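(* Let $(X_t)_{t\ge0}$ be a Lévy process with parameters $(b,\nu_\sigma)$ and suppose that $E_{b,\nu_\sigma}|X_1|^{4+\gamma}<\infty$ for some $\gamma>0$. Let $w(u)=(\log(e+|u|))^{-1/2-\delta}$ with any $\delta>0$. Let the estimators $\widehat b_n\in\mathbb{R}$ and $\widehat\nu_{\sigma,n}\in\mathcal{M}(\mathbb{R})$ be chosen such that $$d^{(2)}\big(\phi(\cdot;\widehat b_n,\widehat\nu_{\sigma,n}),\widehat\phi_n\big)\le\inf_{\tilde b\in\mathbb{R},\,\tilde\nu_\sigma\in\mathcal{M}(\mathbb{R})}d^{(2)}\big(\phi(\cdot;\tilde b,\tilde\nu_\sigma),\widehat\phi_n\big)+\delta_n,$$ where $(\delta_n)$ is a sequence of positive reals with $\delta_n=O(n^{-1/2})$. Then $$E_{b,\nu_\sigma}|\widehat b_n-b|=O(n^{-1/2}),$$ and for any $s>0$ $$\ell_s(\widehat\nu_{\sigma,n},\nu_\sigma)=O_{P_{b,\nu_\sigma}}\left(n^{-1/2}\cdot\sup_{u\in[0,U_n]}\left\{\frac{(1+u)^{2-s}}{w(u)|\phi(u;b,\nu_\sigma)|}\right\}\right),$$ where $$U_n:=\inf\left\{u>0:\ \frac{(1+u)^2n^{-1/2}}{w(u)|\phi(u;b,\nu_\sigma)|}\ge1\right\}.$$ The constants in the risk bounds depend continuously on $|b|$ and $\nu_\sigma(\mathbb{R})$. Moreover, for any $s>0$, in the following specific cases $\ell_s(\widehat\nu_{\sigma,n},\nu_\sigma)$ is $O_{P_{b,\nu_\sigma}}(r_n)$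 with the following rates $r_n$: (a) (Gaussian part) if $\sigma^2>0$: $r_n=(\log n)^{-s/2}$; (b) (exponential decay) if for some $\alpha>0$, $C>0$ one has $|\phi(u;b,\nu_\sigma)|\ge Ce^{-\alpha|u|}$ for all $u\in\mathbb{R}$: $r_n=(\log n)^{-s}$; (c) (polynomial decay of order $\beta\ge0$) if for some $C>0$ one has $|\phi(u;b,\nu_\sigma)|\ge C(1+|u|)^{-\beta}$ for all $u\in\mathbb{R}$: $r_n=\big[(\log n)^{1/2+2\delta}n^{-1/2}\big]^{s/\beta}\vee n^{-1/2}$ (to be read as $n^{-1/2}$ when $\beta=0$).
   Context: $\mathcal{M}(\mathbb{R})$ is the set of finite (non-negative) Borel measures on $\mathbb{R}$. Only Lévy processes with finite second moments are considered. If such a process has volatility $\sigma\ge0$, Lévy (jump) measure $\nu$ (then $\int x^2\nu(dx)<\infty$) and mean $b=E[X_1]$, it is parametrised by $(b,\nu_\sigma)$ with $\nu_\sigma(dx)=\sigma^2\delta_0(dx)+x^2\nu(dx)\in\mathcal{M}(\mathbb{R})$ (so $\sigma^2=\nu_\sigma(\{0\})$), and $E[e^{iuX_t}]=\exp(t\Psi(u;b,\nu_\sigma))$ with $$\Psi(u;b,\nu_\sigma)=iub+\int_{\mathbb{R}}\frac{e^{iux}-1-iux}{x^2}\,\nu_\sigma(dx),$$ the integrand at $x=0$ being $-u^2/2$. Write $\phi(u;b,\nu_\sigma)=\exp(\Psi(u;b,\nu_\sigma))$, and $P_{b,\nu_\sigma}$, $E_{b,\nu_\sigma}$ for probability and expectation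 under these parameters. The process is observed at times $0,1,\dots,n$, and $\widehat\phi_n(u)=\frac1n\sum_{t=1}^ne^{iu(X_t-X_{t-1})}$. With $\|g\|_{L^\infty(w)}=\sup_{u\in\mathbb{R}}|g(u)|w(u)$, set $d^{(2)}(\phi_1,\phi_2)=\sum_{k=0}^2\|\phi_1^{(k)}-\phi_2^{(k)}\|_{L^\infty(w)}$, where $^{(k)}$ denotes the $k$-th derivative. With $\mathcal{F}f(u)=\int f(x)e^{iux}dx$ for $f\in L^1(\mathbb{R})$, let $F_s=\{f:\int(1+|u|)^s|\mathcal{F}f(u)|\,du\le1\}$ (such $f$ are continuous and bounded by one), and define the loss $$\ell_s(\widehat\mu,\mu)=\sup_{f\in F_s}\Big|\int f\,d\widehat\mu-\int f\,d\mu\Big|,\qquad\widehat\mu,\mu\in\mathcal{M}(\mathbb{R}).$$ $Y_n=O_P(r_n)$ means that $Y_n/r_n$ is bounded in probability as $n\to\infty$; $\vee$ denotes the maximum.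
   Formalization: The constants in the risk bounds are continuous functions not of |b| and ν_σ(R) alone but also of E|X_1|^{4+γ} and of the constant D in δ_n ≤ D n^{-1/2}; dependence on |b| and ν_σ(R) only fails, e.g. for b=0, ν_σ=δ_K, n≈K²/100, K→∞. *)

(* Defs.v *)
From HB Require Import structures.
From mathcomp Require Import all_boot all_order all_algebra.
From mathcomp Require Import complex.
From mathcomp Require Import all_classical all_reals all_analysis.

Set Implicit Arguments.
Unset Strict Implicit.
Unset Printing Implicit Defensive.

Import Order.TTheory GRing.Theory Num.Theory.
Import numFieldNormedType.Exports.
Import ComplexField.Normc.

Local Open Scope classical_set_scope.
Local Open Scope ring_scope.
Local Open Scope complex_scope.

Notation finite_borel_measure R :=
  {finite_measure set (measurableTypeR R) -> \bar R}.

Section complex_valued_functions.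
Context {R : realType}.

(* e^{iy} *)
Definition cis (y : R) : R[i] := cos y +i* sin y.

Definition cexp (z : R[i]) : R[i] := (expR (complex.Re z))%:C * cis (complex.Im z).

Definition cintegral d (T : measurableType d) (mu : {measure set T -> \bar R})
    (f : T -> R[i]) : R[i] :=
  (\int[mu]_x complex.Re (f x)) +i* (\int[mu]_x complex.Im (f x)).

Definition cderive (k : nat) (f : R -> R[i]) (u : R) : R[i] :=
  derive1n k (fun v => complex.Re (f v)) u +i* derive1n k (fun v => complex.Im (f v)) u.

End complex_valued_functions.

Section levy_exponent.
Context {R : realType}.

Definition levy_kernel (u x : R) : R[i] :=
  if x == 0 then (- (u ^+ 2 / 2))%:C
  else (cis (u * x) - 1 - (u * x)*i) / (x ^+ 2)%:C.

Definition levy_exponent (b : R) (nu : finite_borel_measure R) (u : R) : R[i] :=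
  (u * b)*i + cintegral nu (levy_kernel u).

Definition levy_cf (b : R) (nu : finite_borel_measure R) (u : R) : R[i] :=
  cexp (levy_exponent b nu u).

End levy_exponent.

Section levy_processes.
Context {R : realType} {d : measure_display} {Omega : measurableType d}.
Context {P : probability Omega R}.
(* Only the times t >= 0 are ever used. *)
Implicit Type X : R -> {RV P >-> R}.

Definition incr X (s t : R) (w : Omega) : R := X t w - X s w.

Record levy_process X : Prop := LevyProcess {
  levy_start : {ae P, forall w, X 0 w = 0} ;
  levy_indep : forall (k : nat) (t : nat -> R) (B : nat -> set R),
    0 <= t 0%N -> {homo t : i j / (i <= j)%N >-> i <= j} ->
    (forall i, measurable (B i)) ->
    P (\bigcap_(i < k) (incr X (t i) (t i.+1) @^-1` B i)) =
    (\prod_(i < k) P (incr X (t i) (t i.+1) @^-1` B i))%E ;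
  levy_stationary : forall (s h : R) (B : set R),
    0 <= s -> 0 <= h -> measurable B ->
    P (incr X s (s + h) @^-1` B) = P (incr X 0 h @^-1` B) ;
  levy_cadlag : {ae P, forall w, forall t : R, 0 <= t ->
    X s w @[s --> t^'+] --> X t w /\
    (0 < t -> cvg (X s w @[s --> t^'-])) }
}.

(* A Levy process with finite second moments, with mean b = E X_1 and with
   nu = sigma^2 delta_0 + x^2 (jump measure)(dx). *)
Record levy_process_with X (b : R) (nu : finite_borel_measure R) : Prop :=
  LevyProcessWith {
  levy_is_process : levy_process X ;
  levy_square_integrable :
    forall t : R, 0 <= t -> ('E_P[fun w => (X t w ^+ 2)%R] < +oo)%E ;
  levy_mean : ('E_P[X 1%R] = b%:E)%E ;
  levy_cfE : forall t u : R, 0 <= t ->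
    cintegral P (fun w => cis (u * X t w)) = cexp (t%:C * levy_exponent b nu u)
}.

Definition empirical_cf X (n : nat) (w : Omega) (u : R) : R[i] :=
  (n%:R^-1)%:C * \sum_(1 <= t < n.+1) cis (u * incr X t.-1%:R t%:R w).

End levy_processes.

Section minimum_distance.
Context {R : realType}.

Definition log_weight (delta u : R) : R :=
  ln (expR 1 + `|u|) `^ (- (1 / 2) - delta).

Definition weighted_sup_norm (w : R -> R) (g : R -> R[i]) : \bar R :=
  ereal_sup [set (normc (g u) * w u)%:E | u in [set: R]].

Definition dist2 (w : R -> R) (f g : R -> R[i]) : \bar R :=
  (\sum_(k < 3) weighted_sup_norm w (fun u => cderive k f u - cderive k g u)%R)%E.

Definition near_minimizer (w : R -> R) (g : R -> R[i]) (eps : R)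
    (b : R) (nu : finite_borel_measure R) : Prop :=
  (dist2 w (levy_cf b nu) g <=
   ereal_inf [set dist2 w (levy_cf p.1 p.2) g
             | p in [set: R * finite_borel_measure R]] + eps%:E)%E.

End minimum_distance.

Section loss.
Context {R : realType}.

Definition fourier (f : R -> R) (u : R) : R[i] :=
  cintegral (@lebesgue_measure R) (fun x => (f x)%:C * cis (u * x)).

(* An L^1 function with integrable Fourier transform has exactly one continuous
   version; it is the one integrated against measures that may have atoms. *)
Definition test_class (s : R) : set (R -> R) :=
  [set f | [/\ continuous f,
    (@lebesgue_measure R).-integrable [set: R] (EFin \o f) &
    (\int[@lebesgue_measure R]_u
       ((1 + `|u|) `^ s * normc (fourier f u))%:E <= 1)%E]].

Definition loss (s : R) (mu1 mu2 : finite_borel_measure R) : \bar R :=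
  ereal_sup [set `|\int[mu1]_x f x - \int[mu2]_x f x|%:E | f in test_class s].

End loss.

Section rates.
Context {R : realType}.

Definition root_rate (n : nat) : R := (Num.sqrt n%:R)^-1.

(* U_n, with g = |phi| *)
Definition cutoff (w g : R -> R) (n : nat) : R :=
  inf [set u : R | 0 < u /\ 1 <= (1 + u) ^+ 2 * root_rate n / (w u * g u)].

Definition general_rate (s : R) (w g : R -> R) (n : nat) : R :=
  root_rate n *
  sup [set (1 + u) `^ (2 - s) / (w u * g u) | u in `[0, cutoff w g n]].

(* Outer probability, since the event need not be assumed measurable; on
   measurable events it is P. *)
Definition bounded_in_prob d (Omega : measurableType d)
    (P : probability Omega R) (Y : nat -> Omega -> \bar R) (r : nat -> R) :=
  forall eps : R, 0 < eps -> exists M : R, \forall n \near \oo,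
    ((P^*)%mu [set w | ((M * r n)%:E < `|Y n w|)%E] <= eps%:E)%E.

End rates.

Section setting.
Context {R : realType} {d : measure_display} {Omega : measurableType d}.

Definition abs_moment (P : probability Omega R) (p : R) (Y : {RV P >-> R}) :
  \bar R := ('E_P[fun o => (`|Y o| `^ p)%R])%E.

(* The estimators are random elements of R and M(R); nothing is required of
   them for n = 0, nor that o |-> nuhat n o be measurable. *)
Record min_distance_setting (P : probability Omega R) (gamma delta : R)
    (X : R -> {RV P >-> R}) (b : R) (nu : finite_borel_measure R)
    (dn : nat -> R) (bhat : nat -> {RV P >-> R})
    (nuhat : nat -> Omega -> finite_borel_measure R) : Prop :=
  MinDistanceSetting {
  setting_levy : levy_process_with X b nu ;
  setting_moment : (abs_moment (4 + gamma)%R (X 1%R) < +oo)%E ;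
  setting_tolerance : forall n, 0 < dn n ;
  setting_minimizer : forall n o, (0 < n)%N ->
    near_minimizer (log_weight delta) (empirical_cf X n o) (dn n)
      (bhat n o) (nuhat n o)
}.

End setting.

(* Main.v *)
Require Import Defs.
From HB Require Import structures.
From mathcomp Require Import all_boot all_order all_algebra.
From mathcomp Require Import complex.
From mathcomp Require Import all_classical all_reals all_analysis.
From mathcomp Require Import measurable_realfun.
From mathcomp Require Import ring lra zify.

(** Write [psi = log phi]. Its second derivative is minus the Fourier transform of
[nu] (lemma [psi2E]), and the loss is controlled by any bound [B (1 + |u|) ^ s] on
the difference of two Fourier transforms ([loss_le], by Fourier inversion). So the
estimation of [nu] reduces to that of [psi''], uniformly with that growth.

The empirical characteristic function and its first two derivatives are within
[O(n ^ (-1/2))] of those of [phi] in the weighted supremum norm, on average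
([empirical_process_sup], [cf_deviation]). After symmetrization, chaining along
dyadic grids bounds the maximum over frequencies up to [2 ^ (2 ^ i)] by a multiple
of [sqrt (n 2 ^ i)]: this cost is the logarithm of the frequency to the power
[1/2], which the weight compensates with a summable remainder. The moment of order
[4 + gamma] gives an envelope in [L^2] together with some Hoelder regularity in
[u] of [x ^ 2 e ^ (i u x)]. The minimum distance estimator inherits the bound: its
jets of order two are at a weighted distance [D = O(n ^ (-1/2))] from those of
[phi] ([near_minimizer_jets]). At [u = 0], where [phi' = i b] and [w = 1], this is
already the bound on the drift.

For [psi''], let [e = D / w]. Where [|phi| >= 2 e], one can divide by [phi]: the
error is at most a multiple of [(1 + |u|) ^ 2 e / |phi|], because [psi'] grows at
most linearly ([second_log_derivative_stable]). Elsewhere the error is at most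
twice the sum of the two total masses, and the mass of the estimator is itself
read off its jet at [0]. Hence the error is at most
[K min (1, (1 + |u|) ^ 2 D / (w |phi|))]. The cutoff [U_n] is the point where the
second bound reaches the first one; beyond it the factor [(1 + |u|) ^ s] alone
makes the first bound small enough. This is the general rate ([loss_le_general]).

The special rates come from the same minimum. If [|phi|] decreases no faster than
[exp (- kappa |u| ^ p)], one cuts at a small multiple of [(log n) ^ (1 / p)]
([exponential_rate]); for a Gaussian part [p = 2], since [|phi|] is at least
[exp (- nu(R) u ^ 2)]. If [|phi|] decreases polynomially, the factor
[(1 + |u|) ^ 2] disappears because [psi'] is bounded ([psi1_bounded]): the kernel
of [psi'] is at most [min (|u|, 2 / |x|)], which is dominated by a combination with
geometric weights of the kernels of [- Re psi (2 ^ k)], and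
[- Re psi (2 ^ k) = - log |phi (2 ^ k)|] is linear in [k]. The two bounds are then
interpolated ([polynomial_rate_rough]), unless the test functions are smooth
enough for the second one alone to suffice ([polynomial_rate_smooth]). *)

Set Implicit Arguments.
Unset Strict Implicit.
Unset Printing Implicit Defensive.

Import Order.TTheory GRing.Theory Num.Theory.
Import numFieldNormedType.Exports.
Import ComplexField.Normc.

Local Open Scope classical_set_scope.
Local Open Scope ring_scope.

(** * Continuous functions and real-valued integrals *)

Section continuous_functions.
Context {R : realType}.

Lemma continuous_add {T : topologicalType} (f g : T -> R) :
  continuous f -> continuous g -> continuous (fun x => f x + g x).
Proof. by move=> cf cg x; exact: cvgD (cf x) (cg x). Qed.

Lemma continuous_mul {T : topologicalType} (f g : T -> R) :
  continuous f -> continuous g -> continuous (fun x => f x * g x).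
Proof. by move=> cf cg x; exact: cvgM (cf x) (cg x). Qed.

Lemma continuous_opp {T : topologicalType} (f : T -> R) :
  continuous f -> continuous (fun x => - f x).
Proof. by move=> cf x; exact: cvgN (cf x). Qed.

Lemma continuous_cst {T : topologicalType} (c : R) : continuous (fun _ : T => c).
Proof. by move=> x; exact: cvg_cst. Qed.

Lemma continuous_id : continuous (fun x : R => x).
Proof. by move=> x; exact: cvg_id. Qed.

Lemma continuous_comp_fun (f g : R -> R) : continuous f -> continuous g ->
  continuous (fun x : R => g (f x) : R).
Proof. by move=> cf cg x; exact: (continuous_comp (cf x) (cg _)). Qed.

Lemma continuous_scalel (c : R -> R) (x : R) : continuous c ->
  continuous (fun u : R => c (u * x) : R).
Proof.
move=> cc; apply: continuous_comp_fun => //.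
by apply: continuous_mul; [exact: continuous_id|exact: continuous_cst].
Qed.

Lemma continuous_scaler (c : R -> R) (u : R) : continuous c ->
  continuous (fun x : R => c (u * x) : R).
Proof.
move=> cc; apply: continuous_comp_fun => //.
by apply: continuous_mul; [exact: continuous_cst|exact: continuous_id].
Qed.

Lemma derivable_continuous (f : R -> R) :
  (forall x : R, derivable f x 1) -> continuous f.
Proof. by move=> df x; exact/differentiable_continuous/derivable1_diffP. Qed.

Lemma is_derive_continuous (f df : R -> R) :
  (forall x : R, is_derive x 1 f (df x)) -> continuous f.
Proof. by move=> fd; apply: derivable_continuous => x; case: (fd x). Qed.

Lemma continuous_sumr n (f : 'I_n -> R -> R) :
  (forall i, continuous (f i)) -> continuous (fun x => \sum_i f i x).
Proof.
by move=> cf; apply: continuous_big => //; exact: add_continuous.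
Qed.

End continuous_functions.

Section real_integrals.
Context {R : realType} d (T : measurableType d).

Lemma integrable_sumr (mu : {measure set T -> \bar R}) n (f : 'I_n -> T -> R) :
  (forall i, mu.-integrable setT (EFin \o f i)) ->
  mu.-integrable setT (EFin \o (fun x => \sum_i f i x)).
Proof.
move=> fi; rewrite (_ : _ \o _ = fun x => (\sum_i (f i x)%:E)%E).
  by apply: integrable_sum => // i _; exact: fi.
by apply/funext => x /=; rewrite sumEFin.
Qed.

Lemma Rintegral_sum (mu : {measure set T -> \bar R}) n (f : 'I_n -> T -> R) :
  (forall i, mu.-integrable setT (EFin \o f i)) ->
  \int[mu]_x (\sum_i f i x) = \sum_i \int[mu]_x f i x.
Proof.
elim: n f => [|n ih] f fi.
  rewrite big_ord0; under eq_Rintegral do rewrite big_ord0.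
  by rewrite /Rintegral integral0.
rewrite big_ord_recl -ih//; under eq_Rintegral do rewrite big_ord_recl.
by rewrite RintegralD//; exact: integrable_sumr.
Qed.

Lemma integrable_dominated (mu : {measure set T -> \bar R}) (f g : T -> R) :
  measurable_fun setT f -> (forall x, `|f x| <= g x) ->
  mu.-integrable setT (EFin \o g) -> mu.-integrable setT (EFin \o f).
Proof.
move=> mf fg; apply: le_integrable => //; first exact/measurable_EFinP.
by move=> x _ /=; rewrite lee_fin (le_trans (fg x))// ler_norm.
Qed.

Lemma bounded_integrable (mu : {finite_measure set T -> \bar R}) (f : T -> R) c :
  measurable_fun setT f -> (forall x, `|f x| <= c) ->
  mu.-integrable setT (EFin \o f).
Proof.
move=> mf fc; apply: (integrable_dominated mf fc); exact: finite_measure_integrable_cst.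
Qed.

Lemma norm_Rintegral_le (mu : {measure set T -> \bar R}) (f g : T -> R) :
  measurable_fun setT f -> (forall x, `|f x| <= g x) ->
  mu.-integrable setT (EFin \o g) -> `|\int[mu]_x f x| <= \int[mu]_x g x.
Proof.
move=> mf fg ig; have fi := integrable_dominated mf fg ig.
apply: (le_trans (le_normr_Rintegral measurableT fi)).
apply: le_Rintegral => //.
by apply: integrable_dominated ig; [exact: measurableT_comp|
  move=> x; rewrite normr_id].
Qed.

Lemma Rintegral_cstT (mu : {finite_measure set T -> \bar R}) (c : R) :
  \int[mu]_x c = c * fine (mu setT).
Proof. by rewrite Rintegral_cst. Qed.

Lemma norm_Rintegral_bound (mu : {finite_measure set T -> \bar R}) (f : T -> R) c :
  measurable_fun setT f -> (forall x, `|f x| <= c) ->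
  `|\int[mu]_x f x| <= c * fine (mu setT).
Proof.
move=> mf fc; rewrite -Rintegral_cstT; apply: norm_Rintegral_le => //.
exact: finite_measure_integrable_cst.
Qed.

Lemma EFin_Rintegral (mu : {measure set T -> \bar R}) (f : T -> R) :
  mu.-integrable setT (EFin \o f) ->
  ((\int[mu]_x f x)%:E = \int[mu]_x (f x)%:E)%E.
Proof. by move=> fi; rewrite /Rintegral fineK//; exact: integrable_fin_num. Qed.

Lemma integrable_affine (mu : {finite_measure set T -> \bar R}) (f : T -> R) a b :
  mu.-integrable setT (EFin \o f) ->
  mu.-integrable setT (EFin \o (fun x => a + b * f x)).
Proof.
move=> fi; rewrite (_ : _ \o _ =
    (EFin \o (fun=> a)) \+ (fun x => b%:E * (EFin \o f) x)%E)%E.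
  by apply: integrableD => //; [exact: finite_measure_integrable_cst|exact: integrableZl].
by apply/funext => x /=; rewrite EFinD EFinM.
Qed.

Lemma Rintegral_affine (mu : {finite_measure set T -> \bar R}) (f : T -> R) a b :
  mu.-integrable setT (EFin \o f) ->
  \int[mu]_x (a + b * f x) = a * fine (mu setT) + b * \int[mu]_x f x.
Proof.
move=> fi; rewrite RintegralD//.
- by rewrite Rintegral_cstT RintegralZl.
- exact: finite_measure_integrable_cst.
- rewrite (_ : _ \o _ = (fun x => b%:E * (EFin \o f) x)%E).
    exact: integrableZl.
  by apply/funext => x /=; rewrite EFinM.
Qed.

Lemma probability_Rintegral_affine (P : probability T R) (f : T -> R) a b :
  P.-integrable setT (EFin \o f) ->
  \int[P]_x (a + b * f x) = a + b * \int[P]_x f x.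
Proof.
move=> fi; rewrite (Rintegral_affine (mu := P))//.
by have /(congr1 fine) /= -> := probability_setT P; rewrite mulr1.
Qed.

Lemma integrable_scale (mu : {measure set T -> \bar R}) (c : R) (f : T -> R) :
  mu.-integrable setT (EFin \o f) -> mu.-integrable setT (EFin \o (fun x => c * f x)).
Proof.
move=> fi; rewrite (_ : _ \o _ = fun x => (c%:E * (EFin \o f) x)%E).
  exact: integrableZl.
by apply/funext => x /=; rewrite EFinM.
Qed.

Lemma continuous_Rintegral (mu : {measure set T -> \bar R}) (F : R -> T -> R)
    (g : T -> R) :
  (forall v, measurable_fun setT (F v)) -> (forall x, continuous (F ^~ x)) ->
  (forall v x, `|F v x| <= g x) -> mu.-integrable setT (EFin \o g) ->
  continuous (fun v : R => \int[mu]_x F v x : R).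
Proof.
move=> mF cF Fg ig u.
have H : {in `]u - 1, u + 1[%classic, continuous (fun v : R => \int[mu]_x F v x : R)}.
  apply: (@continuity_under_integral _ _ _ mu F setT measurableT (u - 1) (u + 1) _ _ g) => //.
  - by move=> v _; exact: integrable_dominated (mF v) (Fg v) ig.
  - by apply: aeW => y _ v _; exact: cF.
  - by move=> v _; apply: aeW => y _; exact: Fg.
by apply: H; rewrite inE/= in_itv/= ltrBlDr ltrDl ltr01.
Qed.

End real_integrals.

(** * The logarithmic weight *)

Section weight.
Context {R : realType}.

Lemma ln_expR1D_ge1 (u : R) : 1 <= ln (expR 1 + `|u|).
Proof.
by rewrite -[leLHS]expRK ler_ln ?posrE ?ltr_wpDr ?expR_gt0 ?lerDl.
Qed.

Lemma ln_expR1D_gt0 (u : R) : 0 < ln (expR 1 + `|u|).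
Proof. exact: lt_le_trans (ln_expR1D_ge1 u). Qed.

Variables (delta : R).
Hypothesis delta0 : 0 < delta.

Lemma log_weight_gt0 (u : R) : 0 < log_weight delta u.
Proof. by rewrite powR_gt0// ln_expR1D_gt0. Qed.

Lemma log_weight_le1 (u : R) : log_weight delta u <= 1.
Proof.
rewrite /log_weight -opprD powRN invf_le1 ?powR_gt0 ?ln_expR1D_gt0//.
rewrite -[leLHS](powRr0 (ln (expR 1 + `|u|))) ler_powR ?ln_expR1D_ge1//.
by rewrite addr_ge0 ?(ltW delta0).
Qed.

Lemma log_weight0 : log_weight delta 0 = 1.
Proof. by rewrite /log_weight normr0 addr0 expRK powR1. Qed.

Lemma log_weightN (u : R) : log_weight delta (- u) = log_weight delta u.
Proof. by rewrite /log_weight normrN. Qed.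

Lemma continuous_log_weight : continuous (log_weight delta).
Proof.
move=> u; rewrite /log_weight.
have -> : (fun u => ln (expR 1 + `|u|) `^ (- (1 / 2) - delta)) =
    (fun u : R => expR ((- (1 / 2) - delta) * ln (ln (expR 1 + `|u|)))).
  by apply/funext => v; rewrite /powR gt_eqF ?ln_expR1D_gt0.
apply: continuous_comp; last exact: continuous_expR.
apply: continuousM; first exact: cst_continuous.
apply: continuous_comp; last exact/continuous_ln/ln_expR1D_gt0.
apply: continuous_comp; last exact/continuous_ln/ltr_pwDl/normr_ge0/expR_gt0.
by apply: continuousD; [exact: cst_continuous|exact: norm_continuous].
Qed.

(** The maximum over the frequencies of a block [2 ^ (2 ^ i), 2 ^ (2 ^ (i + 1))] costs
the factor [sqrt (2 ^ (i + 1))], of the order of the logarithm of the frequency to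
the power [1/2]; the part [- delta] of the exponent of the weight is left over and
makes the blocks summable. *)
Lemma log_weight_decay (i : nat) (u : R) : 2 ^+ (2 ^ i) < u ->
  log_weight delta u * Num.sqrt (2 ^ i.+1)%:R <=
  Num.sqrt 2 * ln 2 `^ (- (1 / 2) - delta) * (2 `^ (- delta)) ^+ i.
Proof.
move=> ui.
have u0 : 0 < u by apply: lt_trans ui; rewrite exprn_gt0.
have l2 : 0 < ln 2 :> R by rewrite ln_gt0// ltr1n.
pose q : R := 2 ^+ i; have q0 : 0 < q by rewrite exprn_gt0.
have L : q * ln 2 <= ln (expR 1 + `|u|).
  rewrite /q -natrX mulr_natl -lnXn// ler_ln ?posrE ?exprn_gt0//.
  by rewrite gtr0_norm// (le_trans (ltW ui))// lerDr expR_ge0.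
have -> : Num.sqrt (2 ^ i.+1)%:R = Num.sqrt 2 * q `^ (1 / 2).
  by rewrite expnS natrM sqrtrM// natrX -/q div1r powR12_sqrt// ltW.
have -> : (2 `^ (- delta)) ^+ i = q `^ (- delta).
  by rewrite -powR_mulrn ?powR_ge0// powRAC powR_mulrn.
have H : log_weight delta u <= q `^ (- (1 / 2) - delta) * ln 2 `^ (- (1 / 2) - delta).
  rewrite -powRM ?(ltW q0) ?(ltW l2)// /log_weight -opprD !powRN.
  rewrite lef_pV2 ?posrE ?powR_gt0 ?ln_expR1D_gt0 ?mulr_gt0//.
  by rewrite ge0_ler_powR ?nnegrE ?addr_ge0 ?(ltW delta0)//
    ?(ltW (ln_expR1D_gt0 _))// ltW ?mulr_gt0.
apply: (le_trans (ler_wpM2r _ H)); first by rewrite mulr_ge0 ?sqrtr_ge0 ?powR_ge0.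
rewrite le_eqVlt; apply/orP; left; apply/eqP.
rewrite [q `^ (- (1 / 2) - delta)]powRD; last by rewrite (gt_eqF q0) implybT.
have -> : q `^ (- (1 / 2)) = (q `^ (1 / 2))^-1 by rewrite powRN.
by field; rewrite gt_eqF// powR_gt0.
Qed.

End weight.

(** * Random signs *)

Section rademacher.
Context {R : realType}.

(** The sharp exponent is [x ^ 2 / 2]; the larger one is within reach of
[1 + y <= expR y] alone, by [expR x <= 1 / (1 - x)] for small [x], and any constant
suffices for a sub-Gaussian bound. *)
Lemma cosh_le_expR_sqr (x : R) : expR x + expR (- x) <= 2 * expR (2 * x ^+ 2).
Proof.
have [xs|xb] := lerP (x ^+ 2) (1 / 4).
- have xlt : `|x| <= 1 / 2.
    rewrite -(@ler_pXn2r _ 2) ?nnegrE// real_normK ?num_real//; lra.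
  have [x1 x2] : - (1 / 2) <= x /\ x <= 1 / 2 by apply/andP; rewrite -ler_norml.
  have e1 : expR x <= (1 - x)^-1.
    rewrite -[x in expR x]opprK expRN lef_pV2 ?posrE ?expR_gt0//; last lra.
    exact: expR_ge1Dx.
  have e2 : expR (- x) <= (1 + x)^-1.
    rewrite expRN lef_pV2 ?posrE ?expR_gt0//; last lra.
    exact: expR_ge1Dx.
  apply: (le_trans (lerD e1 e2)).
  have -> : (1 - x)^-1 + (1 + x)^-1 = 2 * (1 - x ^+ 2)^-1.
    field; rewrite !gt_eqF//; nra.
  rewrite ler_pM2l//.
  apply: le_trans (expR_ge1Dx _).
  have x0 : 0 <= x ^+ 2 by exact: sqr_ge0.
  rewrite -[leLHS]mul1r ler_pdivrMr; nra.
- have h y : y ^+ 2 = x ^+ 2 -> expR y <= expR (2 * x ^+ 2).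
    move=> yx; rewrite ler_expR -yx.
    have : 0 <= (y - 1 / 2) ^+ 2 by exact: sqr_ge0.
    have : 0 <= (y - 1 / 4) ^+ 2 by exact: sqr_ge0.
    nra.
  have := h x erefl; have := h (- x) (sqrrN _); lra.
Qed.

(** A choice of signs is encoded by the set [J] of the indices with sign [+ 1], so
that averaging over all choices is a finite sum. *)
Definition signed_sum (I : finType) (a : I -> R) (J : {set I}) : R :=
  \sum_i (if i \in J then a i else - a i).

Definition sign_average (I : finType) (F : {set I} -> R) : R :=
  (2 ^+ #|I|)^-1 * \sum_J F J.

Section sign_average.
Variable I : finType.
Implicit Types (F G : {set I} -> R) (a : I -> R).

Lemma sign_average_le F G : (forall J, F J <= G J) ->
  sign_average F <= sign_average G.
Proof. by move=> FG; rewrite ler_wpM2l ?invr_ge0 ?exprn_ge0// ler_sum. Qed.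

Lemma sign_average_ge0 F : (forall J, 0 <= F J) -> 0 <= sign_average F.
Proof. by move=> F0; rewrite mulr_ge0 ?invr_ge0 ?exprn_ge0// sumr_ge0. Qed.

Lemma sign_averageD F G :
  sign_average (fun J => F J + G J) = sign_average F + sign_average G.
Proof. by rewrite /sign_average big_split mulrDr. Qed.

Lemma sign_averageZ c F :
  sign_average (fun J => c * F J) = c * sign_average F.
Proof. by rewrite /sign_average -mulr_sumr mulrCA. Qed.

Lemma sign_average_cst c : sign_average (fun _ : {set I} => c) = c.
Proof.
have cI : #|{: {set I}}| = (2 ^ #|I|)%N.
  by rewrite -(cardsT {set I}) -powersetT card_powerset cardsT.
rewrite /sign_average sumr_const cI.
by rewrite -[c *+ _]mulr_natl natrX mulrA mulVf ?mul1r// expf_neq0.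
Qed.

Lemma sign_average_sum n (F : nat -> {set I} -> R) :
  sign_average (fun J => \sum_(k < n) F k J) =
  \sum_(k < n) sign_average (F k).
Proof.
by rewrite /sign_average exchange_big -mulr_sumr.
Qed.

(** The average of a product of functions of distinct signs factorizes. *)
Lemma sign_average_expR a c :
  sign_average (fun J => expR (c * signed_sum a J)) <=
  expR (2 * c ^+ 2 * \sum_i a i ^+ 2).
Proof.
have -> : sign_average (fun J => expR (c * signed_sum a J)) =
    \prod_i ((expR (c * a i) + expR (- (c * a i))) / 2).
  rewrite big_split/= prodr_const mulrC /sign_average exprVn; congr (_ * _).
  rewrite bigA_distr; apply: eq_bigr => J _.
  rewrite /signed_sum mulr_sumr expR_sum; apply: eq_bigr => i _.
  by case: ifP => // _; rewrite mulrN.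
rewrite mulr_sumr expR_sum; apply: ler_prod => i _.
rewrite divr_ge0 ?addr_ge0 ?expR_ge0//=.
by rewrite ler_pdivrMr// [leRHS]mulrC -[2 * c ^+ 2 * _]mulrA -exprMn cosh_le_expR_sqr.
Qed.

Lemma sign_average_expR_norm a (c : R) : 0 <= c ->
  sign_average (fun J => expR (c * `|signed_sum a J|)) <=
  2 * expR (2 * c ^+ 2 * \sum_i a i ^+ 2).
Proof.
move=> c0.
have -> : 2 * expR (2 * c ^+ 2 * \sum_i a i ^+ 2) =
    expR (2 * c ^+ 2 * \sum_i a i ^+ 2) +
    expR (2 * (- c) ^+ 2 * \sum_i a i ^+ 2) by rewrite sqrrN; ring.
apply: le_trans (lerD (sign_average_expR a c) (sign_average_expR a (- c))).
rewrite -sign_averageD; apply: sign_average_le => J.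
by case: ger0P => _; rewrite ?mulrN ?mulNr;
  rewrite ?lerDl ?lerDr expR_ge0.
Qed.

(** The maximum of [n] sub-Gaussian variables. For every threshold [t],
[x <= t + expR (c (x - t)) / c]; the maximum of the exponentials is at most their
sum, whose average is at most one for the threshold [t] chosen below. *)
Lemma sign_average_max (n : nat) (a : nat -> I -> R) (s l : R) :
  0 < s -> 1 <= l -> 2 * n%:R <= expR (l - 1) ->
  (forall k, (k < n)%N -> \sum_i a k i ^+ 2 <= s ^+ 2) ->
  sign_average (fun J => \big[Num.max/0]_(k < n) `|signed_sum (a k) J|) <=
  3 * s * Num.sqrt l.
Proof.
move=> s0 l1 nl asl; have l0 : 0 < l by exact: lt_le_trans l1.
set q : R := Num.sqrt l; have q0 : 0 < q by rewrite sqrtr_gt0.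
have ql : q ^+ 2 = l by rewrite sqr_sqrtr// ltW.
pose c : R := q / s; have c0 : 0 < c by rewrite divr_gt0.
pose t : R := 2 * c * s ^+ 2 + (l - 1) / c.
have step J : \big[Num.max/0]_(k < n) `|signed_sum (a k) J| <=
    t + c^-1 * \sum_(k < n) expR (- c * t) * expR (c * `|signed_sum (a k) J|).
  have t0 : 0 <= c^-1 * \sum_(k < n) expR (- c * t) * expR (c * `|signed_sum (a k) J|).
    rewrite mulr_ge0 ?invr_ge0 ?(ltW c0)//.
    by apply: sumr_ge0 => i _; rewrite mulr_ge0 ?expR_ge0.
  apply: bigmax_le.
  - rewrite addr_ge0//.
    rewrite /t /c.
    have -> : 2 * (q / s) * s ^+ 2 + (l - 1) / (q / s) = s / q * (3 * l - 1).
      rewrite -ql; field; rewrite !gt_eqF//.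
    by rewrite mulr_ge0 ?divr_ge0 ?(ltW s0) ?(ltW q0)//; lra.
  - move=> k _.
    rewrite (bigD1 k)//= mulrDr addrA -[leLHS]addr0 lerD//; last first.
      rewrite mulr_ge0 ?invr_ge0 ?(ltW c0)//.
    by apply: sumr_ge0 => i _; rewrite mulr_ge0 ?expR_ge0.
    rewrite -expRD -lerBlDl ler_pdivlMl//.
    apply: le_trans (expR_ge1Dx _); lra.
apply: (le_trans (sign_average_le step)).
rewrite sign_averageD sign_average_cst sign_averageZ.
rewrite (sign_average_sum n
  (fun k J => expR (- c * t) * expR (c * `|signed_sum (a k) J|))).
have -> : 3 * s * q = t + c^-1.
  by rewrite /t /c -ql; field; rewrite !gt_eqF.
rewrite lerD2l -[leRHS]mulr1 ler_pM2l ?invr_gt0//.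
apply: (@le_trans _ _ (\sum_(k < n) expR (- c * t) *
    (2 * expR (2 * c ^+ 2 * s ^+ 2)))).
  apply: ler_sum => k _; rewrite sign_averageZ ler_pM2l ?expR_gt0//.
  apply: le_trans (sign_average_expR_norm _ (ltW c0)) _.
  rewrite ler_pM2l// ler_expR ler_wpM2l ?asl//.
  by rewrite mulr_ge0 ?sqr_ge0.
rewrite sumr_const card_ord -[leLHS]mulr_natl.
have E : expR (- c * t) * expR (2 * c ^+ 2 * s ^+ 2) = expR (- (l - 1)).
  by rewrite -expRD; congr expR; rewrite /t; field; rewrite gt_eqF.
have -> : n%:R * (expR (- c * t) * (2 * expR (2 * c ^+ 2 * s ^+ 2))) =
    (2 * n%:R) * expR (- (l - 1)).
  rewrite -[expR (- (l - 1))]E; ring.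
by rewrite expRN ler_pdivrMr ?expR_gt0// mul1r.
Qed.

End sign_average.

End rademacher.
(** * Chaining along dyadic grids *)

Section chaining.
Context {R : realType}.

Definition dyadic (j k : nat) : R := k%:R / 2 ^+ j.

Lemma dyadicS_even j k : dyadic j.+1 (2 * k) = dyadic j k.
Proof.
rewrite /dyadic natrM exprS invfM mulrACA divff ?mul1r//.
Qed.

Lemma dyadic_parent j k :
  `|dyadic j.+1 k - dyadic j k./2| <= 2 ^- j.+1.
Proof.
rewrite -(dyadicS_even j) /dyadic -mulrBl normrM normfV [X in _ / X]gtr0_norm ?exprn_gt0//.
rewrite ler_pdivrMr ?exprn_gt0// mulVf ?expf_neq0// mul2n.
rewrite -{1}(odd_double_half k) natrD addrK.
by case: (odd k); rewrite ?normr1 ?normr0.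
Qed.

(** The partial sum is [b - (a n + b) r ^ n] with [a (1 - r) = 1] and
[b (1 - r) = 5 + a r]. *)
Lemma sum_arith_geo (r : R) n : 0 < r -> r < 1 ->
  \sum_(j < n) r ^+ j * (j + 5)%:R <= (5 + r / (1 - r)) / (1 - r).
Proof.
move=> r0 r1.
have r1' : 0 < 1 - r by rewrite subr_gt0.
pose a : R := (1 - r)^-1; pose b : R := (5 + a * r) / (1 - r).
have -> : (5 + r / (1 - r)) / (1 - r) = b by rewrite [r / _]mulrC.
have a0 : 0 < a by rewrite invr_gt0.
have b0 : 0 < b by rewrite divr_gt0// addr_gt0// mulr_gt0.
suff -> : \sum_(j < n) r ^+ j * (j + 5)%:R = b - (a * n%:R + b) * r ^+ n.
  rewrite gerBl mulr_ge0 ?exprn_ge0 ?(ltW r0)//.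
  by rewrite addr_ge0 ?(ltW b0)// mulr_ge0 ?ler0n ?(ltW a0).
elim: n => [|n ih]; first by rewrite big_ord0 expr0; ring.
rewrite big_ord_recr/= ih exprS -[n.+1]addn1 !natrD /b /a; field.
by rewrite gt_eqF.
Qed.

Section process.
Variables (I : finType) (a : R -> I -> R) (A rho : R).
Hypothesis A0 : 0 < A.
Hypotheses (rho0 : 0 < rho) (rho1 : rho < 1).
(* [a u] lists the values at the frequency [u] of the terms of a random sum *)
Hypothesis size_a : forall u, \sum_i a u i ^+ 2 <= A ^+ 2.
Hypothesis step_a : forall j u v, `|u - v| <= 2 ^- j ->
  \sum_i (a u i - a v i) ^+ 2 <= (A * rho ^+ j) ^+ 2.

Definition grid_max (q j : nat) (s : {set I}) : R :=
  \big[Num.max/0]_(k < (2 ^ (q + j)).+1) `|signed_sum (a (dyadic j k)) s|.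

Lemma grid_cardinal q : 2 * ((2 ^ q).+1)%:R <= expR ((q + 3)%:R - 1) :> R.
Proof.
have -> : (q + 3)%:R - 1 = (q + 2)%:R :> R by rewrite !natrD; ring.
have e2 : 2 <= expR 1 :> R by have := expR_ge1Dx (1 : R); lra.
apply: (@le_trans _ _ (2 ^+ (q + 2))).
  rewrite -natrX -natrM ler_nat expnD mulnC.
  by have := expn_gt0 2 q; move: (2 ^ q)%N => m /=; lia.
rewrite -[(q + 2)%:R]mulr1 expRM_natl.
by rewrite lerXn2r ?nnegrE ?expR_ge0.
Qed.

Lemma signed_sumB u v s :
  signed_sum (a u) s - signed_sum (a v) s =
  signed_sum (fun i => a u i - a v i) s.
Proof.
rewrite /signed_sum -sumrB; apply: eq_bigr => i _.
by case: ifP => // _; rewrite opprB opprK addrC.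
Qed.

Lemma grid_max_succ q j s : grid_max q j.+1 s <= grid_max q j s +
  \big[Num.max/0]_(k < (2 ^ (q + j.+1)).+1)
    `|signed_sum (fun i => a (dyadic j.+1 k) i - a (dyadic j k./2) i) s|.
Proof.
apply: bigmax_le => [|k _]; first by rewrite addr_ge0//; exact: bigmax_ge_id.
have k2 : (k./2 < (2 ^ (q + j)).+1)%N.
  case: k => /= k; rewrite !ltnS addnS expnS => /half_leq.
  by rewrite mul2n doubleK.
have -> : signed_sum (a (dyadic j.+1 k)) s = signed_sum (a (dyadic j k./2)) s +
    signed_sum (fun i => a (dyadic j.+1 k) i - a (dyadic j k./2) i) s.
  by rewrite -signed_sumB addrC subrK.
apply: (le_trans (ler_normD _ _)); apply: lerD.
  exact: (@le_bigmax _ _ _ _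
    (fun k : 'I__ => `|signed_sum (a (dyadic j k)) s|) (Ordinal k2)).
exact: (@le_bigmax _ _ _ _ (fun k : 'I__ => `|signed_sum
  (fun i => a (dyadic j.+1 k) i - a (dyadic j k./2) i) s|) k).
Qed.

(** Chaining: the maximum over a grid is at most the maximum over the integers plus
the maxima of the increments from each grid to the next one. The increments at
level [j] have size [A rho ^ j], while their number only enters through the square
root of its logarithm, which is of order [q + j]. *)
Lemma grid_max_average q j : (0 < q)%N ->
  sign_average (grid_max q j) <=
  3 * A * Num.sqrt q%:R * (2 + (5 + rho / (1 - rho)) / (1 - rho)).
Proof.
move=> q0.
have sq m n : (m <= q * n ^ 2)%N ->
    Num.sqrt m%:R <= Num.sqrt q%:R * n%:R :> R.
  move=> mn; rewrite -[X in _ <= _ * X]ger0_norm// -sqrtr_sqr -sqrtrM//.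
  by rewrite ler_sqrt ?mulr_ge0 ?sqr_ge0// -natrX -natrM ler_nat.
apply: (@le_trans _ _ (3 * A * Num.sqrt q%:R *
    (2 + \sum_(i < j) rho ^+ i * (i + 5)%:R))); last first.
  by rewrite ler_wpM2l ?mulr_ge0 ?sqrtr_ge0 ?(ltW A0)// lerD2l sum_arith_geo.
elim: j => [|j ih].
  rewrite big_ord0 addr0.
  apply: (@le_trans _ _ (3 * A * Num.sqrt (q + 3)%:R)).
    apply: (sign_average_max (a := fun k => a (dyadic 0 k))) => //.
    - by rewrite (ler_nat _ 1) addn_gt0 orbT.
    - by rewrite addn0; exact: grid_cardinal.
  rewrite -[leRHS]mulrA ler_pM2l ?mulr_gt0//; apply: sq; lia.
apply: (le_trans (sign_average_le (grid_max_succ q j))).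
rewrite sign_averageD big_ord_recr/= addrA mulrDr; apply: lerD ih _.
apply: (@le_trans _ _ (3 * (A * rho ^+ j) * Num.sqrt (q + j.+1 + 3)%:R)).
  apply: (sign_average_max (a := fun k i => a (dyadic j.+1 k) i - a (dyadic j k./2) i)).
  - by rewrite mulr_gt0 ?exprn_gt0.
  - by rewrite (ler_nat _ 1) addn_gt0 orbT.
  - exact: grid_cardinal.
  - move=> k _; apply: step_a; apply: le_trans (dyadic_parent _ _) _.
    by rewrite lef_pV2 ?posrE ?exprn_gt0// exprS ler_peMl ?exprn_ge0//; lra.
have -> : 3 * A * Num.sqrt q%:R * (rho ^+ j * (j + 5)%:R) =
  3 * (A * rho ^+ j) * (Num.sqrt q%:R * (j + 5)%:R) by ring.
rewrite ler_pM2l ?mulr_gt0 ?exprn_gt0//; apply: sq; nia.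
Qed.

Variables (om : R -> R) (c tau : R).
Hypotheses (c0 : 0 <= c) (tau0 : 0 < tau) (tau1 : tau < 1).
Hypothesis om_ge0 : forall u, 0 <= om u.
Hypothesis om_le1 : forall u, om u <= 1.
Hypothesis om_decay : forall i u, 2 ^+ (2 ^ i) < u ->
  om u * Num.sqrt (2 ^ i.+1)%:R <= c * tau ^+ i.

Definition weighted_grid_max (i j : nat) (s : {set I}) : R :=
  \big[Num.max/0]_(k < (2 ^ (2 ^ i + j)).+1)
    (om (dyadic j k) * `|signed_sum (a (dyadic j k)) s|).

Lemma weighted_grid_max_succ i j s : weighted_grid_max i.+1 j s <=
  weighted_grid_max i j s +
  c * tau ^+ i / Num.sqrt (2 ^ i.+1)%:R * grid_max (2 ^ i.+1) j s.
Proof.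
have sq0 : 0 < Num.sqrt (2 ^ i.+1)%:R :> R by rewrite sqrtr_gt0 ltr0n expn_gt0.
have co0 : 0 <= c * tau ^+ i / Num.sqrt (2 ^ i.+1)%:R.
  by rewrite divr_ge0 ?(ltW sq0)// mulr_ge0 ?exprn_ge0 ?(ltW tau0).
have W0 : 0 <= weighted_grid_max i j s by exact: bigmax_ge_id.
have G0 : 0 <= grid_max (2 ^ i.+1) j s by exact: bigmax_ge_id.
apply: bigmax_le => [|k _]; first by rewrite addr_ge0 ?(mulr_ge0 co0).
have [kle|klt] := leqP k (2 ^ (2 ^ i + j)).
  rewrite -[leLHS]addr0 lerD ?(mulr_ge0 co0)//.
  have ki : (k < (2 ^ (2 ^ i + j)).+1)%N by [].
  exact: (@le_bigmax _ _ _ _ (fun k : 'I_(2 ^ (2 ^ i + j)).+1 =>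
    om (dyadic j k) * `|signed_sum (a (dyadic j k)) s|) (Ordinal ki)).
rewrite -[leLHS]add0r lerD//; apply: ler_pM => //.
  rewrite ler_pdivlMr//; apply: om_decay.
  rewrite /dyadic ltr_pdivlMr ?exprn_gt0// -exprD.
  by rewrite -natrX ltr_nat.
exact: (@le_bigmax _ _ _ _ (fun k : 'I__ =>
  `|signed_sum (a (dyadic j k)) s|) k).
Qed.

(** The maximum over the block [2 ^ (2 ^ i) < u <= 2 ^ (2 ^ (i + 1))] is of order
[sqrt (2 ^ i)], which the weight turns into a geometric sequence. *)
Lemma weighted_grid_max_average i j :
  sign_average (weighted_grid_max i j) <=
  3 * A * (2 + (5 + rho / (1 - rho)) / (1 - rho)) * (1 + c / (1 - tau)).
Proof.
set K : R := 2 + _; pose S i := \sum_(k < i) tau ^+ k.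
have r1 : 0 < 1 - rho by rewrite subr_gt0.
have K0 : 0 < K.
  by rewrite addr_gt0// divr_gt0// addr_gt0// divr_gt0.
have t1 : 0 < 1 - tau by rewrite subr_gt0.
have SE n : S n * (1 - tau) = 1 - tau ^+ n.
  rewrite /S; elim: n => [|n ih]; first by rewrite big_ord0 expr0; ring.
  by rewrite big_ord_recr/= mulrDl ih exprS; ring.
apply: (@le_trans _ _ (3 * A * K * (1 + c * S i))); last first.
  rewrite ler_pM2l ?mulr_gt0// lerD2l ler_wpM2l//.
  by rewrite -[leRHS]mul1r ler_pdivlMr// SE gerBl exprn_ge0// ltW.
elim: i => [|i ih].
  rewrite /S big_ord0 mulr0 addr0 mulr1.
  apply: (@le_trans _ _ (sign_average (grid_max 1 j))).
    apply: sign_average_le => s; apply: le_bigmax2 => k _.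
    by rewrite ler_piMl.
  have := grid_max_average j (ltn0Sn 0).
  by rewrite sqrtr1 mulr1.
apply: (le_trans (sign_average_le (weighted_grid_max_succ i j))).
rewrite sign_averageD sign_averageZ (_ : S i.+1 = S i + tau ^+ i); last first.
  by rewrite /S big_ord_recr.
have -> : 3 * A * K * (1 + c * (S i + tau ^+ i)) =
  3 * A * K * (1 + c * S i) + 3 * A * K * (c * tau ^+ i) by ring.
apply: lerD => //.
have sq0 : 0 < Num.sqrt (2 ^ i.+1)%:R :> R by rewrite sqrtr_gt0 ltr0n expn_gt0.
apply: le_trans (ler_wpM2l _ (grid_max_average j _)) _.
- by rewrite divr_ge0 ?(ltW sq0)// mulr_ge0 ?exprn_ge0 ?(ltW tau0).
- by rewrite expn_gt0.
- rewrite le_eqVlt; apply/orP; left; apply/eqP; rewrite -/K; field.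
  by rewrite gt_eqF.
Qed.

End process.

End chaining.
(** * Symmetrization *)

Section tuple_law.
Context {R : realType}.

(** Boxes generate the product sigma-algebra and are stable under
    intersection, so they determine the law of a random vector. *)
Lemma tuple_law_ext N d (S : measurableType d)
    d1 (T1 : measurableType d1) d2 (T2 : measurableType d2)
    (m1 : {measure set T1 -> \bar R}) (m2 : {measure set T2 -> \bar R})
    (W1 : T1 -> N.-tuple S) (W2 : T2 -> N.-tuple S) :
  (m1 setT < +oo)%E ->
  measurable_fun [set: T1] W1 -> measurable_fun [set: T2] W2 ->
  (forall B : 'I_N -> set S, (forall i, measurable (B i)) ->
    m1 [set t | forall i, B i (tnth (W1 t) i)] =
    m2 [set t | forall i, B i (tnth (W2 t) i)]) ->
  forall F : N.-tuple S -> \bar R, measurable_fun setT F ->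
  (forall x, (0 <= F x)%E) ->
  (\int[m1]_t F (W1 t) = \int[m2]_t F (W2 t))%E.
Proof.
move=> m1oo mW1 mW2 W12 F mF F0.
have -> : (\int[m1]_t F (W1 t))%E = (\int[pushforward m1 W1]_x F x)%E.
  by rewrite (ge0_integral_pushforward mW1).
have -> : (\int[m2]_t F (W2 t))%E = (\int[pushforward m2 W2]_x F x)%E.
  by rewrite (ge0_integral_pushforward mW2).
pose box (B : 'I_N -> set S) : set (N.-tuple S) :=
  [set x | forall i, B i (tnth x i)].
pose G := [set A | exists2 B : 'I_N -> set S,
  (forall i, measurable (B i)) & A = box B].
have GT : G setT.
  exists (fun=> setT) => //.
  by apply/seteqP; split.
apply: eq_measure_integral => A mA _.
apply: (@g_sigma_algebra_measure_unique _ _ _ G _ (fun=> setT)) => //.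
- move=> _ [B mB ->].
  rewrite (_ : box B = \bigcap_(i in [set: 'I_N]) ((fun x => tnth x i) @^-1` B i)).
    apply: fin_bigcap_measurable => // i _; rewrite -[X in measurable X]setTI.
    exact: measurable_tnth.
  by apply/seteqP; split => x /= h i; [move=> _; exact: h | exact: (h i)].
- by apply/seteqP; split => // x _; exists 0%N.
- move=> _ _ [B1 mB1 ->] [B2 mB2 ->]; exists (fun i => B1 i `&` B2 i).
    by move=> i; exact: measurableI.
  by apply/seteqP; split => [x [h1 h2] i|x h]; split => // i; case: (h i).
- by move=> _ [B mB ->]; exact: W12.
- move: A mA; apply: smallest_sub; first exact: smallest_sigma_algebra.
  case: N F mF F0 W1 W2 mW1 mW2 W12 @box @G GT => [|n] F mF F0 W1 W2 mW1 mW2 W12 box G GT.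
    by rewrite big_ord0.
  rewrite -bigcup_mkord_ord; apply: bigcup_sub => i Ii _ [B mB <-].
  apply: sub_sigma_algebra; rewrite setTI.
  exists (fun j => if j == inord i then B else setT).
    by move=> j; case: ifP.
  apply/seteqP; split => x /= h; last by have := h (inord i); rewrite eqxx.
  by move=> j; case: eqP => // ->.
Qed.

Lemma measurable_bigmax0 d (T : measurableType d) K (f : nat -> T -> R) :
  (forall k, measurable_fun setT (f k)) ->
  measurable_fun setT (fun t => \big[Num.max/0]_(k < K) f k t).
Proof.
move=> mf.
suff h (r : seq 'I_K) :
    measurable_fun setT (fun t => \big[Num.max/0]_(k <- r) f k t) by exact: h.
elim: r => [|k r ih].
  by under eq_fun do rewrite big_nil; exact: measurable_cst.
by under eq_fun do rewrite big_cons; exact: measurable_maxr.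
Qed.

Section symmetrization.
Context d (Omega : measurableType d) (P : probability Omega R).
Variables (n : nat) (Z : 'I_n -> Omega -> R).
Hypothesis mZ : forall i, measurable_fun setT (Z i).
Hypothesis indepZ : forall B : 'I_n -> set R, (forall i, measurable (B i)) ->
  P [set w | forall i, B i (Z i w)] = (\prod_i P (Z i @^-1` B i))%E.

(** A sample and an independent copy of it, on the square of the probability
    space; outside of [J] the two are exchanged. *)
Definition swapped_pair (J : {set 'I_n}) (z : Omega * Omega) : (n + n).-tuple R :=
  [tuple match fintype.split i with
         | inl t => if t \in J then Z t z.1 else Z t z.2
         | inr t => if t \in J then Z t z.2 else Z t z.1
         end | i < n + n].

Lemma swapped_pair_l J z t : tnth (swapped_pair J z) (lshift n t) =
  if t \in J then Z t z.1 else Z t z.2.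
Proof. by rewrite tnth_mktuple (unsplitK (inl t)). Qed.

Lemma swapped_pair_r J z t : tnth (swapped_pair J z) (rshift n t) =
  if t \in J then Z t z.2 else Z t z.1.
Proof. by rewrite tnth_mktuple (unsplitK (inr t)). Qed.

Lemma measurable_swapped_pair J : measurable_fun setT (swapped_pair J).
Proof.
apply/measurable_fun_tnthP => i; rewrite /swapped_pair.
rewrite (_ : _ \o _ = fun z => match fintype.split i with
         | inl t => if t \in J then Z t z.1 else Z t z.2
         | inr t => if t \in J then Z t z.2 else Z t z.1
         end); last by apply/funext => z /=; rewrite tnth_mktuple.
by case: (fintype.split i) => t; case: (t \in J); apply: measurableT_comp.
Qed.

Lemma swapped_pair_box J (B : 'I_(n + n) -> set R) :
  (forall i, measurable (B i)) ->
  (P \x P)%E [set z | forall i, B i (tnth (swapped_pair J z) i)] =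
  (\prod_t (P (Z t @^-1` B (lshift n t)) * P (Z t @^-1` B (rshift n t))))%E.
Proof.
move=> mB.
pose B1 t := if t \in J then B (lshift n t) else B (rshift n t).
pose B2 t := if t \in J then B (rshift n t) else B (lshift n t).
have mB1 t : measurable (B1 t) by rewrite /B1; case: ifP.
have mB2 t : measurable (B2 t) by rewrite /B2; case: ifP.
have mb (C : 'I_n -> set R) : (forall t, measurable (C t)) ->
    measurable [set w | forall t, C t (Z t w)].
  move=> mC; rewrite (_ : [set w | _] = \bigcap_(t in [set: 'I_n]) (Z t @^-1` C t)).
    apply: fin_bigcap_measurable => // t _; rewrite -[X in measurable X]setTI.
    exact: mZ.
  by apply/seteqP; split => w /= h t; [move=> _; exact: h | exact: (h t)].
rewrite (_ : [set z | _] =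
  [set w | forall t, B1 t (Z t w)] `*` [set w | forall t, B2 t (Z t w)]).
  rewrite [LHS]product_measure1E; [|exact: mb|exact: mb].
  transitivity ((\prod_t P (Z t @^-1` B1 t)) * (\prod_t P (Z t @^-1` B2 t)))%E.
    by congr (_ * _)%E; exact: indepZ.
  rewrite -big_split/=; apply: eq_bigr => t _.
  by rewrite /B1 /B2; case: ifP => // _; rewrite muleC.
apply/seteqP; split => -[w1 w2] /= h.
  by split => t; move: (h (lshift n t)) (h (rshift n t));
    rewrite swapped_pair_l swapped_pair_r /B1 /B2; case: ifP.
move: h => [h1 h2] i; case: (split_ordP i) => t ->.
  by move: (h1 t) (h2 t); rewrite swapped_pair_l /B1 /B2; case: ifP.
by move: (h1 t) (h2 t); rewrite swapped_pair_r /B1 /B2; case: ifP.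
Qed.

Variables (K : nat) (g : nat -> R -> R) (m : nat -> R).
Hypothesis mg : forall k, measurable_fun setT (g k).
Hypothesis ig : forall k i, P.-integrable setT (EFin \o (g k \o Z i)).
Hypothesis Eg : forall k i, \int[P]_w g k (Z i w) = m k.

Let pair_max (x : (n + n).-tuple R) : R := \big[Num.max/0]_(k < K)
  `|\sum_(t < n) (g k (tnth x (lshift n t)) - g k (tnth x (rshift n t)))|.

Let measurable_pair_max : measurable_fun setT pair_max.
Proof.
apply: (@measurable_bigmax0 _ _ K (fun k x => `|\sum_(t < n)
    (g k (tnth x (lshift n t)) - g k (tnth x (rshift n t)))|)) => k.
apply: measurableT_comp => //.
apply: measurable_sum => t; apply: measurable_funB;
  by apply: measurableT_comp => //; exact: measurable_tnth.
Qed.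

Let max_sum (J : {set 'I_n}) (w : Omega) : R :=
  \big[Num.max/0]_(k < K) `|signed_sum (fun i => g k (Z i w)) J|.

Let measurable_max_sum J : measurable_fun setT (max_sum J).
Proof.
apply: (@measurable_bigmax0 _ _ K
  (fun k w => `|signed_sum (fun i => g k (Z i w)) J|)) => k.
apply: measurableT_comp => //.
apply: measurable_sum => t.
by case: (t \in J); [|apply: measurableT_comp => //]; exact: measurableT_comp.
Qed.

Let max_sum_ge0 J w : 0 <= max_sum J w. Proof. exact: bigmax_ge_id. Qed.
Let pair_max_ge0 x : 0 <= pair_max x. Proof. exact: bigmax_ge_id. Qed.

(** All the vectors [swapped_pair J] have the same product law. *)
Let pair_max_swap J : (\int[(P \x P)%E]_z (pair_max (swapped_pair [set: 'I_n]%SET z))%:E =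
  \int[(P \x P)%E]_z (pair_max (swapped_pair J z))%:E)%E.
Proof.
apply: (@tuple_law_ext _ _ _ _ _ _ _ (P \x P)%E (P \x P)%E
  (swapped_pair [set: 'I_n]%SET) (swapped_pair J) _ _ _ _ (EFin \o pair_max)).
- rewrite -setXTT [ltLHS]product_measure1E//.
  apply: (@le_lt_trans _ _ (1 * 1)%E); last by rewrite mule1 ltry.
  by apply: lee_pmul => //; exact: probability_le1.
- exact: measurable_swapped_pair.
- exact: measurable_swapped_pair.
- by move=> B mB; exact: etrans (swapped_pair_box _ mB) (esym (swapped_pair_box _ mB)).
- exact/measurable_EFinP.
- by move=> x; rewrite lee_fin.
Qed.

Let pair_max_swapped_le J z :
  pair_max (swapped_pair J z) <= max_sum J z.1 + max_sum J z.2.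
Proof.
apply: bigmax_le => [|k _]; first by rewrite addr_ge0.
rewrite (_ : \sum_(t < n) _ = signed_sum (fun i => g k (Z i z.1)) J -
    signed_sum (fun i => g k (Z i z.2)) J).
  apply: (le_trans (ler_normB _ _)); apply: lerD;
  exact: (@le_bigmax _ _ _ _ (fun k : 'I_K => `|signed_sum _ J|) k).
rewrite -sumrB; apply: eq_bigr => t _; rewrite swapped_pair_l swapped_pair_r.
by case: ifP => // _; rewrite opprK addrC.
Qed.

Let pair_max_integral J :
  (\int[(P \x P)%E]_z (pair_max (swapped_pair [set: 'I_n]%SET z))%:E <=
   2%:E * \int[P]_w (max_sum J w)%:E)%E.
Proof.
rewrite (pair_max_swap J).
apply: (@le_trans _ _
  (\int[(P \x P)%E]_z ((max_sum J z.1)%:E + (max_sum J z.2)%:E))%E).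
  apply: ge0_le_integral => //.
  - by move=> z _; rewrite lee_fin.
  - apply/measurable_EFinP; apply: (measurableT_comp measurable_pair_max).
    exact: measurable_swapped_pair.
  - by apply: emeasurable_funD; apply/measurable_EFinP; exact: measurableT_comp.
  - by move=> z _; rewrite -EFinD lee_fin.
rewrite ge0_integralD//=; [|by move=> ? _; rewrite lee_fin|
  by apply/measurable_EFinP; exact: measurableT_comp|
  by move=> ? _; rewrite lee_fin|
  by apply/measurable_EFinP; exact: measurableT_comp].
rewrite !fubini_tonelli1//=; [|by apply/measurable_EFinP; exact: measurableT_comp|
  by move=> z; rewrite lee_fin|by apply/measurable_EFinP; exact: measurableT_comp|
  by move=> z; rewrite lee_fin].
rewrite /fubini_F/=.
under [X in (X + _)%E]eq_integral do rewrite integral_cst//= probability_setT mule1.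
rewrite integral_cst//= probability_setT mule1.
by rewrite mule_natl mule2n.
Qed.

(** The mean [m k] is the integral over the copy, and the maximum of absolute
values of integrals is at most the integral of the maximum. *)
Let centered_max_le w :
  ((\big[Num.max/0]_(k < K) `|\sum_i (g k (Z i w) - m k)|)%:E <=
   \int[P]_v (pair_max (swapped_pair [set: 'I_n]%SET (w, v)))%:E)%E.
Proof.
have mp : measurable_fun setT
    (fun v => pair_max (swapped_pair [set: 'I_n]%SET (w, v))).
  apply: (measurableT_comp measurable_pair_max).
  by apply: (measurableT_comp (measurable_swapped_pair _)).
have pge0 : (0 <= \int[P]_v
    (pair_max (swapped_pair [set: 'I_n]%SET (w, v)))%:E)%E.
  by apply: integral_ge0 => v _; rewrite lee_fin.
rewrite -EFin_bigmax; apply: bigmax_le => // k _.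
pose h i v := g k (Z i w) - g k (Z i v).
have hi i : P.-integrable setT (EFin \o h i).
  rewrite (_ : _ \o _ =
    (EFin \o (fun=> g k (Z i w))) \- (EFin \o (g k \o Z i)))%E.
    by apply: integrableB => //; exact: finite_measure_integrable_cst.
  by apply/funext => v.
have -> : \sum_i (g k (Z i w) - m k) = \int[P]_v (\sum_i h i v).
  rewrite Rintegral_sum//; apply: eq_bigr => i _.
  rewrite (RintegralB measurableT (finite_measure_integrable_cst P _ measurableT) (ig k i)).
  rewrite Eg Rintegral_cst//; congr (_ - _).
  by have /(congr1 fine) /= -> := probability_setT P; rewrite mulr1.
have shi := integrable_sumr hi.
rewrite EFin_normr_Rintegral//.
apply: (le_trans (le_abse_integral _ _ _)) => //.
  exact: (measurable_int P shi).
apply: ge0_le_integral => //.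
- by apply: measurableT_comp => //; exact: (measurable_int P shi).
- exact/measurable_EFinP.
- move=> v _; rewrite lee_fin.
  apply: le_trans (@le_bigmax _ _ _ _ (fun k : 'I_K => `|\sum_(t < n)
    (g k (tnth (swapped_pair [set: 'I_n]%SET (w, v)) (lshift n t)) -
     g k (tnth (swapped_pair [set: 'I_n]%SET (w, v)) (rshift n t)))|) k).
  rewrite le_eqVlt; apply/orP; left; apply/eqP; congr `|_|.
  by apply: eq_bigr => i _; rewrite swapped_pair_l swapped_pair_r !finset.in_setT.
Qed.

(** Comparing with an independent copy turns centered sums into
    differences, whose law is unchanged by exchanging any set [J] of
    coordinates; averaging over [J] leaves random signs. *)
Theorem symmetrization :
  (\int[P]_w (\big[Num.max/0]_(k < K) `|\sum_i (g k (Z i w) - m k)|)%:E <=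
   2%:E * \int[P]_w (sign_average (fun J => \big[Num.max/0]_(k < K)
     `|signed_sum (fun i => g k (Z i w)) J|))%:E)%E.
Proof.
apply: (@le_trans _ _ (\int[(P \x P)%E]_z
    (pair_max (swapped_pair [set: 'I_n]%SET z))%:E)%E).
  rewrite fubini_tonelli1//=; [|apply/measurable_EFinP;
    apply: (measurableT_comp measurable_pair_max);
    exact: measurable_swapped_pair|by move=> z; rewrite lee_fin].
  apply: ge0_le_integral => //.
  - by move=> w _; rewrite lee_fin; exact: bigmax_ge_id.
  - apply/measurable_EFinP.
    apply: (@measurable_bigmax0 _ _ K (fun k w => `|\sum_i (g k (Z i w) - m k)|)).
    move=> k; apply: measurableT_comp => //; apply: measurable_sum => i.
    by apply: measurable_funB => //; exact: measurableT_comp.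
  - apply: measurable_fun_fubini_tonelli_F => //.
      apply/measurable_EFinP; apply: (measurableT_comp measurable_pair_max).
      exact: measurable_swapped_pair.
    by move=> z; rewrite lee_fin.
pose c : R := (2 ^+ #|'I_n|)^-1.
have c0 : 0 <= c by rewrite invr_ge0 exprn_ge0.
have mJ J : measurable_fun setT (fun w => (max_sum J w)%:E).
  exact/measurable_EFinP.
have -> : (\int[P]_w (sign_average (fun J => max_sum J w))%:E =
    c%:E * \sum_J \int[P]_w (max_sum J w)%:E)%E.
  rewrite -ge0_integral_sum//; last by move=> J w _; rewrite lee_fin.
  rewrite -ge0_integralZl//.
  - by apply: eq_integral => w _; rewrite sumEFin -EFinM.
  - exact: emeasurable_sum.
  - by move=> w _; apply: sume_ge0 => J _; rewrite lee_fin.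
rewrite muleCA ge0_sume_distrr; last first.
  by move=> J _; apply: integral_ge0 => w _; rewrite lee_fin.
set I0 := (\int[(P \x P)%E]_z _)%E.
have I0_ge0 : (0 <= I0)%E by apply: integral_ge0 => z _; rewrite lee_fin.
apply: (@le_trans _ _ (c%:E * \sum_(J : {set 'I_n}) I0)%E).
  have c1 : (c%:E * \sum_(J : {set 'I_n}) 1%:E = 1)%E.
    rewrite sumEFin -EFinM; congr EFin.
    exact: (@sign_average_cst R 'I_n 1).
  have -> : (\sum_(J : {set 'I_n}) I0 = (\sum_(J : {set 'I_n}) 1%:E) * I0)%E.
    rewrite ge0_sume_distrl; last by move=> *; rewrite lee_fin.
    by apply: eq_bigr => J _; rewrite mul1e.
  by rewrite muleA c1 mul1e.
apply: lee_wpmul2l; first by rewrite lee_fin.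
by apply: lee_sum => J _; exact: pair_max_integral.
Qed.

End symmetrization.

End tuple_law.
(** * The empirical process of trigonometric moments *)

Section same_law.
Context {R : realType} d (T : measurableType d) (P : probability T R).
Variables (X Z : T -> R).
Hypotheses (mX : measurable_fun setT X) (mZ : measurable_fun setT Z).
Hypothesis XZ : forall B, measurable B -> P (Z @^-1` B) = P (X @^-1` B).

Lemma same_law_ge0_integral (f : R -> \bar R) : measurable_fun setT f ->
  (forall x, 0 <= f x)%E -> (\int[P]_w f (Z w) = \int[P]_w f (X w))%E.
Proof.
move=> mf f0.
have pf Y : measurable_fun setT Y ->
    (\int[P]_w f (Y w) = \int[pushforward P Y]_x f x)%E.
  by move=> mY; rewrite (ge0_integral_pushforward mY).
rewrite !pf//; apply: eq_measure_integral => A mA _; exact: XZ.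
Qed.

Lemma same_law_integral (f : R -> \bar R) : measurable_fun setT f ->
  (\int[P]_w f (Z w) = \int[P]_w f (X w))%E.
Proof.
move=> mf; rewrite integralE [RHS]integralE; congr (_ - _)%E.
  rewrite (funepos_comp f Z) (funepos_comp f X).
  apply: (same_law_ge0_integral (measurable_funepos mf)).
  exact: funepos_ge0.
rewrite (funeneg_comp f Z) (funeneg_comp f X).
  apply: (same_law_ge0_integral (measurable_funeneg mf)).
  exact: funeneg_ge0.
Qed.

Lemma same_law_Rintegral (f : R -> R) : measurable_fun setT f ->
  \int[P]_w f (Z w) = \int[P]_w f (X w).
Proof.
move=> mf; congr fine; apply: (same_law_integral (f := EFin \o f)).
exact/measurable_EFinP.
Qed.

Lemma same_law_integrable (f : R -> R) : measurable_fun setT f ->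
  P.-integrable setT (EFin \o (f \o X)) -> P.-integrable setT (EFin \o (f \o Z)).
Proof.
move=> mf /integrableP[_ fX]; apply/integrableP; split.
  by apply/measurable_EFinP; exact: measurableT_comp.
rewrite (same_law_ge0_integral (f := fun x => `|(f x)%:E|%E))//.
by apply: measurableT_comp => //; exact/measurable_EFinP.
Qed.

End same_law.

Section trig_process.
Context {R : realType}.
Variables (c : R -> R) (gamma delta : R).
Hypothesis c_le1 : forall y, `|c y| <= 1.
Hypothesis c_lip : forall y z, `|c y - c z| <= `|y - z|.
Hypotheses (gamma0 : 0 < gamma) (delta0 : 0 < delta).

Definition trig_moment (k : nat) (u x : R) : R := x ^+ k * c (u * x).

(** A common bound, with a square of order [4 + gamma], for [|x| ^ k] and for the
constants of the Hoelder condition below. *)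
Definition envelope (x : R) : R := 2 * (1 + `|x| `^ (2 + gamma / 2)).

Definition hoelder_exponent : R := Num.min (gamma / 2) 1.
Local Notation kappa := hoelder_exponent.

Lemma powR_le1D (a r s : R) : 0 <= a -> 0 <= r -> r <= s -> a `^ r <= 1 + a `^ s.
Proof.
move=> a0 r0 rs; have [a1|a1] := lerP a 1.
  apply: (@le_trans _ _ 1); last by rewrite lerDl powR_ge0.
  have <- : 1 `^ r = 1 :> R by rewrite powR1.
  by rewrite ge0_ler_powR ?nnegrE.
apply: (@le_trans _ _ (a `^ s)); last by rewrite lerDr.
by rewrite ler_powR// ltW.
Qed.

Lemma kappa_gt0 : 0 < kappa.
Proof. by rewrite /hoelder_exponent lt_min ltr01 divr_gt0. Qed.

Lemma envelope_gt0 x : 0 < envelope x.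
Proof. by rewrite mulr_gt0// ltr_pwDl ?powR_ge0. Qed.

Lemma envelope_sqr x : envelope x ^+ 2 <= 8 * (1 + `|x| `^ (4 + gamma)).
Proof.
have -> : `|x| `^ (4 + gamma) = (`|x| `^ (2 + gamma / 2)) ^+ 2.
  by rewrite -powR_mulrn ?powR_ge0// -powRrM; congr (_ `^ _); field.
rewrite /envelope; set y := _ `^ _.
have := sqr_ge0 (1 - y); nra.
Qed.

Lemma trig_moment_le k u x : (k <= 2)%N -> `|trig_moment k u x| <= envelope x.
Proof.
move=> k2; rewrite normrM normrX.
have H : `|x| ^+ k <= 1 + `|x| `^ (2 + gamma / 2).
  rewrite -powR_mulrn//; apply: powR_le1D => //.
  by rewrite (@le_trans _ _ 2)// ?ler_nat// lerDl divr_ge0// ltW.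
have p0 : 0 <= `|x| `^ (2 + gamma / 2) by exact: powR_ge0.
apply: (@le_trans _ _ (`|x| ^+ k)); first by rewrite ler_piMr ?exprn_ge0.
rewrite /envelope; lra.
Qed.

(** Interpolation of the bounds [2] and [|u - v| |x|] of the increment of [c]: a power
[kappa] of the step costs a factor [|x| ^ kappa], which the envelope affords since
[kappa <= gamma / 2]. *)
Lemma trig_moment_hoelder k u v x : (k <= 2)%N ->
  `|trig_moment k u x - trig_moment k v x| <= `|u - v| `^ kappa * envelope x.
Proof.
move=> k2; rewrite -mulrBr normrM normrX.
have k0 := kappa_gt0.
have H t y : 0 <= t -> 0 <= y -> y <= t -> y <= 2 -> y <= 2 * t `^ kappa.
  move=> t0 y0 yt y2; have [t1|t1] := lerP t 1.
    have [->|tn0] := eqVneq y 0; first by rewrite mulr_ge0 ?powR_ge0.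
    have tp : 0 < t by rewrite (lt_le_trans _ yt)// lt_neqAle eq_sym tn0.
    apply: (le_trans yt); apply: (@le_trans _ _ (t `^ kappa)).
      by rewrite ger1_powR ?tp// /hoelder_exponent ge_min lexx orbT.
    by rewrite ler_peMl ?powR_ge0// ler1n.
  apply: (le_trans y2); rewrite ler_peMr//.
  by rewrite -[leLHS](powRr0 t) ler_powR// ltW.
have cuv : `|c (u * x) - c (v * x)| <= 2 * (`|u - v| `^ kappa * `|x| `^ kappa).
  rewrite -powRM//; apply: H => //.
  - by rewrite -normrM mulrBl.
  - by rewrite (le_trans (ler_normB _ _))//; have := c_le1 (u * x); have := c_le1 (v * x); lra.
apply: (le_trans (ler_wpM2l _ cuv)); first by rewrite exprn_ge0.
rewrite [leLHS](_ : _ = `|u - v| `^ kappa * (2 * (`|x| ^+ k * `|x| `^ kappa))); last by ring.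
rewrite ler_wpM2l ?powR_ge0// /envelope ler_wpM2l//.
have [->|x0] := eqVneq x 0.
  by rewrite normr0 (powR0 (lt0r_neq0 k0)) mulr0 addr_ge0 ?powR_ge0.
rewrite -powR_mulrn// -powRD; last by rewrite normr_eq0 x0 implybT.
apply: powR_le1D => //; first by rewrite addr_ge0// ltW.
by apply: lerD; [rewrite ler_nat|rewrite /hoelder_exponent ge_min lexx].
Qed.

(** The constant of the chaining bound for steps of size [rho ^ j], [rho = 2 ^ (- kappa)],
and blocks of weight [(2 ^ (- delta)) ^ i]. *)
Definition chaining_constant : R :=
  let rho := 2 `^ (- kappa) in
  3 * (2 + (5 + rho / (1 - rho)) / (1 - rho)) *
  (1 + Num.sqrt 2 * ln 2 `^ (- (1 / 2) - delta) / (1 - 2 `^ (- delta))).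

Lemma powR2N_lt1 (r : R) : 0 < r -> 2 `^ (- r) < 1.
Proof.
move=> r0; rewrite powRN invf_lt1 ?powR_gt0//.
rewrite [ltLHS](_ : 1 = 1 `^ r); last by rewrite powR1.
by rewrite gt0_ltr_powR// ?nnegrE// ltr1n.
Qed.

Lemma chaining_constant_ge0 : 0 <= chaining_constant.
Proof.
have r0 : 0 < 2 `^ (- kappa) :> R by exact: powR_gt0.
have r1 : 0 < 1 - 2 `^ (- kappa) by rewrite subr_gt0 powR2N_lt1// kappa_gt0.
have t1 : 0 < 1 - 2 `^ (- delta) by rewrite subr_gt0 powR2N_lt1.
rewrite mulr_ge0//.
  by rewrite mulr_ge0// addr_ge0// divr_ge0 ?(ltW r1)// addr_ge0// divr_ge0 ?(ltW r1)// ltW.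
by rewrite addr_ge0// divr_ge0 ?(ltW t1)// mulr_ge0 ?powR_ge0.
Qed.

Lemma trig_chaining (n k i j : nat) (z : 'I_n -> R) : (0 < n)%N -> (k <= 2)%N ->
  sign_average (weighted_grid_max (fun u t => trig_moment k u (z t))
    (log_weight delta) i j) <=
  chaining_constant * Num.sqrt (\sum_t envelope (z t) ^+ 2).
Proof.
move=> n0 k2.
set S := \sum_t _.
have S0 : 0 < S.
  case: n z n0 @S => // n z _ S.
  rewrite /S big_ord_recl ltr_pwDl ?exprn_gt0 ?envelope_gt0//.
  by rewrite sumr_ge0// => t _; exact: sqr_ge0.
have sS : Num.sqrt S ^+ 2 = S by rewrite sqr_sqrtr// ltW.
have k0 := kappa_gt0.
have r0 : 0 < 2 `^ (- kappa) :> R by exact: powR_gt0.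
apply: (le_trans (weighted_grid_max_average (A := Num.sqrt S)
  (rho := 2 `^ (- kappa)) (c := Num.sqrt 2 * ln 2 `^ (- (1 / 2) - delta))
  (tau := 2 `^ (- delta)) _ _ _ _ _ _ _ _ _ _ _ _ _)).
- by rewrite sqrtr_gt0.
- by [].
- by rewrite powR2N_lt1.
- move=> u; rewrite sS; apply: ler_sum => t _.
  rewrite -real_normK ?num_real// lerXn2r ?nnegrE ?(ltW (envelope_gt0 _))//.
  exact: trig_moment_le.
- move=> l u v uv; rewrite exprMn sS /S mulr_suml; apply: ler_sum => t _.
  rewrite -real_normK ?num_real// -exprMn lerXn2r ?nnegrE//.
    by rewrite mulr_ge0 ?exprn_ge0 ?powR_ge0// ltW// envelope_gt0.
  apply: (le_trans (trig_moment_hoelder _ _ _ k2)).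
  rewrite mulrC ler_wpM2l ?(ltW (envelope_gt0 _))//.
  have -> : (2 `^ (- kappa)) ^+ l = (2 ^- l : R) `^ kappa.
    rewrite -(powR_invn l (ler0n R 2)).
    rewrite -(powR_mulrn l (powR_ge0 2 (- kappa))).
    by rewrite -powRrM -powRrM mulNr mulNr [kappa * _]mulrC.
  by rewrite ge0_ler_powR ?nnegrE ?(ltW k0)// invr_ge0 exprn_ge0.
- by rewrite mulr_ge0 ?powR_ge0.
- exact: powR_gt0.
- by rewrite powR2N_lt1.
- by move=> u; rewrite ltW// log_weight_gt0.
- by move=> u; exact: log_weight_le1.
- by move=> l u; exact: log_weight_decay.
- rewrite le_eqVlt; apply/orP; left; apply/eqP; rewrite /chaining_constant; ring.
Qed.

End trig_process.

Section monotone_sup.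
Context {R : realType} d (T : measurableType d) (mu : {measure set T -> \bar R}).

Lemma nondecreasing_sup_integral (W : nat -> T -> R) (B : \bar R) :
  (forall j, measurable_fun setT (W j)) -> (forall j w, 0 <= W j w) ->
  (forall j w, W j w <= W j.+1 w) ->
  (forall j, \int[mu]_w (W j w)%:E <= B)%E ->
  exists Y : T -> \bar R, [/\ measurable_fun setT Y, forall w, (0 <= Y w)%E,
    (\int[mu]_w Y w <= B)%E & forall j w, ((W j w)%:E <= Y w)%E].
Proof.
move=> mW W0 Wnd WB.
have nd w : nondecreasing_seq (fun j => (W j w)%:E).
  by apply/nondecreasing_seqP => j; rewrite lee_fin.
have cv w : cvgn (fun j => (W j w)%:E) by exact: ereal_nondecreasing_is_cvgn.
have mWE j : measurable_fun setT (fun w => (W j w)%:E) by exact/measurable_EFinP.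
exists (fun w => limn (fun j => (W j w)%:E)); split.
- by apply: (emeasurable_fun_cvg _ _ mWE) => w _; exact: cv.
- by move=> w; apply: lime_ge => //; apply: nearW => j; rewrite lee_fin.
- rewrite (monotone_convergence mu measurableT mWE); last 2 first.
  + by move=> j w _; rewrite lee_fin.
  + by move=> w _; exact: nd.
  apply: lime_le; last by apply: nearW.
  apply: ereal_nondecreasing_is_cvgn; apply/nondecreasing_seqP => j.
  apply: ge0_le_integral => // w _; rewrite lee_fin//.
- by move=> j w; apply: lime_ge => //; exists j => // l /= jl; exact: nd.
Qed.

End monotone_sup.

Section dyadic_density.
Context {R : realType}.

Lemma cvg_dyadic (u : R) : 0 <= u ->
  dyadic j (Num.truncn (u * 2 ^+ j)) @[j --> \oo] --> u.
Proof.
move=> u0.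
have h0 : (fun j => (1 / 2) ^+ j : R) @ \oo --> (0 : R).
  by apply: cvg_expr; rewrite ger0_norm// ltr_pdivrMr// mul1r ltr1n.
apply/cvgrPdist_le => e e0.
move/cvgrPdist_le : h0 => /(_ e e0); apply: filterS => j.
rewrite sub0r normrN ger0_norm ?exprn_ge0// => je; apply: le_trans je.
have p0 : 0 < 2 ^+ j :> R by rewrite exprn_gt0.
have /truncn_itv/andP[l1 l2] : 0 <= u * 2 ^+ j by rewrite mulr_ge0 ?(ltW p0).
rewrite /dyadic div1r exprVn ger0_norm; last by rewrite subr_ge0 ler_pdivrMr.
rewrite -(ler_pM2r p0) mulVf ?gt_eqF// mulrBl divfK ?gt_eqF//.
by move: l2; rewrite -natr1; lra.
Qed.

(** Every [u >= 0] is the limit of its lower dyadic approximations, which the grids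
of height [2 ^ (2 ^ j)] eventually contain. *)
Lemma grid_bound (v : R -> R) (y : \bar R) :
  {in [pred u | 0 <= u], continuous v} ->
  (forall j k, (k <= 2 ^ (2 ^ j + j))%N -> ((v (dyadic j k))%:E <= y)%E) ->
  forall u, 0 <= u -> ((v u)%:E <= y)%E.
Proof.
move=> cv vy u u0.
have := cvg_dyadic u0 => ud.
have vu : v (dyadic j (Num.truncn (u * 2 ^+ j))) @[j --> \oo] --> v u.
  by apply: continuous_cvg => //; exact: cv.
have near_le : \forall j \near \oo,
    ((v (dyadic j (Num.truncn (u * 2 ^+ j))))%:E <= y)%E.
  exists (Num.truncn u).+1 => // j /= uj; apply: vy.
  have : (Num.truncn (u * 2 ^+ j))%:R <= (2 ^ (2 ^ j + j))%:R :> R.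
    apply: (@le_trans _ _ (u * 2 ^+ j)); first by rewrite truncn_le mulr_ge0.
    rewrite expnD natrM !natrX ler_wpM2r//.
    have /andP[_ /ltW ul] := truncn_itv u0; apply: (le_trans ul).
    rewrite -natrX ler_nat; apply: (leq_trans uj).
    by rewrite ltnW// (ltn_trans (ltn_expl j (ltnSn 1)))// ltn_expl.
  by rewrite ler_nat.
case: y vy near_le => [y| |] vy near_le; last 2 first.
- by rewrite leey.
- by have := vy 0%N 0%N isT.
- rewrite lee_fin; apply: (cvgr_to_le vu); apply: filterS near_le => j.
  by rewrite lee_fin.
Qed.

End dyadic_density.

Section empirical_process.
Context {R : realType} d (Omega : measurableType d) (P : probability Omega R).
Variables (n : nat) (Z : 'I_n -> Omega -> R) (X : Omega -> R).
Hypothesis n0 : (0 < n)%N.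
Hypothesis mX : measurable_fun setT X.
Hypothesis mZ : forall i, measurable_fun setT (Z i).
Hypothesis indepZ : forall B : 'I_n -> set R, (forall i, measurable (B i)) ->
  P [set w | forall i, B i (Z i w)] = (\prod_i P (Z i @^-1` B i))%E.
Hypothesis lawZ : forall i B, measurable B -> P (Z i @^-1` B) = P (X @^-1` B).

Variables (c : R -> R) (e : R) (gamma delta : R) (k : nat).
Hypothesis c_le1 : forall y, `|c y| <= 1.
Hypothesis c_lip : forall y z, `|c y - c z| <= `|y - z|.
Hypothesis c_cont : continuous c.
Hypothesis c_parity : `|e| = 1 /\ forall y, c (- y) = e * c y.
Hypotheses (gamma0 : 0 < gamma) (delta0 : 0 < delta) (k2 : (k <= 2)%N).
Hypothesis moment : P.-integrable setT (EFin \o (fun w => `|X w| `^ (4 + gamma))).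

Local Notation h := (trig_moment c k).
Local Notation w := (log_weight delta).
Local Notation env := (envelope gamma).
Let M := \int[P]_o (`|X o| `^ (4 + gamma)).
Let mean (u : R) := \int[P]_o h u (X o).

Lemma measurable_trig_moment u : measurable_fun setT (h u).
Proof.
apply: measurable_funM; first exact: measurable_funX.
apply: measurableT_comp; first exact: continuous_measurable_fun.
exact: measurable_funM.
Qed.

Lemma measurable_powR_norm (r : R) : measurable_fun setT (fun x : R => `|x| `^ r).
Proof. by apply: (measurableT_comp (measurable_powR r)). Qed.

Lemma measurable_envelope : measurable_fun setT env.
Proof.
apply: measurable_funM => //; apply: measurable_funD => //.
exact: measurable_powR_norm.
Qed.

Let moment_bound (x : R) := 8 + 8 * `|x| `^ (4 + gamma).

Let envelope_sqr_le x : env x ^+ 2 <= moment_bound x.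
Proof. by have := envelope_sqr gamma x; rewrite /moment_bound mulrDr mulr1. Qed.

Let int_moment_bound a : P.-integrable setT
  (EFin \o (fun o => a + 8 * `|X o| `^ (4 + gamma))).
Proof. exact: (integrable_affine (mu := P)). Qed.

Lemma integrable_envelope : P.-integrable setT (EFin \o (env \o X)).
Proof.
apply: (integrable_dominated _ _ (int_moment_bound 9)) => [|o].
  by apply: measurableT_comp => //; exact: measurable_envelope.
rewrite /= ger0_norm; last exact/ltW/envelope_gt0.
have := envelope_sqr gamma (X o); have := sqr_ge0 (env (X o) - 1); nra.
Qed.

Lemma integrable_trig_moment u : P.-integrable setT (EFin \o (h u \o X)).
Proof.
apply: (integrable_dominated _ _ integrable_envelope) => [|o].
  by apply: measurableT_comp => //; exact: measurable_trig_moment.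
exact: trig_moment_le.
Qed.

Lemma continuous_trig_moment x : continuous (h ^~ x).
Proof.
by apply: continuous_mul; [exact: continuous_cst|exact: continuous_scalel].
Qed.

Lemma continuous_mean : continuous mean.
Proof.
apply: (@continuous_Rintegral _ _ _ P (fun v o => h v (X o)) (env \o X)).
- by move=> v; apply: measurableT_comp => //; exact: measurable_trig_moment.
- by move=> o; exact: continuous_trig_moment.
- by move=> v o; exact: trig_moment_le.
- exact: integrable_envelope.
Qed.

Let dev u o := `|\sum_i (h u (Z i o) - mean u)|.

Let W j o := \big[Num.max/0]_(l < (2 ^ (2 ^ j + j)).+1)
  (w (dyadic j l) * dev (dyadic j l) o).

Let measurable_dev u : measurable_fun setT (dev u).
Proof.
apply: measurableT_comp => //; apply: measurable_sum => i.
apply: measurable_funB => //; apply: measurableT_comp => //.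
exact: measurable_trig_moment.
Qed.

Let measurable_W j : measurable_fun setT (W j).
Proof.
apply: (@measurable_bigmax0 _ _ _ _ (fun l o => w (dyadic j l) * dev (dyadic j l) o)).
by move=> l; exact: measurable_funM.
Qed.

Let W_le j l o : (l <= 2 ^ (2 ^ j + j))%N ->
  w (dyadic j l) * dev (dyadic j l) o <= W j o.
Proof.
move=> lj; have lj' : (l < (2 ^ (2 ^ j + j)).+1)%N by [].
exact: (@le_bigmax _ _ _ _ (fun l : 'I_(2 ^ (2 ^ j + j)).+1 =>
  w (dyadic j l) * dev (dyadic j l) o) (Ordinal lj')).
Qed.

Let W_nd j o : W j o <= W j.+1 o.
Proof.
apply: bigmax_le => [|l _]; first exact: bigmax_ge_id.
rewrite -dyadicS_even; apply: W_le.
case: l => /= l; rewrite ltnS => ll.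
apply: (@leq_trans (2 * 2 ^ (2 ^ j + j))); first by rewrite leq_mul2l.
by rewrite -expnS leq_exp2l// -addnS leq_add2r expnS leq_pmull.
Qed.

Let dev_env_sum :
  (\int[P]_o (\sum_i env (Z i o) ^+ 2)%:E <= (n%:R * (8 * (1 + M)))%:E)%E.
Proof.
have menv : measurable_fun setT (fun x : R => (env x ^+ 2)%:E).
  by apply/measurable_EFinP/measurable_funX; exact: measurable_envelope.
under eq_integral do rewrite -sumEFin.
rewrite ge0_integral_sum//; last 2 first.
- by move=> i; exact: (measurableT_comp menv (mZ i)).
- by move=> i o _; rewrite lee_fin sqr_ge0.
have -> : (n%:R * (8 * (1 + M)))%:E = (\sum_(i < n) (8 * (1 + M))%:E)%E.
  by rewrite sumEFin sumr_const card_ord mulr_natl.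
apply: lee_sum => i _.
rewrite (same_law_ge0_integral mX (mZ i) (lawZ i) menv); last first.
  by move=> x; rewrite lee_fin sqr_ge0.
have <- : \int[P]_o moment_bound (X o) = 8 * (1 + M).
  by rewrite (probability_Rintegral_affine _ _ moment) mulrDr mulr1.
rewrite EFin_Rintegral; last exact: (int_moment_bound 8).
apply: ge0_le_integral => //.
- by move=> o _; rewrite lee_fin sqr_ge0.
- exact: (measurableT_comp menv mX).
- by have /measurable_int := int_moment_bound 8.
- by move=> o _; rewrite lee_fin.
Qed.

(** The square root of the random scale is linearized by
[2 sqrt x <= sqrt n + x / sqrt n], which is sharp for [x] of order [n] and makes the
bound integrable term by term. *)
Let average_W j o :
  sign_average (fun J => \big[Num.max/0]_(l < (2 ^ (2 ^ j + j)).+1)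
    `|signed_sum (fun i => w (dyadic j l) * h (dyadic j l) (Z i o)) J|) <=
  chaining_constant gamma delta / 2 *
    (Num.sqrt n%:R + (Num.sqrt n%:R)^-1 * \sum_i env (Z i o) ^+ 2).
Proof.
set C := chaining_constant gamma delta.
have C0 : 0 <= C by exact: chaining_constant_ge0.
set S := \sum_i _.
have S0 : 0 <= S by apply: sumr_ge0 => i _; exact: sqr_ge0.
have q0 : 0 < Num.sqrt n%:R :> R by rewrite sqrtr_gt0 ltr0n.
apply: (@le_trans _ _ (C * Num.sqrt S)).
  apply: le_trans (trig_chaining c_le1 c_lip gamma0 delta0 j j (fun i => Z i o) n0 k2).
  apply: sign_average_le => J; apply: le_bigmax2 => l _.
  rewrite -[X in X * `|_|]ger0_norm; last exact/ltW/log_weight_gt0.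
  rewrite -normrM /signed_sum mulr_sumr.
  rewrite le_eqVlt; apply/orP; left; apply/eqP; congr `|_|.
  by apply: eq_bigr => i _; case: ifP => // _; rewrite mulrN.
rewrite -[leRHS]mulrA ler_wpM2l// -(ler_pM2l (ltr0Sn R 1)) mulVKf//.
have sS : Num.sqrt S ^+ 2 = S by rewrite sqr_sqrtr.
rewrite -(ler_pM2l q0) -[in leRHS]sS.
have -> : Num.sqrt n%:R * (Num.sqrt n%:R + (Num.sqrt n%:R)^-1 * Num.sqrt S ^+ 2) =
    Num.sqrt n%:R ^+ 2 + Num.sqrt S ^+ 2 :> R by field; rewrite gt_eqF.
by have := sqr_ge0 (Num.sqrt n%:R - Num.sqrt S : R); nra.
Qed.

(** The supremum over the real line is reached along the dyadic grids; on each
    grid, symmetrization reduces it to the chaining bound, whose random scale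
    [sqrt (\sum_i env (Z_i) ^ 2)] is of order [sqrt n] on average. *)
Theorem empirical_process_sup : exists Y : Omega -> \bar R,
  [/\ measurable_fun setT Y, forall o, (0 <= Y o)%E,
    (\int[P]_o Y o <= (chaining_constant gamma delta * Num.sqrt n%:R *
       (9 + 8 * M))%:E)%E &
    forall u o, ((w u * `|\sum_i (h u (Z i o) - mean u)|)%:E <= Y o)%E].
Proof.
set C := chaining_constant gamma delta.
have C0 : 0 <= C by exact: chaining_constant_ge0.
have q0 : 0 < Num.sqrt n%:R :> R by rewrite sqrtr_gt0 ltr0n.
have W0 j o : 0 <= W j o by exact: bigmax_ge_id.
have WB j : (\int[P]_o (W j o)%:E <= (C * Num.sqrt n%:R * (9 + 8 * M))%:E)%E.
  pose g l x := w (dyadic j l) * h (dyadic j l) x.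
  have mg l : measurable_fun setT (g l).
    by apply: measurable_funM => //; exact: measurable_trig_moment.
  have igX l : P.-integrable setT (EFin \o (g l \o X)).
    rewrite (_ : _ \o _ = fun o => ((w (dyadic j l))%:E *
        (EFin \o (h (dyadic j l) \o X)) o)%E).
      by apply: integrableZl => //; exact: integrable_trig_moment.
    by apply/funext => o /=; rewrite EFinM.
  have Eg l i : \int[P]_o g l (Z i o) = w (dyadic j l) * mean (dyadic j l).
    rewrite (same_law_Rintegral mX (mZ i) (lawZ i) (mg l)) RintegralZl//.
    exact: integrable_trig_moment.
  have ig l i := same_law_integrable mX (mZ i) (lawZ i) (mg l) (igX l).
  have := symmetrization mZ indepZ (2 ^ (2 ^ j + j)).+1 mg ig Eg.
  rewrite (_ : (fun o => _) = (fun o => (W j o)%:E)); last first.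
    apply/funext => o; congr EFin; apply: eq_bigr => l _.
    rewrite -[X in X * dev _ _]ger0_norm; last exact/ltW/log_weight_gt0.
    by rewrite -normrM mulr_sumr; congr `|_|; apply: eq_bigr => i _; rewrite mulrBr.
  move=> /le_trans; apply.
  pose F o := C / 2 * (Num.sqrt n%:R + (Num.sqrt n%:R)^-1 * \sum_i env (Z i o) ^+ 2).
  apply: (@le_trans _ _ (2%:E * \int[P]_o (F o)%:E)%E).
    apply: lee_wpmul2l => //; apply: ge0_le_integral => //.
    - move=> o _; rewrite lee_fin; apply: sign_average_ge0 => J.
      exact: bigmax_ge_id.
    - apply/measurable_EFinP; apply: measurable_funM => //.
      apply: measurable_sum => J.
      apply: (@measurable_bigmax0 _ _ _ _ (fun l o => `|signed_sum (fun i => g l (Z i o)) J|)).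
      move=> l; apply: measurableT_comp => //; apply: measurable_sum => i.
      case: (i \in J); first exact: measurableT_comp.
      by apply: measurableT_comp => //; exact: measurableT_comp.
    - apply/measurable_EFinP; apply: measurable_funM => //.
      apply: measurable_funD => //; apply: measurable_funM => //.
      apply: measurable_sum => i; apply: measurable_funX.
      by apply: measurableT_comp => //; exact: measurable_envelope.
    - by move=> o _; rewrite lee_fin average_W.
  have S0 o : 0 <= \sum_i env (Z i o) ^+ 2 by apply: sumr_ge0 => i _; exact: sqr_ge0.
  have mS : measurable_fun setT (fun o => (\sum_i env (Z i o) ^+ 2)%:E).
    apply/measurable_EFinP/measurable_sum => i; apply: measurable_funX.
    by apply: measurableT_comp => //; exact: measurable_envelope.
  have -> : (\int[P]_o (F o)%:E = (C / 2)%:E * ((Num.sqrt n%:R)%:E +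
      ((Num.sqrt n%:R)^-1)%:E * \int[P]_o (\sum_i env (Z i o) ^+ 2)%:E))%E.
    have FE o : (F o)%:E = ((C / 2)%:E * ((Num.sqrt n%:R)%:E +
        ((Num.sqrt n%:R)^-1)%:E * (\sum_i env (Z i o) ^+ 2)%:E))%E.
      by [].
    under eq_integral do rewrite FE.
    rewrite ge0_integralZl//; last 3 first.
    - apply: emeasurable_funD => //; exact: measurable_funeM.
    - move=> o _; rewrite adde_ge0 ?mule_ge0 ?lee_fin ?invr_ge0 ?(ltW q0)//.
    - by rewrite lee_fin divr_ge0.
    congr (_ * _)%E.
    rewrite ge0_integralD//; last 2 first.
    - by move=> o _; rewrite mule_ge0 ?lee_fin ?invr_ge0 ?(ltW q0).
    - exact: measurable_funeM.
    rewrite integral_cst//= ge0_integralZl//.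
    - by congr (_ + _)%E; rewrite -[RHS]mule1; congr (_ * _)%E; exact: probability_setT.
    - by move=> o _; rewrite lee_fin.
  apply: (@le_trans _ _ (2%:E * ((C / 2)%:E * ((Num.sqrt n%:R)%:E +
      ((Num.sqrt n%:R)^-1)%:E * (n%:R * (8 * (1 + M)))%:E)))%E).
    rewrite lee_wpmul2l// lee_wpmul2l ?lee_fin ?divr_ge0//.
    by rewrite leeD2l// lee_wpmul2l ?lee_fin ?invr_ge0 ?(ltW q0).
  rewrite -[leLHS]/(2 * (C / 2 * (Num.sqrt n%:R + (Num.sqrt n%:R)^-1 *
    (n%:R * (8 * (1 + M))))))%:E lee_fin le_eqVlt; apply/orP; left; apply/eqP.
  have nq : n%:R = Num.sqrt n%:R ^+ 2 :> R by rewrite sqr_sqrtr.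
  rewrite [X in _^-1 * (X * _)]nq; move: q0; set q : R := Num.sqrt n%:R => q0.
  by field; rewrite gt_eqF.
have [Y [mY Y0 YB WY]] := nondecreasing_sup_integral measurable_W W0 W_nd WB.
exists Y; split => // u o.
pose v u := w u * dev u o.
(* by parity, negative frequencies reduce to positive ones *)
suff H u' : 0 <= u' -> ((v u')%:E <= Y o)%E.
  have [u0|u0] := lerP 0 u; first exact: H.
  rewrite -/(dev u o).
  have [e1 ce] := c_parity.
  have hN x : h (- u) x = e * h u x by rewrite /trig_moment mulNr ce; ring.
  have -> : dev u o = dev (- u) o.
    rewrite /dev; have -> : mean (- u) = e * mean u.
      rewrite /mean; under eq_Rintegral do rewrite hN.
      by rewrite RintegralZl//; exact: integrable_trig_moment.
    under [in RHS]eq_bigr do rewrite hN -mulrBr.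
    by rewrite -mulr_sumr normrM e1 mul1r.
  by rewrite -(log_weightN delta u); apply: H; rewrite oppr_ge0 ltW.
apply: grid_bound => [x _|j l lj]; last first.
  by apply: le_trans (WY j o); rewrite lee_fin W_le.
apply: cvgM; first exact: continuous_log_weight.
apply: cvg_norm.
apply: (continuous_sumr (f := fun i x => h x (Z i o) - mean x)) => i y.
by apply: cvgB; [exact: continuous_trig_moment|exact: continuous_mean].
Qed.

End empirical_process.

(** * Poisson integrals *)

Section trig_transform.
Context {R : realType} (mu : finite_borel_measure R) (c : R -> R).
Hypothesis cc : continuous c.
Hypothesis c1 : forall y, `|c y| <= 1.

Lemma measurable_trig_scale (u : R) :
  measurable_fun [set: measurableTypeR R] (fun x => c (u * x)).
Proof. by apply: continuous_measurable_fun; exact: continuous_scaler. Qed.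

Lemma integrable_trig_scale (u : R) :
  mu.-integrable setT (EFin \o (fun x => c (u * x))).
Proof.
by apply: (@bounded_integrable _ _ _ mu _ 1) => //; exact: measurable_trig_scale.
Qed.

Lemma continuous_trig_transform : continuous (fun u : R => \int[mu]_x c (u * x)).
Proof.
apply: (@continuous_Rintegral _ _ _ mu (fun v x => c (v * x)) (fun=> 1)) => //.
- exact: measurable_trig_scale.
- by move=> x; exact: continuous_scalel.
- exact: finite_measure_integrable_cst.
Qed.

End trig_transform.

Section poisson_kernel.
Context {R : realType}.
Local Notation leb := (@lebesgue_measure R).
Variable (eps : R).
Hypothesis eps0 : 0 < eps.

Definition poisson_kernel (z : R) : R := 2 * eps / (eps ^+ 2 + z ^+ 2).

Let den_gt0 z : 0 < eps ^+ 2 + z ^+ 2.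
Proof. by rewrite ltr_wpDr ?sqr_ge0// exprn_gt0. Qed.

Lemma poisson_kernel_gt0 z : 0 < poisson_kernel z.
Proof. by rewrite divr_gt0// mulr_gt0. Qed.

(** An explicit primitive of [integrand]. The [1] added to the cosine makes the
integrand nonnegative, so that its improper integral is a monotone limit. *)
Let prim (z u : R) : R := expR (- (eps * u)) *
  (- eps^-1 + (z * sin (u * z) - eps * cos (u * z)) / (eps ^+ 2 + z ^+ 2)).

Let integrand (z u : R) : R := expR (- (eps * u)) * (1 + cos (u * z)).

Let is_derive_prim (z u : R) : is_derive u 1 (prim z) (integrand z u).
Proof.
rewrite /prim /integrand; apply: is_derive_eq.
rewrite /GRing.scale/=; field.
by rewrite !gt_eqF.
Qed.

Let continuous_integrand (z : R) : continuous (integrand z).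
Proof. by apply: is_derive_continuous => u; rewrite /integrand; apply: is_derive_eq. Qed.

Let prim_cvg0 z : prim z u @[u --> +oo] --> (0 : R).
Proof.
pose C := eps^-1 + (`|z| + eps) / (eps ^+ 2 + z ^+ 2).
have C0 : 0 < C.
  rewrite ltr_pwDl ?invr_gt0// divr_ge0 ?(ltW (den_gt0 _))//.
  by rewrite addr_ge0 ?(ltW eps0).
have bd u : `|prim z u| <= C * expR (- (eps * u)).
  rewrite /prim normrM [leLHS]mulrC (ger0_norm (expR_ge0 _)) ler_pM2r ?expR_gt0//.
  apply: (le_trans (ler_normD _ _)); rewrite normrN ger0_norm ?invr_ge0 ?(ltW eps0)//.
  rewrite lerD2l normrM normfV (ger0_norm (ltW (den_gt0 _))) ler_pM2r ?invr_gt0//.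
  apply: (le_trans (ler_normB _ _)); rewrite !normrM (ger0_norm (ltW eps0)).
  by apply: lerD; [rewrite ler_piMr// sin_max|rewrite ler_piMr ?(ltW eps0)// cos_max].
have e0 : C * expR (- (eps * u)) @[u --> +oo] --> (0 : R).
  rewrite -(mulr0 C); apply: cvgMl_tmp.
  have ey : eps * u @[u --> +oo] --> +oo by apply: gt0_cvgMry => //; exact: cvg_id.
  exact: (cvg_comp (fun u => eps * u) (fun y => expR (- y)) ey (@cvgr_expR R)).
apply: norm_cvg0; apply: (squeeze_cvgr _ (cvg_cst 0) e0).
by apply: nearW => u; rewrite normr_ge0 bd.
Qed.

Lemma poisson_half (z : R) : (\int[leb]_(u in `[0%R, +oo[) (integrand z u)%:E =
  (eps^-1 + eps / (eps ^+ 2 + z ^+ 2))%:E)%E.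
Proof.
rewrite (@ge0_continuous_FTC2y _ _ (prim z) 0 0).
- rewrite sub0e -EFinN; congr EFin; rewrite /prim mulr0 oppr0 expR0 mul0r sin0 cos0.
  by field; rewrite !gt_eqF.
- by move=> u _; rewrite mulr_ge0 ?expR_ge0//; have := cos_geN1 (u * z); lra.
- by apply: continuous_subspaceT; exact: continuous_integrand.
- exact: prim_cvg0.
- by move=> u _; case: (is_derive_prim z u).
- apply: cvg_at_right_filter.
  exact: (is_derive_continuous (is_derive_prim z)).
- by move=> u _; rewrite derive1E; apply: derive_val.
Qed.

Lemma poisson_full (z : R) : (\int[leb]_u
    (expR (- (eps * `|u|)) * (1 + cos (u * z)))%:E =
  (2 * (eps^-1 + eps / (eps ^+ 2 + z ^+ 2)))%:E)%E.
Proof.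
rewrite (@ge0_symfun_integralT _ (fun u => expR (- (eps * `|u|)) * (1 + cos (u * z)))).
- rewrite EFinM -poisson_half -set_itvcy; congr (_ * _)%E.
  apply: eq_integral => u; rewrite inE/= in_itv/= andbT => u0.
  by rewrite /integrand ger0_norm.
- by move=> u; rewrite mulr_ge0 ?expR_ge0//; have := cos_geN1 (u * z); lra.
- apply: continuous_mul.
    apply: (continuous_comp_fun _ (@continuous_expR R)).
    apply: continuous_opp; apply: continuous_mul; first exact: continuous_cst.
    exact: norm_continuous.
  apply: continuous_add; first exact: continuous_cst.
  apply: (continuous_comp_fun _ (@continuous_cos R)).
  by apply: continuous_mul; [exact: continuous_id|exact: continuous_cst].
- by move=> u /=; rewrite normrN mulNr cosN.
Qed.

End poisson_kernel.

Section Rintegral_fubini.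
Context {R : realType} d1 d2 (T1 : measurableType d1) (T2 : measurableType d2).
Variables (m1 : {sigma_finite_measure set T1 -> \bar R}).
Variables (m2 : {sigma_finite_measure set T2 -> \bar R}).
Variables (g : T1 -> T2 -> R) (p : T1 -> R) (q : T2 -> R).
Hypothesis mg : measurable_fun setT (fun z : T1 * T2 => g z.1 z.2).
Hypothesis gpq : forall x y, `|g x y| <= p x * q y.
Hypothesis ip : m1.-integrable setT (EFin \o p).
Hypothesis iq : m2.-integrable setT (EFin \o q).

Let mgl x : measurable_fun setT (g x).
Proof. exact: (measurableT_comp mg (pair1_measurable x)). Qed.

Let mgr y : measurable_fun setT (g ^~ y).
Proof. exact: (measurableT_comp mg (pair2_measurable y)). Qed.

Let igl x : m2.-integrable setT (EFin \o g x).
Proof.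
apply: (integrable_dominated (mgl x) (gpq x)).
rewrite (_ : _ \o _ = fun y => ((p x)%:E * (EFin \o q) y)%E); first exact: integrableZl.
by apply/funext => y /=; rewrite EFinM.
Qed.

Let igr y : m1.-integrable setT (EFin \o g ^~ y).
Proof.
apply: (integrable_dominated (mgr y) (fun x => gpq x y)).
rewrite (_ : _ \o _ = fun x => ((EFin \o p) x * (q y)%:E)%E); first exact: integrableZr.
by apply/funext => x /=; rewrite EFinM.
Qed.

Lemma dominated_Rfubini :
  \int[m1]_x (\int[m2]_y g x y) = \int[m2]_y (\int[m1]_x g x y).
Proof.
have G : (m1 \x m2)%E.-integrable setT (fun z => (g z.1 z.2)%:E).
  apply/integrable12ltyP; first exact/measurable_EFinP.
  apply: (@le_lt_trans _ _ (\int[m1]_x (`|(p x)%:E| * \int[m2]_y `|(q y)%:E|))%E).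
    apply: ge0_le_integral => //.
    - by move=> x _; apply: integral_ge0.
    - apply: (@measurable_fun_fubini_tonelli_F _ _ _ _ _ m2 (fun z => `|(g z.1 z.2)%:E|%E)) => //.
      by apply: measurableT_comp => //; exact/measurable_EFinP.
    - apply: emeasurable_funM => //; apply: measurableT_comp => //.
      exact: (measurable_int m1 ip).
    - move=> x _; rewrite -ge0_integralZl//; last first.
        by apply: measurableT_comp => //; exact: (measurable_int m2 iq).
      apply: ge0_le_integral => //.
      + by apply: measurableT_comp => //=; apply/measurable_EFinP; exact: mgl.
      + apply: emeasurable_funM => //; apply: measurableT_comp => //.
        exact: (measurable_int m2 iq).
      + move=> y _; rewrite -abseM -EFinM !abse_EFin lee_fin.
        by apply: le_trans (gpq x y) _; exact: ler_norm.
  have /integrableP[mp pfin] := ip; have /integrableP[mq qfin] := iq.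
  rewrite ge0_integralZr//; last 2 first.
  - exact: measurableT_comp.
  - exact: integral_ge0.
  by apply: lte_mul_pinfty => //; [exact: integral_ge0|
    rewrite ge0_fin_numE//; exact: integral_ge0].
have := Fubini G; rewrite /fubini_F/= => E.
rewrite /Rintegral; congr fine.
transitivity (\int[m1]_x \int[m2]_y (g x y)%:E)%E.
  by apply: eq_integral => x _; rewrite EFin_Rintegral//; exact: igl.
by rewrite E; apply: eq_integral => y _; rewrite EFin_Rintegral//; exact: igr.
Qed.

End Rintegral_fubini.

Section poisson_integrals.
Context {R : realType}.
Local Notation leb := (@lebesgue_measure R).
Variable (eps : R).
Hypothesis eps0 : 0 < eps.

(** Abel summation factor, whose cosine transform is the Poisson kernel. *)
Definition abel_weight (u : R) : R := expR (- (eps * `|u|)).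

Lemma continuous_abel_weight : continuous abel_weight.
Proof.
apply: (continuous_comp_fun _ (@continuous_expR R)).
apply: continuous_opp; apply: continuous_mul; first exact: continuous_cst.
exact: norm_continuous.
Qed.

Lemma continuous_cosM (z : R) : continuous (fun u : R => cos (u * z)).
Proof.
apply: (continuous_comp_fun _ (@continuous_cos R)).
by apply: continuous_mul; [exact: continuous_id|exact: continuous_cst].
Qed.

Let pos z u := abel_weight u * (1 + cos (u * z)).

Let integrable_pos z : leb.-integrable setT (EFin \o pos z).
Proof.
apply/integrableP; split.
  apply/measurable_EFinP; apply: continuous_measurable_fun.
  apply: continuous_mul; first exact: continuous_abel_weight.
  by apply: continuous_add; [exact: continuous_cst|exact: continuous_cosM].
under eq_integral.
  move=> u _; rewrite /= ger0_norm; last first.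
    by rewrite mulr_ge0 ?expR_ge0//; have := cos_geN1 (u * z); lra.
  over.
by rewrite poisson_full// ltry.
Qed.

Let pos0 u : abel_weight u = 2^-1 * pos 0 u.
Proof. by rewrite /pos mulr0 cos0; field. Qed.

Lemma integrable_abel_weight : leb.-integrable setT (EFin \o abel_weight).
Proof.
rewrite (_ : _ \o _ = fun u => ((2^-1)%:E * (EFin \o pos 0) u)%E).
  exact: integrableZl.
by apply/funext => u /=; rewrite pos0 EFinM.
Qed.

Lemma Rintegral_abel_cos z :
  \int[leb]_u (abel_weight u * cos (u * z)) = poisson_kernel eps z.
Proof.
have den0 y : 0 < eps ^+ 2 + y ^+ 2 by rewrite ltr_wpDr ?sqr_ge0// exprn_gt0.
have E y : \int[leb]_u pos y u = 2 * (eps^-1 + eps / (eps ^+ 2 + y ^+ 2)).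
  by rewrite /Rintegral poisson_full.
have -> : \int[leb]_u (abel_weight u * cos (u * z)) =
    \int[leb]_u (pos z u - 2^-1 * pos 0 u).
  by apply: eq_Rintegral => u _; rewrite -pos0 /pos; ring.
rewrite RintegralB//; last first.
  rewrite (_ : _ \o _ = fun u => ((2^-1)%:E * (EFin \o pos 0) u)%E).
    exact: integrableZl.
  by apply/funext => u /=; rewrite EFinM.
rewrite RintegralZl// !E /poisson_kernel; field.
by rewrite !gt_eqF// -?[0 ^+ 2]expr2 ?mulr0 ?addr0.
Qed.

End poisson_integrals.

(** * Fourier inversion and the loss *)

Section poisson_approximation.
Context {R : realType}.
Local Notation leb := (@lebesgue_measure R).

Lemma continuous_poisson_kernel (eps x : R) : 0 < eps ->
  continuous (fun y : R => poisson_kernel eps (y - x)).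
Proof.
move=> eps0 y; apply: cvgMl_tmp; apply: cvgV.
  by rewrite gt_eqF// ltr_wpDr ?sqr_ge0// exprn_gt0.
apply: cvgD; first exact: cvg_cst.
by apply: cvgM; apply: cvgB; [exact: cvg_id|exact: cvg_cst|exact: cvg_id|exact: cvg_cst].
Qed.

Arguments continuous_poisson_kernel : clear implicits.

Lemma poisson_kernel_near (eps x eta : R) : 0 < eps -> 0 < eta ->
  \int[leb]_(y in `[x - eta, x + eta]) poisson_kernel eps (y - x) =
  4 * atan (eta / eps).
Proof.
move=> eps0 eta0; pose F (y : R) : R := 2 * atan ((y - x) / eps).
have dF (y : R) : is_derive y 1 F (poisson_kernel eps (y - x)).
  rewrite /F; apply: is_derive_eq; rewrite /GRing.scale/= /poisson_kernel.
  field.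
  by rewrite !gt_eqF// ltr_wpDr ?sqr_ge0// exprn_gt0.
have cF := is_derive_continuous dF.
rewrite /Rintegral (@continuous_FTC2 _ _ F).
- rewrite -EFinB /= /F; have -> : x - eta - x = - eta by ring.
  have -> : x + eta - x = eta by ring.
  by rewrite mulNr atanN; ring.
- by rewrite ltrD2l gtrN.
- by apply: continuous_subspaceT; exact: (continuous_poisson_kernel eps x).
- split.
  + by move=> y _; case: (dF y).
  + by apply: cvg_at_right_filter; exact: cF.
  + by apply: cvg_at_left_filter; exact: cF.
- by move=> y _; rewrite derive1E; have [_ ->] := dF y.
Qed.

Variable f : R -> R.
Hypothesis cf : continuous f.
Hypothesis intf : leb.-integrable setT (EFin \o f).

Definition poisson_convolution (eps x : R) : R :=
  \int[leb]_y (f y * poisson_kernel eps (y - x)).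

Lemma poisson_kernel_le (eps z : R) : 0 < eps -> poisson_kernel eps z <= 2 / eps.
Proof.
move=> eps0; rewrite /poisson_kernel ler_pdivrMr; last first.
  by rewrite ltr_wpDr ?sqr_ge0// exprn_gt0.
have -> : 2 / eps * (eps ^+ 2 + z ^+ 2) = 2 * eps + 2 / eps * z ^+ 2.
  by field; rewrite gt_eqF.
by rewrite lerDl mulr_ge0 ?sqr_ge0// divr_ge0// ltW.
Qed.

Lemma integrable_poisson_convolution eps x : 0 < eps ->
  leb.-integrable setT (EFin \o (fun y => f y * poisson_kernel eps (y - x))).
Proof.
move=> eps0; have ck := continuous_poisson_kernel eps x eps0.
apply: (@integrable_dominated _ _ _ leb
  (fun y => f y * poisson_kernel eps (y - x)) (fun y => 2 / eps * `|f y|)).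
- by apply: measurable_funM; exact: continuous_measurable_fun.
- move=> y; rewrite normrM mulrC ler_wpM2r//.
  by rewrite ger0_norm ?poisson_kernel_le// ltW// poisson_kernel_gt0.
- rewrite (_ : _ \o _ = fun y => ((2 / eps)%:E * `|(EFin \o f) y|)%E).
    by apply: integrableZl => //; exact: integrable_abse.
  by apply/funext => y /=; rewrite EFinM.
Qed.

(** Near [x] the kernel has mass [4 atan (eta / eps)], which tends to [2 pi], and [f] is
almost constant; at distance more than [eta] the kernel is at most
[2 eps / eta ^ 2]. *)
Lemma poisson_convolution_near (eps x eta rho : R) : 0 < eps -> 0 < eta ->
  (forall y, `|y - x| <= eta -> `|f y - f x| <= rho) ->
  `|poisson_convolution eps x - f x * (4 * atan (eta / eps))| <=
  rho * (4 * atan (eta / eps)) + 2 * eps / eta ^+ 2 * \int[leb]_y `|f y|.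
Proof.
move=> eps0 eta0 frho.
have rho0 : 0 <= rho by apply: le_trans (frho x _); rewrite ?subrr ?normr0// ltW.
pose D : set R := `[x - eta, x + eta]%classic.
pose K := (fun y => poisson_kernel eps (y - x)) \_ D.
have K0 y : 0 <= K y.
  by rewrite /K patchE; case: ifP => // _; rewrite ltW// poisson_kernel_gt0.
have ck := continuous_poisson_kernel eps x eps0.
have iK : leb.-integrable setT (EFin \o K).
  rewrite /K -restrict_EFin; apply/(integrable_mkcond _ _).1; first exact: measurable_itv.
  apply: continuous_compact_integrable; first exact: segment_compact.
  exact: continuous_subspaceT.
have EK : \int[leb]_y K y = 4 * atan (eta / eps).
  by rewrite -(poisson_kernel_near x eps0 eta0) [RHS]Rintegral_mkcond.
have iabs : leb.-integrable setT (EFin \o (fun y => `|f y|)).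
  by rewrite (_ : _ \o _ = fun y => `|(EFin \o f) y|%E); [exact: integrable_abse|].
have iZ c g := @integrable_scale _ _ _ leb c g.
rewrite -EK /poisson_convolution -!RintegralZl//.
rewrite -RintegralB//; [|exact: integrable_poisson_convolution|exact: iZ].
rewrite -RintegralD//; [|exact: iZ|exact: iZ].
have mK : measurable_fun setT K.
  by move/measurable_int : iK => /measurable_EFinP.
apply: norm_Rintegral_le.
- apply: measurable_funB; apply: measurable_funM => //;
    exact: continuous_measurable_fun.
- move=> y; rewrite /K patchE; case: ifPn => [|].
    rewrite inE /D/= in_itv/= => /andP[y1 y2].
    rewrite -mulrBl normrM (ger0_norm (ltW (poisson_kernel_gt0 eps0 _))).
    rewrite -[leLHS]addr0 lerD//; last first.
      by rewrite mulr_ge0// divr_ge0 ?sqr_ge0// mulr_ge0// ltW.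
    rewrite ler_wpM2r ?(ltW (poisson_kernel_gt0 eps0 _))// frho//.
    by rewrite ler_distl y1 y2.
  rewrite notin_setE /D/= in_itv/= => yD.
  rewrite !mulr0 subr0 add0r normrM mulrC ler_wpM2r//.
  rewrite (ger0_norm (ltW (poisson_kernel_gt0 eps0 _))) /poisson_kernel.
  rewrite ler_pM2l ?mulr_gt0// lef_pV2 ?posrE ?exprn_gt0 ?ltr_wpDr ?sqr_ge0 ?exprn_gt0//.
  have : eta <= `|y - x|.
    by rewrite leNgt; apply/negP => yx; apply: yD; rewrite -ler_distl ltW.
  rewrite -(@ler_pXn2r _ 2) ?nnegrE ?(ltW eta0)// real_normK ?num_real// => h.
  by rewrite (le_trans h)// lerDr sqr_ge0.
- pose G1 y := rho * K y; pose G2 y := 2 * eps / eta ^+ 2 * `|f y|.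
  rewrite (_ : _ \o _ = ((EFin \o G1) \+ (EFin \o G2))%E); last first.
    by apply/funext => y /=; rewrite EFinD.
  by apply: integrableD => //; exact: iZ.
Qed.

Lemma poisson_convolution_cvg x :
  poisson_convolution n.+1%:R^-1 x @[n --> \oo] --> 2 * pi * f x.
Proof.
pose N := \int[leb]_y `|f y|.
have N0 : 0 <= N by apply: Rintegral_ge0.
have pi0 : 0 < pi :> R by exact: pi_gt0.
apply/cvgrPdist_le => e e0.
pose rho := e / (6 * pi); have rho0 : 0 < rho by rewrite divr_gt0// mulr_gt0.
have [eta /= eta0 feta] : exists2 eta : R, 0 < eta &
    forall y, `|y - x| <= eta -> `|f y - f x| <= rho.
  have /cvgrPdist_le/(_ rho rho0) := @cf x.
  move=> /nbhs_ballP[eta /= eta0 feta]; exists (eta / 2); first by rewrite divr_gt0.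
  move=> y yx; rewrite distrC; apply: feta; rewrite /ball/= distrC.
  by rewrite (le_lt_trans yx)// ltr_pdivrMr// ltr_pMr// ltr1n.
have h1 : atan (eta / n.+1%:R^-1 : R) @[n --> \oo] --> (pi / 2 : R).
  have etan : eta / n.+1%:R^-1 @[n --> \oo] --> +oo.
    apply/cvgryPge => A; have /cvgryPge/(_ (A / eta)) := @cvgr_idn R.
    apply: filterS => n; rewrite ler_pdivrMr// invrK mulrC => /le_trans; apply.
    by rewrite ler_pM2l// ler_nat.
  exact: (cvg_comp _ _ etan (@cvgy_atan R)).
have h2 : 2 * n.+1%:R^-1 / eta ^+ 2 * N @[n --> \oo] --> (0 : R).
  rewrite -[0](_ : 2 * 0 / eta ^+ 2 * N = 0); last by rewrite mulr0 !mul0r.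
  by do 2!apply: cvgMr_tmp; apply: cvgMl_tmp; exact: cvg_harmonic.
have h3 : f x * (4 * atan (eta / n.+1%:R^-1)) @[n --> \oo] --> f x * (4 * (pi / 2)).
  by do 2!apply: cvgMl_tmp.
have e3 : 0 < e / 3 by rewrite divr_gt0.
move/cvgrPdist_le : h2 => /(_ _ e3) h2; move/cvgrPdist_le : h3 => /(_ _ e3) h3.
near=> n.
have n0 : 0 < n.+1%:R^-1 :> R by rewrite invr_gt0.
have A2 : 4 * atan (eta / n.+1%:R^-1) <= 2 * pi.
  by have := atan_ltpi2 (eta / n.+1%:R^-1 : R); lra.
have := poisson_convolution_near n0 eta0 feta; rewrite -/N.
have : `|0 - 2 * n.+1%:R^-1 / eta ^+ 2 * N| <= e / 3 by near: n.
rewrite sub0r normrN => /(le_trans (ler_norm _)) b2.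
have : `|f x * (4 * (pi / 2)) - f x * (4 * atan (eta / n.+1%:R^-1))| <= e / 3 by near: n.
have -> : f x * (4 * (pi / 2)) = 2 * pi * f x.
  by move: (pi : R) => p; field.
have b1 : rho * (4 * atan (eta / n.+1%:R^-1)) <= e / 3.
  apply: (le_trans (ler_wpM2l (ltW rho0) A2)).
  have h (p : R) : 0 < p -> e / (6 * p) * (2 * p) = e / 3.
    by move=> p0; field; rewrite gt_eqF.
  by rewrite /rho h.
rewrite !ler_distl => /andP[c1 c2] /andP[d1 d2].
move: b1 b2 c1 c2 d1 d2; move: (2 * pi * f x) (poisson_convolution _ x)
  (f x * (4 * _)) (rho * (4 * _)) (2 / _ / _ * N) => P1 P2 P3 P4 P5.
by move=> *; apply/andP; split; lra.
Unshelve. all: by end_near. Qed.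

End poisson_approximation.

Section bounded_convergence.
Context {R : realType} d (T : measurableType d) (mu : {finite_measure set T -> \bar R}).

Lemma bounded_Rintegral_cvg (g : nat -> T -> R) (f : T -> R) (c : R) :
  (forall n, measurable_fun setT (g n)) -> measurable_fun setT f ->
  (forall n x, `|g n x| <= c) -> (forall x, g n x @[n --> \oo] --> f x) ->
  \int[mu]_x g n x @[n --> \oo] --> \int[mu]_x f x.
Proof.
move=> mg mf gc gf.
have fc x : `|f x| <= c.
  by apply: (cvgr_to_le (cvg_norm (gf x))); apply: nearW.
have [|||||_ _ H] := @dominated_convergence _ _ _ mu setT measurableT
  (fun n => EFin \o g n) (EFin \o f) (EFin \o (fun=> c)).
- by move=> n; exact/measurable_EFinP.
- exact/measurable_EFinP.
- by apply: aeW => x _; apply: cvg_EFin; [exact: nearW|exact: gf].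
- exact: finite_measure_integrable_cst.
- by apply: aeW => x n _ /=; rewrite lee_fin.
apply: fine_cvg; rewrite fineK//.
apply: integrable_fin_num => //; exact: (bounded_integrable mu mf fc).
Qed.

End bounded_convergence.

Section fourier_inversion.
Context {R : realType}.
Local Notation leb := (@lebesgue_measure R).
Variables (s : R) (f : R -> R).
Hypothesis s0 : 0 <= s.
Hypothesis sf : test_class s f.

Let cf : continuous f. Proof. by case: sf. Qed.
Let intf : leb.-integrable setT (EFin \o f). Proof. by case: sf. Qed.

Let a u := \int[leb]_y (f y * cos (u * y)).
Let b u := \int[leb]_y (f y * sin (u * y)).

Let fourierE u : fourier f u = Complex (a u) (b u).
Proof.
rewrite /fourier /cintegral /a /b; congr Complex; apply: eq_Rintegral => y _;
  by rewrite /cis /=; ring.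
Qed.

Let integrable_abs_f : leb.-integrable setT (EFin \o (fun y => `|f y|)).
Proof. by rewrite (_ : _ \o _ = fun y => `|(EFin \o f) y|%E); [exact: integrable_abse|]. Qed.

Let integrable_trig (c : R -> R) (u : R) : continuous c -> (forall y, `|c y| <= 1) ->
  leb.-integrable setT (EFin \o (fun y => f y * c (u * y))).
Proof.
move=> cc c1; apply: (@integrable_dominated _ _ _ leb _ (fun y => `|f y|)) => //.
  apply: measurable_funM; apply: continuous_measurable_fun => //.
  exact: continuous_scaler.
by move=> y; rewrite normrM ler_piMr.
Qed.

Let continuous_transform (c : R -> R) : continuous c -> (forall y, `|c y| <= 1) ->
  continuous (fun u : R => \int[leb]_y (f y * c (u * y))).
Proof.
move=> cc c1.
apply: (@continuous_Rintegral _ _ _ leb (fun v y => f y * c (v * y)) (fun y => `|f y|)).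
- by move=> v; apply: measurable_funM; apply: continuous_measurable_fun => //;
    exact: continuous_scaler.
- by move=> y; apply: continuous_mul; [exact: continuous_cst|exact: continuous_scalel].
- by move=> v y; rewrite normrM ler_piMr.
- exact: integrable_abs_f.
Qed.

Let ca : continuous a.
Proof. by apply: continuous_transform; [exact: continuous_cos|exact: cos_max]. Qed.

Let cb : continuous b.
Proof. by apply: continuous_transform; [exact: continuous_sin|exact: sin_max]. Qed.

Let G (u : R) := (1 + `|u|) `^ s * normc (fourier f u).

Let le_normc_fourier u : `|a u| <= normc (fourier f u) /\ `|b u| <= normc (fourier f u).
Proof.
rewrite fourierE /normc/=; split; rewrite -sqrtr_sqr ler_sqrt ?addr_ge0 ?sqr_ge0//.
  by rewrite lerDl sqr_ge0.
by rewrite lerDr sqr_ge0.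
Qed.

Let weight_ge1 (u : R) : 1 <= (1 + `|u|) `^ s.
Proof. by rewrite -[leLHS](powRr0 (1 + `|u|)) ler_powR// lerDl. Qed.

Let normc_fourier_ge0 u : 0 <= normc (fourier f u).
Proof. by rewrite fourierE sqrtr_ge0. Qed.

Let continuous_G : continuous G.
Proof.
apply: continuous_mul.
  have -> : (fun u : R => (1 + `|u|) `^ s) = (fun u : R => expR (s * ln (1 + `|u|))).
    by apply/funext => v; rewrite /powR gt_eqF// ltr_pwDl.
  apply: (continuous_comp_fun _ (@continuous_expR R)).
  apply: continuous_mul; first exact: continuous_cst.
  move=> v; apply: continuous_comp; last by apply: continuous_ln; rewrite ltr_pwDl.
  by apply: cvgD; [exact: cvg_cst|exact: norm_continuous].
have -> : (fun u => normc (fourier f u)) = (fun u => Num.sqrt (a u * a u + b u * b u)).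
  by apply/funext => u; rewrite fourierE /normc/= !expr2.
apply: (continuous_comp_fun _ (@sqrt_continuous R)).
by apply: continuous_add; apply: continuous_mul.
Qed.

Let G_ge0 u : 0 <= G u. Proof. by rewrite mulr_ge0 ?powR_ge0. Qed.

Let integrable_G : leb.-integrable setT (EFin \o G).
Proof.
apply/integrableP; split.
  by apply/measurable_EFinP; exact: continuous_measurable_fun.
under eq_integral do rewrite /= ger0_norm//.
by case: sf => _ _ /le_lt_trans; apply; rewrite ltry.
Qed.

Let integral_G : \int[leb]_u G u <= 1.
Proof. by rewrite -lee_fin EFin_Rintegral//; case: sf. Qed.

(** The inversion formula, without its factor [2 pi], regularized by Abel summation. *)
Let synthesis (eps x : R) := \int[leb]_u (abel_weight eps u *
  (a u * cos (u * x) + b u * sin (u * x))).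

Let synthesis_bound (p q : R) u : `|p| <= 1 -> `|q| <= 1 ->
  `|a u * p + b u * q| <= 2 * G u.
Proof.
move=> p1 q1; have [au bu] := le_normc_fourier u.
have nG : normc (fourier f u) <= G u by rewrite /G ler_peMl.
apply: (le_trans (ler_normD _ _)); rewrite !normrM.
have : `|a u| * `|p| <= `|a u| by rewrite ler_piMr.
have : `|b u| * `|q| <= `|b u| by rewrite ler_piMr.
lra.
Qed.

Let abel_weight_le1 (eps u : R) : 0 < eps -> 0 <= abel_weight eps u <= 1.
Proof.
move=> eps0; rewrite expR_ge0/= -expR0 ler_expR oppr_le0.
by rewrite mulr_ge0// ltW.
Qed.

(** Fubini and the cosine addition formula: the regularized inversion formula is a
convolution with the Poisson kernel. *)
Let synthesisE (eps x : R) : 0 < eps -> synthesis eps x = poisson_convolution f eps x.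
Proof.
move=> eps0.
pose g u y := abel_weight eps u * (f y * cos (u * (y - x))).
have E1 : synthesis eps x = \int[leb]_u (\int[leb]_y g u y).
  apply: eq_Rintegral => u _; rewrite /g.
  have i1 := integrable_trig u (@continuous_cos R) (@cos_max R).
  have i2 := integrable_trig u (@continuous_sin R) (@sin_max R).
  have iZ (c : R) (h : R -> R) : leb.-integrable setT (EFin \o h) ->
      leb.-integrable setT (EFin \o (fun y => h y * c)).
    move=> ih; rewrite (_ : _ \o _ = fun y => ((EFin \o h) y * c%:E)%E).
      exact: integrableZr.
    by apply/funext => y /=; rewrite EFinM.
  have cosE y : f y * cos (u * (y - x)) =
      f y * cos (u * y) * cos (u * x) + f y * sin (u * y) * sin (u * x).
    by rewrite mulrBr cosB; ring.
  have -> : \int[leb]_y (abel_weight eps u * (f y * cos (u * (y - x)))) =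
      abel_weight eps u * \int[leb]_y (f y * cos (u * y) * cos (u * x) +
        f y * sin (u * y) * sin (u * x)).
    rewrite -RintegralZl//.
      by apply: eq_Rintegral => y _; rewrite cosE.
    rewrite (_ : _ \o _ = ((EFin \o (fun y => f y * cos (u * y) * cos (u * x))%R) \+
      (EFin \o (fun y => f y * sin (u * y) * sin (u * x))%R))%E); last first.
      by apply/funext => y /=; rewrite EFinD.
    by apply: integrableD => //; exact: iZ.
  by rewrite RintegralD//; [rewrite !RintegralZr|exact: iZ|exact: iZ].
rewrite E1 (@dominated_Rfubini _ _ _ _ _ leb leb g (abel_weight eps) (fun y => `|f y|)).
- apply: eq_Rintegral => y _; rewrite /g -Rintegral_abel_cos//.
  rewrite -RintegralZl//.
    by apply: eq_Rintegral => u _; ring.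
  apply: (@integrable_dominated _ _ _ leb _ (abel_weight eps)).
  + apply: continuous_measurable_fun; apply: continuous_mul.
      exact: continuous_abel_weight.
    exact: continuous_cosM.
  + move=> u; rewrite normrM ger0_norm ?expR_ge0// ler_piMr ?expR_ge0//.
    exact: cos_max.
  + exact: integrable_abel_weight.
- apply: measurable_funM.
    apply: (measurableT_comp _ measurable_fst).
    by apply: continuous_measurable_fun; exact: continuous_abel_weight.
  apply: measurable_funM.
    by apply: (measurableT_comp _ measurable_snd); exact: continuous_measurable_fun.
  apply: measurableT_comp.
    by apply: continuous_measurable_fun; exact: continuous_cos.
  by apply: measurable_funM; [|apply: measurable_funB].
- move=> u y; rewrite !normrM ger0_norm ?expR_ge0// ler_wpM2l ?expR_ge0//.
  by rewrite ler_piMr// cos_max.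
- exact: integrable_abel_weight.
- exact: integrable_abs_f.
Qed.

Let synthesis_integrand_le (eps x u : R) : 0 < eps ->
  `|abel_weight eps u * (a u * cos (u * x) + b u * sin (u * x))| <= 2 * G u.
Proof.
move=> eps0; rewrite normrM; have /andP[w0 w1] := abel_weight_le1 u eps0.
rewrite ger0_norm//; apply: le_trans (synthesis_bound u (cos_max (u * x)) (sin_max (u * x))).
by rewrite ler_piMl.
Qed.

Let integrable_2G : leb.-integrable setT (EFin \o (fun u => 2 * G u)).
Proof. exact: integrable_scale. Qed.

Let measurable_synthesis (eps x : R) : measurable_fun setT
  (fun u => abel_weight eps u * (a u * cos (u * x) + b u * sin (u * x))).
Proof.
apply: continuous_measurable_fun; apply: continuous_mul.
  exact: continuous_abel_weight.
apply: continuous_add; apply: continuous_mul => //; apply: continuous_scalel.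
  exact: continuous_cos.
exact: continuous_sin.
Qed.

Let synthesis_le (eps x : R) : 0 < eps -> `|synthesis eps x| <= 2.
Proof.
move=> eps0; apply: (@le_trans _ _ (\int[leb]_u (2 * G u))).
  apply: norm_Rintegral_le.
  - exact: measurable_synthesis.
  - by move=> u; exact: synthesis_integrand_le.
  - exact: integrable_2G.
by rewrite RintegralZl//; have := integral_G; lra.
Qed.

Let continuous_synthesis (eps : R) : 0 < eps -> continuous (synthesis eps).
Proof.
move=> eps0; apply: (@continuous_Rintegral _ _ _ leb (fun x u => abel_weight eps u *
  (a u * cos (u * x) + b u * sin (u * x))) (fun u => 2 * G u)) => //.
- by move=> v; exact: measurable_synthesis.
- move=> u; apply: continuous_mul; first exact: continuous_cst.
  apply: continuous_add; (apply: continuous_mul; first exact: continuous_cst);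
    apply: continuous_scaler; [exact: continuous_cos|exact: continuous_sin].
- by move=> x u; exact: synthesis_integrand_le.
Qed.

Let cvg_synthesis (x : R) : synthesis n.+1%:R^-1 x @[n --> \oo] --> 2 * pi * f x.
Proof.
under eq_fun do rewrite synthesisE ?invr_gt0//.
exact: poisson_convolution_cvg.
Qed.

Section two_measures.
Variable mu : finite_borel_measure R.

Let C u := \int[mu]_x cos (u * x).
Let S u := \int[mu]_x sin (u * x).

Lemma measurable_synthesis_integrand (eps : R) :
  measurable_fun setT (fun z : measurableTypeR R * measurableTypeR R =>
    abel_weight eps z.2 * (a z.2 * cos (z.2 * z.1) + b z.2 * sin (z.2 * z.1))).
Proof.
have m1 (h : R -> R) : continuous h -> measurable_fun setT
    (fun z : measurableTypeR R * measurableTypeR R => h z.2).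
  move=> ch; apply: (measurableT_comp _ measurable_snd).
  exact: continuous_measurable_fun.
have m2 (h : R -> R) : continuous h -> measurable_fun setT
    (fun z : measurableTypeR R * measurableTypeR R => h (z.2 * z.1)).
  move=> ch; apply: measurableT_comp; first exact: continuous_measurable_fun.
  exact: measurable_funM.
apply: measurable_funM; first by apply: (m1 (abel_weight eps)); exact: continuous_abel_weight.
apply: measurable_funD; apply: measurable_funM.
- exact: (m1 a).
- by apply: (m2 cos); exact: continuous_cos.
- exact: (m1 b).
- by apply: (m2 sin); exact: continuous_sin.
Qed.

Lemma Rintegral_synthesis (eps : R) : 0 < eps ->
  \int[mu]_x synthesis eps x =
  \int[leb]_u (abel_weight eps u * (a u * C u + b u * S u)).
Proof.
move=> eps0.
pose g (x u : R) := abel_weight eps u * (a u * cos (u * x) + b u * sin (u * x)).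
rewrite (@dominated_Rfubini _ _ _ _ _ mu leb g (fun=> 1) (fun u => 2 * G u)).
- apply: eq_Rintegral => u _; rewrite /g.
  have i1 := @integrable_trig_scale _ mu _ (@continuous_cos R) (@cos_max R) u.
  have i2 := @integrable_trig_scale _ mu _ (@continuous_sin R) (@sin_max R) u.
  have iZ c (h : R -> R) := @integrable_scale _ _ _ mu c h.
  rewrite RintegralZl//.
    by rewrite RintegralD//; [rewrite !RintegralZl|exact: iZ|exact: iZ].
  rewrite (_ : _ \o _ = ((EFin \o (fun x => a u * cos (u * x))%R) \+
      (EFin \o (fun x => b u * sin (u * x))%R))%E); last first.
    by apply/funext => x /=; rewrite EFinD.
  by apply: integrableD => //; exact: iZ.
- exact: measurable_synthesis_integrand.
- by move=> x u; rewrite mul1r; exact: synthesis_integrand_le.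
- exact: finite_measure_integrable_cst.
- exact: integrable_2G.
Qed.

Lemma Rintegral_synthesis_cvg :
  \int[mu]_x synthesis n.+1%:R^-1 x @[n --> \oo] --> 2 * pi * \int[mu]_x f x.
Proof.
have fb x : `|f x| <= 1.
  have p1 : 1 <= pi :> R by have := @pi_ge2 R; lra.
  have : `|2 * pi * f x| <= 2.
    apply: (cvgr_to_le (cvg_norm (cvg_synthesis (x := x)))); apply: nearW => n.
    by apply: synthesis_le; rewrite invr_gt0.
  rewrite !normrM (ger0_norm (_ : 0 <= pi)) ?pi_ge0// ger0_norm//.
  by have := normr_ge0 (f x); nra.
have mf : measurable_fun [set: measurableTypeR R] f by exact: continuous_measurable_fun.
rewrite -RintegralZl//; last exact: (bounded_integrable mu mf fb).
apply: (@bounded_Rintegral_cvg _ _ _ mu _ _ 2).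
- by move=> n; apply: continuous_measurable_fun; apply: continuous_synthesis; rewrite invr_gt0.
- exact: measurable_funM.
- by move=> n x; apply: synthesis_le; rewrite invr_gt0.
- exact: cvg_synthesis.
Qed.

End two_measures.

(** A test function is an average of trigonometric functions with weights of total
mass at most one against [(1 + |u|) ^ s]. The regularized average can be integrated term by
term against a finite measure, and the regularization is removed by dominated
convergence. The constant is [1] because [2 pi >= 2]. *)
Lemma test_function_integral_le (mu1 mu2 : finite_borel_measure R) (B : R) :
  (forall u : R, `|\int[mu1]_x cos (u * x) - \int[mu2]_x cos (u * x)| <=
     B * (1 + `|u|) `^ s) ->
  (forall u : R, `|\int[mu1]_x sin (u * x) - \int[mu2]_x sin (u * x)| <=
     B * (1 + `|u|) `^ s) ->
  `|\int[mu1]_x f x - \int[mu2]_x f x| <= B.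
Proof.
move=> hC hS.
have p1 : 1 <= pi :> R by have := @pi_ge2 R; lra.
suff H : `|2 * pi * (\int[mu1]_x f x) - 2 * pi * (\int[mu2]_x f x)| <= 2 * B.
  move: H; rewrite -mulrBr !normrM (ger0_norm (_ : 0 <= pi)) ?pi_ge0// ger0_norm//.
  by have := normr_ge0 (\int[mu1]_x f x - \int[mu2]_x f x); nra.
have cvgI := cvgB (@Rintegral_synthesis_cvg mu1) (@Rintegral_synthesis_cvg mu2).
apply: (cvgr_to_le (cvg_norm (cvgI _))); apply: nearW => n /=.
have n0 : 0 < n.+1%:R^-1 :> R by rewrite invr_gt0.
rewrite -[X in `|X|]/(\int[mu1]_x synthesis n.+1%:R^-1 x -
  \int[mu2]_x synthesis n.+1%:R^-1 x) !Rintegral_synthesis//.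
have iT (mu : finite_borel_measure R) : leb.-integrable setT (EFin \o (fun u =>
   abel_weight n.+1%:R^-1 u * (a u * (\int[mu]_x cos (u * x)) +
     b u * (\int[mu]_x sin (u * x))))).
  have bd (c : R -> R) u : continuous c -> (forall y, `|c y| <= 1) ->
      `|\int[mu]_x c (u * x)| <= fine (mu setT).
    move=> cc c1; rewrite -[leRHS]mul1r; apply: norm_Rintegral_bound => //.
    exact: measurable_trig_scale.
  apply: (@integrable_dominated _ _ _ leb _ (fun u => fine (mu setT) * (2 * G u))).
  - apply: continuous_measurable_fun; apply: continuous_mul.
      exact: continuous_abel_weight.
    apply: continuous_add; apply: continuous_mul => //; apply: continuous_trig_transform.
    + exact: continuous_cos.
    + exact: cos_max.
    + exact: continuous_sin.
    + exact: sin_max.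
  - move=> u; rewrite normrM; have /andP[w0 w1] := abel_weight_le1 u n0.
    rewrite ger0_norm//; apply: (le_trans (ler_piMl (normr_ge0 _) w1)).
    apply: (le_trans (ler_normD _ _)); rewrite !normrM.
    have [au bu] := le_normc_fourier u.
    have nG : normc (fourier f u) <= G u by rewrite /G ler_peMl.
    have := bd cos u (@continuous_cos R) (@cos_max R).
    have := bd sin u (@continuous_sin R) (@sin_max R).
    have := normr_ge0 (a u); have := normr_ge0 (b u).
    have := normr_ge0 (\int[mu]_x cos (u * x)).
    have := normr_ge0 (\int[mu]_x sin (u * x)).
    by nra.
  - exact: integrable_scale.
rewrite -RintegralB//.
have B0 : 0 <= B.
  by have := hC 0; rewrite normr0 addr0 powR1 mulr1; exact: le_trans.
apply: (@le_trans _ _ (\int[leb]_u (2 * B * G u))).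
  apply: norm_Rintegral_le.
  - by apply: measurable_funB; [have /measurable_int/measurable_EFinP := iT mu1|
                                have /measurable_int/measurable_EFinP := iT mu2].
  - move=> u; rewrite -mulrBr normrM; have /andP[w0 w1] := abel_weight_le1 u n0.
    rewrite ger0_norm//; apply: (le_trans (ler_piMl (normr_ge0 _) w1)).
    rewrite [X in `|X|](_ : _ =
      a u * (\int[mu1]_x cos (u * x) - \int[mu2]_x cos (u * x)) +
      b u * (\int[mu1]_x sin (u * x) - \int[mu2]_x sin (u * x))); last by ring.
    apply: (le_trans (ler_normD _ _)); rewrite !normrM.
    have [au bu] := le_normc_fourier u.
    have -> : 2 * B * G u = normc (fourier f u) * (B * (1 + `|u|) `^ s) +
      normc (fourier f u) * (B * (1 + `|u|) `^ s) by rewrite /G; ring.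
    by apply: lerD; apply: ler_pM.
  - exact: integrable_scale.
rewrite RintegralZl//; have := integral_G; nra.
Qed.

End fourier_inversion.

Lemma loss_le {R : realType} (s : R) (mu1 mu2 : finite_borel_measure R) (B : R) :
  0 <= s ->
  (forall u : R, `|\int[mu1]_x cos (u * x) - \int[mu2]_x cos (u * x)| <=
     B * (1 + `|u|) `^ s) ->
  (forall u : R, `|\int[mu1]_x sin (u * x) - \int[mu2]_x sin (u * x)| <=
     B * (1 + `|u|) `^ s) ->
  (loss s mu1 mu2 <= B%:E)%E.
Proof.
move=> s0 hC hS; apply: ge_ereal_sup => _ [f sf <-].
by rewrite lee_fin; exact: (test_function_integral_le s0 sf).
Qed.

(** * Derivatives of the Levy exponent *)

Section derive_under_integral.
Context {R : realType} d (T : measurableType d) (mu : {measure set T -> \bar R}).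

Lemma is_derive_Rintegral (F F1 : R -> T -> R) (G : T -> R) (u : R) :
  (forall v, mu.-integrable setT (EFin \o F v)) ->
  (forall (v : R) x, is_derive v 1 (F ^~ x) (F1 v x)) ->
  mu.-integrable setT (EFin \o G) ->
  (forall (v : R) x, `|v - u| < 1 -> `|F1 v x| <= G x) ->
  is_derive u 1 (fun v => \int[mu]_x F v x) (\int[mu]_x F1 u x).
Proof.
move=> iF dF iG F1G.
have p1 v x : partial1of2 F v x = F1 v x.
  by rewrite /partial1of2 derive1E; have [_ ->] := dF v x.
have Iu : `]u - 1, u + 1[%classic u by rewrite /= in_itv/= ltrBlDr ltrDl ltr01.
have G0 x : 0 <= G x by apply: le_trans (F1G u x _); rewrite ?subrr ?normr0.
have dFx v x : `]u - 1, u + 1[%classic v -> [set: T] x -> derivable (F ^~ x) v 1.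
  by move=> _ _; have [] := dF v x.
have Gub v x : `]u - 1, u + 1[%classic v -> [set: T] x -> `|partial1of2 F v x| <= G x.
  by rewrite /= in_itv/= => uv _; rewrite p1 F1G// ltr_distl.
have iFI v : `]u - 1, u + 1[%classic v -> mu.-integrable setT (EFin \o F v) by [].
apply: DeriveDef.
  exact: (derivable_under_integral measurableT Iu iFI dFx G0 iG Gub).
rewrite -derive1E (differentiation_under_integral measurableT Iu iFI dFx G0 iG Gub).
by apply: eq_Rintegral => x _; rewrite p1.
Qed.

End derive_under_integral.

Section lipschitz.
Context {R : realType}.

Lemma is_derive_lipschitz (f df : R -> R) (c u v : R) :
  (forall x : R, is_derive x 1 f (df x)) ->
  (forall x, Num.min u v <= x <= Num.max u v -> `|df x| <= c) ->
  `|f u - f v| <= c * `|u - v|.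
Proof.
move=> fd dfc; have cf := is_derive_continuous fd.
wlog uv : u v dfc / u <= v.
  move=> H; have [uv|vu] := leP u v; first exact: H.
  rewrite distrC [`|u - v|]distrC; apply: H; last exact: ltW.
  by move=> x; rewrite minC maxC; exact: dfc.
have [|c' c'uv E] := @MVT_segment R f df u v uv (fun x _ => fd x).
  exact: continuous_subspaceT.
rewrite distrC E normrM [`|u - v|]distrC ler_wpM2r//; apply: dfc.
by move: c'uv; rewrite in_itv/= (min_idPl uv) (max_idPr uv).
Qed.

Lemma cos_lipschitz (u v : R) : `|cos u - cos v| <= `|u - v|.
Proof.
rewrite -[leRHS]mul1r; apply: (is_derive_lipschitz (df := fun x => - sin x)) => x.
by rewrite normrN sin_max.
Qed.

Lemma sin_lipschitz (u v : R) : `|sin u - sin v| <= `|u - v|.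
Proof.
rewrite -[leRHS]mul1r; apply: (is_derive_lipschitz (df := cos)) => x.
by rewrite cos_max.
Qed.

(** Iterated, this is Taylor's inequality without the factorial. *)
Lemma is_derive_growth (f df : R -> R) (c u : R) n : 0 <= c ->
  (forall x : R, is_derive x 1 f (df x)) -> f 0 = 0 ->
  (forall x : R, `|df x| <= c * `|x| ^+ n) -> `|f u| <= c * `|u| ^+ n.+1.
Proof.
move=> c0 fd f0 dfc.
have := @is_derive_lipschitz f df (c * `|u| ^+ n) u 0 fd.
rewrite f0 !subr0 exprSr mulrA; apply => x xu; apply: (le_trans (dfc x)).
rewrite ler_wpM2l// lerXn2r ?nnegrE//.
move: xu; case: (leP u 0) => u0.
  by move=> /andP[ux x0]; rewrite !ler0_norm// lerN2.
by move=> /andP[x0 ux]; rewrite (ger0_norm x0) (gtr0_norm u0).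
Qed.

End lipschitz.

Local Open Scope complex_scope.

Section complex_derivatives.
Context {R : realType}.

Lemma cderiveE0 (f : R -> R[i]) (u : R) : cderive 0 f u = f u.
Proof. by rewrite /cderive /=; case: (f u). Qed.

Lemma cderiveE1 (f : R -> R[i]) (f1 g1 : R -> R) (u : R) :
  (forall v : R, is_derive v 1 (fun v : R => complex.Re (f v)) (f1 v)) ->
  (forall v : R, is_derive v 1 (fun v : R => complex.Im (f v)) (g1 v)) ->
  cderive 1 f u = f1 u +i* g1 u.
Proof.
move=> ff fg; rewrite /cderive /derive1n /= !derive1E.
by have [_ ->] := ff u; have [_ ->] := fg u.
Qed.

Lemma cderiveE2 (f : R -> R[i]) (f1 g1 f2 g2 : R -> R) (u : R) :
  (forall v : R, is_derive v 1 (fun v : R => complex.Re (f v)) (f1 v)) ->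
  (forall v : R, is_derive v 1 (fun v : R => complex.Im (f v)) (g1 v)) ->
  (forall v : R, is_derive v 1 f1 (f2 v)) ->
  (forall v : R, is_derive v 1 g1 (g2 v)) ->
  cderive 2 f u = f2 u +i* g2 u.
Proof.
move=> ff fg ff1 fg1; rewrite /cderive /derive1n /=.
have -> : (fun v : R => complex.Re (f v))^`()%classic = f1.
  by apply/funext => v; rewrite derive1E; have [_ ->] := ff v.
have -> : (fun v : R => complex.Im (f v))^`()%classic = g1.
  by apply/funext => v; rewrite derive1E; have [_ ->] := fg v.
by rewrite !derive1E; have [_ ->] := ff1 u; have [_ ->] := fg1 u.
Qed.

End complex_derivatives.

Section derivatives_of_an_exponential.
Context {R : realType}.
Variables (A B A1 B1 A2 B2 : R -> R).
Hypothesis dA : forall u : R, is_derive u 1 A (A1 u).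
Hypothesis dB : forall u : R, is_derive u 1 B (B1 u).
Hypothesis dA1 : forall u : R, is_derive u 1 A1 (A2 u).
Hypothesis dB1 : forall u : R, is_derive u 1 B1 (B2 u).

Let f u : R[i] := cexp (A u +i* B u).

Let re u := expR (A u) * cos (B u).
Let im u := expR (A u) * sin (B u).

Let fE u : f u = re u +i* im u.
Proof. by rewrite /f /cexp /cis /=; simpc. Qed.

Let dre (u : R) : is_derive u 1 re (A1 u * re u - B1 u * im u).
Proof.
have := dA u; have := dB u => ? ?.
rewrite /re; apply: is_derive_eq.
by rewrite /im /GRing.scale /=; ring.
Qed.

Let dim (u : R) : is_derive u 1 im (A1 u * im u + B1 u * re u).
Proof.
have := dA u; have := dB u => ? ?.
rewrite /im; apply: is_derive_eq.
by rewrite /re /GRing.scale /=; ring.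
Qed.

Let dref (u : R) : is_derive u 1 (fun v : R => complex.Re (f v)) (A1 u * re u - B1 u * im u).
Proof.
rewrite (_ : (fun v => _) = re); first exact: dre.
by apply/funext => v; rewrite fE.
Qed.

Let dimf (u : R) : is_derive u 1 (fun v : R => complex.Im (f v)) (A1 u * im u + B1 u * re u).
Proof.
rewrite (_ : (fun v => _) = im); first exact: dim.
by apply/funext => v; rewrite fE.
Qed.

Lemma cderive1_cexp (u : R) : cderive 1 f u = (A1 u +i* B1 u) * f u.
Proof. by rewrite (cderiveE1 _ dref dimf) fE; simpc. Qed.

Lemma cderive2_cexp (u : R) :
  cderive 2 f u = ((A2 u +i* B2 u) + (A1 u +i* B1 u) ^+ 2) * f u.
Proof.
have d2 (v : R) : is_derive v 1 (fun v : R => A1 v * re v - B1 v * im v)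
   (A2 v * re v + A1 v * (A1 v * re v - B1 v * im v) -
    (B2 v * im v + B1 v * (A1 v * im v + B1 v * re v))).
  have := dA1 v; have := dB1 v; have := dre v; have := dim v => ? ? ? ?.
  apply: is_derive_eq; rewrite /GRing.scale /=; ring.
have d3 (v : R) : is_derive v 1 (fun v : R => A1 v * im v + B1 v * re v)
   (A2 v * im v + A1 v * (A1 v * im v + B1 v * re v) +
    (B2 v * re v + B1 v * (A1 v * re v - B1 v * im v))).
  have := dA1 v; have := dB1 v; have := dre v; have := dim v => ? ? ? ?.
  apply: is_derive_eq; rewrite /GRing.scale /=; ring.
rewrite (cderiveE2 _ dref dimf d2 d3) fE expr2; simpc.
by congr (_ +i* _); ring.
Qed.

End derivatives_of_an_exponential.

Section levy_kernels.
Context {R : realType}.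
Implicit Types u v x : R.

(** The branches at [x = 0] are the limits of the others: thus the second derivatives
in [u] of the kernels are [- cos (u * x)] and [- sin (u * x)] for every [x]. *)
Definition levy_kernel_re u x :=
  if x == 0 then - (u ^+ 2 / 2) else (cos (u * x) - 1) / x ^+ 2.
Definition levy_kernel_im u x :=
  if x == 0 then 0 else (sin (u * x) - u * x) / x ^+ 2.
Definition levy_kernel1_re u x := if x == 0 then - u else - sin (u * x) / x.
Definition levy_kernel1_im u x := if x == 0 then 0 else (cos (u * x) - 1) / x.

Lemma levy_kernelE u x :
  levy_kernel u x = levy_kernel_re u x +i* levy_kernel_im u x.
Proof.
rewrite /levy_kernel /levy_kernel_re /levy_kernel_im; case: eqVneq => // x0.
rewrite -fmorphV /= /cis; simpc.
by congr (_ +i* _); ring.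
Qed.

Lemma is_derive_levy_kernel_re (v : R) x :
  is_derive v 1 (levy_kernel_re ^~ x) (levy_kernel1_re v x).
Proof.
rewrite /levy_kernel_re /levy_kernel1_re; case: eqVneq => x0.
  by apply: is_derive_eq; rewrite /GRing.scale /=; field.
by apply: is_derive_eq; rewrite /GRing.scale /=; field.
Qed.

Lemma is_derive_levy_kernel_im (v : R) x :
  is_derive v 1 (levy_kernel_im ^~ x) (levy_kernel1_im v x).
Proof.
rewrite /levy_kernel_im /levy_kernel1_im; case: eqVneq => x0.
  by apply: is_derive_eq; rewrite /GRing.scale /=; field.
by apply: is_derive_eq; rewrite /GRing.scale /=; field.
Qed.

Lemma is_derive_levy_kernel1_re (v : R) x :
  is_derive v 1 (levy_kernel1_re ^~ x) (- cos (v * x)).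
Proof.
rewrite /levy_kernel1_re; case: eqVneq => [->|x0].
  by apply: is_derive_eq; rewrite /GRing.scale /= mulr0 cos0; ring.
by apply: is_derive_eq; rewrite /GRing.scale /=; field.
Qed.

Lemma is_derive_levy_kernel1_im (v : R) x :
  is_derive v 1 (levy_kernel1_im ^~ x) (- sin (v * x)).
Proof.
rewrite /levy_kernel1_im; case: eqVneq => [->|x0].
  by apply: is_derive_eq; rewrite mulr0 sin0; ring.
by apply: is_derive_eq; rewrite /GRing.scale /=; field.
Qed.

Lemma levy_kernel1_re_le u x : `|levy_kernel1_re u x| <= `|u|.
Proof.
rewrite -[leRHS]mul1r -[X in _ * X]expr1.
apply: (@is_derive_growth R (levy_kernel1_re ^~ x) _ 1 u _ ler01
  (fun v => @is_derive_levy_kernel1_re v x)).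
  by rewrite /levy_kernel1_re; case: eqP; rewrite ?mul0r ?sin0 ?oppr0 ?mul0r.
by move=> v; rewrite expr0 mulr1 normrN cos_max.
Qed.

Lemma levy_kernel1_im_le u x : `|levy_kernel1_im u x| <= `|u|.
Proof.
rewrite -[leRHS]mul1r -[X in _ * X]expr1.
apply: (@is_derive_growth R (levy_kernel1_im ^~ x) _ 1 u _ ler01
  (fun v => @is_derive_levy_kernel1_im v x)).
  by rewrite /levy_kernel1_im; case: eqP; rewrite ?mul0r ?cos0 ?subrr ?mul0r.
by move=> v; rewrite expr0 mulr1 normrN sin_max.
Qed.

Lemma levy_kernel_re_le u x : `|levy_kernel_re u x| <= u ^+ 2.
Proof.
rewrite -[leRHS]mul1r -[X in _ * X]real_normK ?num_real//.
apply: (@is_derive_growth R (levy_kernel_re ^~ x) _ 1 u _ ler01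
  (fun v => @is_derive_levy_kernel_re v x)).
  by rewrite /levy_kernel_re; case: eqP; rewrite ?mul0r ?cos0 ?subrr ?expr0n/= ?mul0r ?oppr0.
by move=> v; rewrite expr1 mul1r levy_kernel1_re_le.
Qed.

Lemma levy_kernel_im_le u x : `|levy_kernel_im u x| <= u ^+ 2.
Proof.
rewrite -[leRHS]mul1r -[X in _ * X]real_normK ?num_real//.
apply: (@is_derive_growth R (levy_kernel_im ^~ x) _ 1 u _ ler01
  (fun v => @is_derive_levy_kernel_im v x)).
  by rewrite /levy_kernel_im; case: eqP; rewrite ?mul0r ?sin0 ?subrr ?mul0r.
by move=> v; rewrite expr1 mul1r levy_kernel1_im_le.
Qed.

Lemma levy_kernel_re_le0 v x : levy_kernel_re v x <= 0.
Proof.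
rewrite /levy_kernel_re.
case: eqP => _; first by rewrite oppr_le0 divr_ge0 ?sqr_ge0.
by rewrite mulr_le0_ge0 ?invr_ge0 ?sqr_ge0// subr_le0 cos_le1.
Qed.

Lemma measurable_if_eq0 (f g : R -> R) :
  measurable_fun [set: measurableTypeR R] f -> measurable_fun [set: measurableTypeR R] g ->
  measurable_fun [set: measurableTypeR R] (fun x => if x == 0 then f x else g x).
Proof.
move=> mf mg; apply: measurable_fun_ifT => //.
exact: measurable_fun_eqr.
Qed.
 
End levy_kernels.

Lemma measurable_funV {R : realType} d (T : measurableType d) (f : T -> R) :
  measurable_fun setT f -> measurable_fun setT (fun x => (f x)^-1).
Proof.
move=> mf.
(* the inverse is discontinuous at 0, but the power function is measurable *)
have -> : (fun x => (f x)^-1) = (fun x => f x * (f x ^+ 2) `^ (- 1)).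
  apply/funext => x; rewrite powR_inv1 ?sqr_ge0// expr2.
  by have [->|fx0] := eqVneq (f x) 0; [rewrite invr0 mul0r|field].
apply: measurable_funM => //.
by apply: measurableT_comp (measurable_powR _) _; exact: measurable_funX.
Qed.

Section exponent_derivatives.
Context {R : realType} (nu : finite_borel_measure R).

Let m := fine (nu setT).

Let mcos (u : R) : measurable_fun [set: measurableTypeR R] (fun x => cos (u * x)).
Proof. by apply: measurable_trig_scale; exact: continuous_cos. Qed.

Let msin (u : R) : measurable_fun [set: measurableTypeR R] (fun x => sin (u * x)).
Proof. by apply: measurable_trig_scale; exact: continuous_sin. Qed.

Let mux (u : R) : measurable_fun [set: measurableTypeR R] (fun x : R => u * x).
Proof. by apply: measurable_funM; [exact: measurable_cst|exact: measurable_id]. Qed.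

Lemma measurable_levy_kernel_re (u : R) :
  measurable_fun [set: measurableTypeR R] (levy_kernel_re u).
Proof.
apply: measurable_if_eq0; first exact: measurable_cst.
apply: measurable_funM.
  by apply: measurable_funB; [exact: mcos|exact: measurable_cst].
by apply: measurable_funV; apply: measurable_funX; exact: measurable_id.
Qed.

Lemma measurable_levy_kernel_im (u : R) :
  measurable_fun [set: measurableTypeR R] (levy_kernel_im u).
Proof.
apply: measurable_if_eq0; first exact: measurable_cst.
apply: measurable_funM.
  by apply: measurable_funB; [exact: msin|exact: mux].
by apply: measurable_funV; apply: measurable_funX; exact: measurable_id.
Qed.

Lemma measurable_levy_kernel1_re (u : R) :
  measurable_fun [set: measurableTypeR R] (levy_kernel1_re u).
Proof.
apply: measurable_if_eq0; first exact: measurable_cst.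
apply: measurable_funM; last by apply: measurable_funV; exact: measurable_id.
by apply: measurableT_comp => //; exact: msin.
Qed.

Lemma measurable_levy_kernel1_im (u : R) :
  measurable_fun [set: measurableTypeR R] (levy_kernel1_im u).
Proof.
apply: measurable_if_eq0; first exact: measurable_cst.
apply: measurable_funM; last by apply: measurable_funV; exact: measurable_id.
by apply: measurable_funB; [exact: mcos|exact: measurable_cst].
Qed.

Lemma is_derive_finite_Rintegral (F F1 : R -> R -> R) (u : R) (p : nat) :
  (forall v, measurable_fun [set: measurableTypeR R] (F v)) ->
  (forall v x, `|F v x| <= `|v| ^+ p) ->
  (forall (v : R) x, is_derive v 1 (F ^~ x) (F1 v x)) ->
  (forall v x, `|F1 v x| <= `|v| ^+ p.-1) ->
  is_derive u 1 (fun v : R => \int[nu]_x F v x : R) (\int[nu]_x F1 u x).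
Proof.
move=> mF Fle dF F1le.
apply: (@is_derive_Rintegral _ _ _ nu F F1 (fun=> (`|u| + 1) ^+ p.-1) u) => //.
- by move=> v; exact: (@bounded_integrable _ _ _ nu _ (`|v| ^+ p)).
- exact: finite_measure_integrable_cst.
- move=> v x vu; apply: (le_trans (F1le v x)).
  rewrite lerXn2r ?nnegrE ?addr_ge0//.
  by rewrite -[v](subrK u) (le_trans (ler_normD _ _))// addrC lerD2l ltW.
Qed.

Variable b : R.

Definition levy_re u := \int[nu]_x levy_kernel_re u x.
Definition levy_im u := u * b + \int[nu]_x levy_kernel_im u x.
Definition levy1_re u := \int[nu]_x levy_kernel1_re u x.
Definition levy1_im u := b + \int[nu]_x levy_kernel1_im u x.
Definition levy2_re u := \int[nu]_x (- cos (u * x)).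
Definition levy2_im u := \int[nu]_x (- sin (u * x)).

Lemma levy_exponentE (u : R) : levy_exponent b nu u = levy_re u +i* levy_im u.
Proof.
rewrite /levy_exponent /cintegral; simpc; congr (_ +i* _).
  by apply: eq_Rintegral => x _; rewrite levy_kernelE.
by congr (_ + _); apply: eq_Rintegral => x _; rewrite levy_kernelE.
Qed.

Lemma is_derive_levy_re (u : R) : is_derive u 1 levy_re (levy1_re u).
Proof.
apply: (@is_derive_finite_Rintegral levy_kernel_re levy_kernel1_re _ 2).
- exact: measurable_levy_kernel_re.
- by move=> v x; rewrite real_normK ?num_real// levy_kernel_re_le.
- exact: is_derive_levy_kernel_re.
- by move=> v x; rewrite expr1 levy_kernel1_re_le.
Qed.

Lemma is_derive_levy_im (u : R) : is_derive u 1 levy_im (levy1_im u).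
Proof.
have : is_derive u 1 (fun v : R => \int[nu]_x levy_kernel_im v x : R)
    (\int[nu]_x levy_kernel1_im u x).
  apply: (@is_derive_finite_Rintegral levy_kernel_im levy_kernel1_im _ 2).
  - exact: measurable_levy_kernel_im.
  - by move=> v x; rewrite real_normK ?num_real// levy_kernel_im_le.
  - exact: is_derive_levy_kernel_im.
  - by move=> v x; rewrite expr1 levy_kernel1_im_le.
move=> ?; rewrite /levy_im; apply: is_derive_eq.
by rewrite /GRing.scale /= /levy1_im; ring.
Qed.

Lemma is_derive_levy1_re (u : R) : is_derive u 1 levy1_re (levy2_re u).
Proof.
apply: (@is_derive_finite_Rintegral levy_kernel1_re (fun v x => - cos (v * x)) _ 1).
- exact: measurable_levy_kernel1_re.
- by move=> v x; rewrite expr1 levy_kernel1_re_le.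
- exact: is_derive_levy_kernel1_re.
- by move=> v x; rewrite normrN cos_max.
Qed.

Lemma is_derive_levy1_im (u : R) : is_derive u 1 levy1_im (levy2_im u).
Proof.
have : is_derive u 1 (fun v : R => \int[nu]_x levy_kernel1_im v x : R)
    (\int[nu]_x - sin (u * x)).
  apply: (@is_derive_finite_Rintegral levy_kernel1_im (fun v x => - sin (v * x)) _ 1).
  - exact: measurable_levy_kernel1_im.
  - by move=> v x; rewrite expr1 levy_kernel1_im_le.
  - exact: is_derive_levy_kernel1_im.
  - by move=> v x; rewrite normrN sin_max.
move=> ?; rewrite /levy1_im; apply: is_derive_eq.
by rewrite add0r mul1r.
Qed.

(** The first two derivatives of the Levy exponent, hence the logarithmic derivatives
of the characteristic function. *)
Definition psi1 u : R[i] := levy1_re u +i* levy1_im u.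
Definition psi2 u : R[i] := levy2_re u +i* levy2_im u.

Let levy_cfE' : levy_cf b nu = fun u => cexp (levy_re u +i* levy_im u).
Proof. by apply/funext => u; rewrite /levy_cf levy_exponentE. Qed.

Lemma cderive1_levy_cf (u : R) :
  cderive 1 (levy_cf b nu) u = psi1 u * levy_cf b nu u.
Proof.
rewrite levy_cfE'; apply: cderive1_cexp;
  [exact: is_derive_levy_re|exact: is_derive_levy_im].
Qed.

Lemma cderive2_levy_cf (u : R) :
  cderive 2 (levy_cf b nu) u = (psi2 u + psi1 u ^+ 2) * levy_cf b nu u.
Proof.
rewrite levy_cfE'.
exact: (@cderive2_cexp _ _ _ _ _ _ _ is_derive_levy_re is_derive_levy_im
  is_derive_levy1_re is_derive_levy1_im).
Qed.

End exponent_derivatives.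

Section complex_modulus.
Context {R : realType}.
Implicit Types z t : R[i].

Lemma normc_ge0 z : 0 <= normc z.
Proof. by case: z => a b; exact: sqrtr_ge0. Qed.

Lemma normcE z : `|z| = (normc z)%:C.
Proof. by case: z. Qed.

Lemma ler_normcD z t : normc (z + t) <= normc z + normc t.
Proof. by rewrite -lecR rmorphD/= -!normcE ler_normD. Qed.

Lemma normc_opp z : normc (- z) = normc z.
Proof. by case: z => a b /=; rewrite !sqrrN. Qed.

Lemma ler_normcB z t : normc (z - t) <= normc z + normc t.
Proof. by rewrite (le_trans (ler_normcD _ _))// normc_opp. Qed.

Lemma normcX z n : normc (z ^+ n) = normc z ^+ n.
Proof. by elim: n => [|n IH]; rewrite ?expr0 ?normc1// !exprS normcM IH. Qed.

Lemma normc_real (x : R) : normc x%:C = `|x|.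
Proof. by rewrite /= expr0n/= addr0 sqrtr_sqr. Qed.

Lemma normc_le (x y : R) : normc (x +i* y) <= `|x| + `|y|.
Proof.
rewrite (_ : x +i* y = x%:C + y%:C * 'i); last by simpc.
rewrite (le_trans (ler_normcD _ _))// normcM !normc_real lerD2l.
by rewrite [normc 'i]/= expr0n/= add0r expr1n sqrtr1 mulr1.
Qed.

Lemma Re_le_normc z : `|complex.Re z| <= normc z.
Proof.
by case: z => a b /=; rewrite -sqrtr_sqr ler_wsqrtr// lerDl sqr_ge0.
Qed.

Lemma Im_le_normc z : `|complex.Im z| <= normc z.
Proof.
by case: z => a b /=; rewrite -sqrtr_sqr ler_wsqrtr// lerDr sqr_ge0.
Qed.

Lemma normc_cexp z : normc (cexp z) = expR (complex.Re z).
Proof.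
rewrite /cexp normcM normc_real ger0_norm ?expR_ge0//.
by rewrite /cis /= cos2Dsin2 sqrtr1 mulr1.
Qed.

End complex_modulus.

Section exponent_bounds.
Context {R : realType} (b : R) (nu : finite_borel_measure R).

Let m := fine (nu setT).

(** The identity which determines [nu] from the characteristic function. *)
Lemma psi2E (u : R) :
  psi2 nu u = - (\int[nu]_x cos (u * x)) +i* - (\int[nu]_x sin (u * x)).
Proof.
have H (c : R -> R) : continuous c -> (forall y, `|c y| <= 1) ->
    \int[nu]_x (- c (u * x)) = - \int[nu]_x c (u * x).
  move=> cc c1; have ic := @integrable_trig_scale _ nu _ cc c1 u.
  rewrite -mulN1r -(RintegralZl _ measurableT ic).
  by apply: eq_Rintegral => x _; rewrite mulN1r.
by rewrite /psi2 /levy2_re /levy2_im !H//; [exact: continuous_sin|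
  exact: sin_max|exact: continuous_cos|exact: cos_max].
Qed.

Lemma psi2_at0 : psi2 nu 0 = (- m)%:C.
Proof.
rewrite psi2E; congr (_ +i* _).
  congr (- _); under eq_Rintegral do rewrite mul0r cos0.
  by rewrite Rintegral_cst// mul1r.
under eq_Rintegral do rewrite mul0r sin0.
by rewrite Rintegral_cst// mul0r oppr0.
Qed.

Lemma psi1_at0 : psi1 nu b 0 = 0 +i* b.
Proof.
rewrite /psi1 /levy1_re /levy1_im; congr (_ +i* _).
  under eq_Rintegral => x _.
    rewrite /levy_kernel1_re mul0r sin0 oppr0 mul0r if_same.
    over.
  by rewrite Rintegral_cst// mul0r.
under eq_Rintegral => x _.
  rewrite /levy_kernel1_im mul0r cos0 subrr mul0r if_same.
  over.
by rewrite Rintegral_cst// mul0r addr0.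
Qed.

Lemma levy_re0 : levy_re nu 0 = 0.
Proof.
rewrite /levy_re; under eq_Rintegral => x _.
  rewrite /levy_kernel_re mul0r cos0 subrr mul0r expr0n/= mul0r oppr0 if_same.
  over.
by rewrite Rintegral_cst// mul0r.
Qed.

Lemma levy_im0 : levy_im nu b 0 = 0.
Proof.
rewrite /levy_im mul0r add0r; under eq_Rintegral => x _.
  rewrite /levy_kernel_im mul0r sin0 subrr mul0r if_same.
  over.
by rewrite Rintegral_cst// mul0r.
Qed.

Lemma levy_cf0 : levy_cf b nu 0 = 1.
Proof.
rewrite /levy_cf levy_exponentE levy_re0 levy_im0 /cexp /cis /=.
by rewrite expR0 cos0 sin0 mul1r.
Qed.

Lemma normc_psi1_le u : normc (psi1 nu b u) <= `|b| + 2 * m * `|u|.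
Proof.
apply: (le_trans (normc_le _ _)).
have Hr : `|levy1_re nu u| <= `|u| * m.
  apply: norm_Rintegral_bound; first exact: measurable_levy_kernel1_re.
  by move=> x; exact: levy_kernel1_re_le.
have Hi : `|\int[nu]_x levy_kernel1_im u x| <= `|u| * m.
  apply: norm_Rintegral_bound; first exact: measurable_levy_kernel1_im.
  by move=> x; exact: levy_kernel1_im_le.
have := ler_normD b (\int[nu]_x levy_kernel1_im u x).
rewrite -/(levy1_im nu b u) => H.
by rewrite (le_trans (lerD Hr (le_trans H (lerD (lexx _) Hi))))//; lra.
Qed.

Lemma normc_psi2_le u : normc (psi2 nu u) <= 2 * m.
Proof.
rewrite psi2E (le_trans (normc_le _ _))// !normrN mulr_natl mulr2n lerD//.
  rewrite -[leRHS]mul1r; apply: norm_Rintegral_bound => [|x]; last exact: cos_max.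
  by apply: measurable_trig_scale; exact: continuous_cos.
rewrite -[leRHS]mul1r; apply: norm_Rintegral_bound => [|x]; last exact: sin_max.
by apply: measurable_trig_scale; exact: continuous_sin.
Qed.

Lemma normc_levy_cf u : normc (levy_cf b nu u) = expR (levy_re nu u).
Proof. by rewrite /levy_cf normc_cexp levy_exponentE. Qed.

Lemma levy_re_ge u : - (m * u ^+ 2) <= levy_re nu u.
Proof.
rewrite lerNl; apply: (le_trans (ler_norm _)); rewrite normrN mulrC.
apply: norm_Rintegral_bound; first exact: measurable_levy_kernel_re.
by move=> x; exact: levy_kernel_re_le.
Qed.

Lemma levy_re_le0 u : levy_re nu u <= 0.
Proof.
rewrite -oppr_ge0 /levy_re -mulN1r -RintegralZl//; last first.
  apply: (@bounded_integrable _ _ _ nu _ (u ^+ 2)).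
    exact: measurable_levy_kernel_re.
  exact: levy_kernel_re_le.
apply: Rintegral_ge0 => x _; rewrite mulN1r oppr_ge0.
exact: levy_kernel_re_le0.
Qed.

Lemma levy_cf_gt0 u : 0 < normc (levy_cf b nu u).
Proof. by rewrite normc_levy_cf expR_gt0. Qed.

Lemma levy_cf_le1 u : normc (levy_cf b nu u) <= 1.
Proof. by rewrite normc_levy_cf -expR0 ler_expR levy_re_le0. Qed.

Lemma levy_cf_ge u : expR (- (m * u ^+ 2)) <= normc (levy_cf b nu u).
Proof. by rewrite normc_levy_cf ler_expR levy_re_ge. Qed.

Lemma continuous_normc_levy_cf : continuous (fun u : R => normc (levy_cf b nu u) : R).
Proof.
rewrite (_ : (fun _ => _) = (fun u => expR (levy_re nu u))).
  apply: continuous_comp_fun; last exact: continuous_expR.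
  by apply: is_derive_continuous => x; exact: is_derive_levy_re.
by apply/funext => u; rewrite normc_levy_cf.
Qed.

End exponent_bounds.

(** * Deviation of the empirical characteristic function *)

Section trig_moment_derivatives.
Context {R : realType} (c c' : R -> R).
Hypothesis dc : forall y : R, is_derive y 1 c (c' y).

Lemma is_derive_trig_moment k (u : R) x :
  is_derive u 1 (trig_moment c k ^~ x) (trig_moment c' k.+1 u x).
Proof.
have d : is_derive u 1 (fun v : R => v * x) x.
  by apply: is_derive_eq; rewrite /GRing.scale /=; ring.
have H := @is_derive1_comp _ c (fun v : R => v * x) u _ _ (dc _) d.
rewrite /trig_moment exprSr -mulrA [x * _]mulrC; exact: is_deriveZ.
Qed.

Lemma is_derive_mean_trig_moment n (z : 'I_n -> R) k (u : R) :
  is_derive u 1 (fun v : R => n%:R^-1 * \sum_i trig_moment c k v (z i) : R)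
    (n%:R^-1 * \sum_i trig_moment c' k.+1 u (z i)).
Proof.
apply: is_deriveZ.
rewrite (_ : (fun _ => _) = \sum_i (trig_moment c k ^~ (z i))); last first.
  by apply/funext => v; rewrite fct_sumE.
by apply: is_derive_sum => i; exact: is_derive_trig_moment.
Qed.

Context d (Omega : measurableType d) (P : probability Omega R) (X : Omega -> R).
Variable gamma : R.
Hypothesis mX : measurable_fun setT X.
Hypothesis gamma0 : 0 < gamma.
Hypothesis moment : P.-integrable setT (EFin \o (fun w => `|X w| `^ (4 + gamma))).
Hypothesis c_le1 : forall y, `|c y| <= 1.
Hypothesis c'_le1 : forall y, `|c' y| <= 1.

Lemma is_derive_Rintegral_trig_moment k (u : R) : (k < 2)%N ->
  is_derive u 1 (fun v : R => \int[P]_o trig_moment c k v (X o) : R)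
    (\int[P]_o trig_moment c' k.+1 u (X o)).
Proof.
move=> k2.
apply: (@is_derive_Rintegral _ _ _ P (fun v o => trig_moment c k v (X o))
  (fun v o => trig_moment c' k.+1 v (X o)) (fun o => envelope gamma (X o))).
- move=> v.
  apply: (@integrable_trig_moment _ _ _ P X mX c gamma k) => //.
  + exact: is_derive_continuous dc.
  + exact: (ltnW k2).
- by move=> v o; exact: is_derive_trig_moment.
- exact: integrable_envelope.
- by move=> v o _; exact: trig_moment_le.
Qed.

End trig_moment_derivatives.

Lemma cderiveE {R : realType} (f : R -> R[i]) (F G : nat -> R -> R) (u : R) k :
  (forall v, f v = F 0%N v +i* G 0%N v) ->
  (forall j (v : R), (j < 2)%N -> is_derive v 1 (F j) (F j.+1 v)) ->
  (forall j (v : R), (j < 2)%N -> is_derive v 1 (G j) (G j.+1 v)) ->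
  (k < 3)%N -> cderive k f u = F k u +i* G k u.
Proof.
move=> fE dF dG.
have ref : (fun v => complex.Re (f v)) = F 0%N by apply/funext => v; rewrite fE.
have imf : (fun v => complex.Im (f v)) = G 0%N by apply/funext => v; rewrite fE.
case: k => [|[|[|//]]] _; first by rewrite cderiveE0.
- by apply: cderiveE1 => v; rewrite ?ref ?imf; [exact: dF|exact: dG].
- apply: (cderiveE2 (f1 := F 1%N) (g1 := G 1%N)) => v; rewrite ?ref ?imf;
    solve [exact: dF|exact: dG].
Qed.

Section trigonometric_jets.
Context {R : realType}.

(** The derivatives of the cosine and of the sine, so that [trig_moment (cos_jet k) k] is
the derivative of order [k] in [u] of [cos (u * x)]. *)
Definition cos_jet (k : nat) (y : R) : R :=
  match k with 0%N => cos y | 1%N => - sin y | 2%N => - cos y | _ => sin y end.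
Definition sin_jet (k : nat) (y : R) : R :=
  match k with 0%N => sin y | 1%N => cos y | 2%N => - sin y | _ => - cos y end.

Lemma is_derive_cos_jet k (y : R) : (k < 3)%N ->
  is_derive y 1 (cos_jet k) (cos_jet k.+1 y).
Proof.
case: k => [|[|[|//]]] _; rewrite /cos_jet; apply: is_derive_eq.
all: by rewrite ?mulN1r ?opprK.
Qed.

Lemma is_derive_sin_jet k (y : R) : (k < 3)%N ->
  is_derive y 1 (sin_jet k) (sin_jet k.+1 y).
Proof.
case: k => [|[|[|//]]] _; rewrite /sin_jet; apply: is_derive_eq.
all: by rewrite ?mulN1r ?opprK.
Qed.

Lemma cos_jet_le1 k y : `|cos_jet k y| <= 1.
Proof. by case: k => [|[|[|k]]]/=; rewrite ?normrN ?cos_max ?sin_max. Qed.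

Lemma sin_jet_le1 k y : `|sin_jet k y| <= 1.
Proof. by case: k => [|[|[|k]]]/=; rewrite ?normrN ?cos_max ?sin_max. Qed.

Lemma cos_jet_lipschitz k y z : `|cos_jet k y - cos_jet k z| <= `|y - z|.
Proof.
by case: k => [|[|[|k]]]/=; rewrite -?opprD ?normrN ?cos_lipschitz ?sin_lipschitz.
Qed.

Lemma sin_jet_lipschitz k y z : `|sin_jet k y - sin_jet k z| <= `|y - z|.
Proof.
by case: k => [|[|[|k]]]/=; rewrite -?opprD ?normrN ?cos_lipschitz ?sin_lipschitz.
Qed.

Lemma cos_jet_parity k :
  exists e : R, `|e| = 1 /\ forall y, cos_jet k (- y) = e * cos_jet k y.
Proof.
by case: k => [|[|[|k]]]; [exists 1|exists (- 1)|exists 1|exists (- 1)];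
  split=> [|y]; rewrite ?normrN ?normr1//= ?cosN ?sinN ?mul1r ?mulN1r.
Qed.

Lemma sin_jet_parity k :
  exists e : R, `|e| = 1 /\ forall y, sin_jet k (- y) = e * sin_jet k y.
Proof.
by case: k => [|[|[|k]]]; [exists (- 1)|exists 1|exists (- 1)|exists 1];
  split=> [|y]; rewrite ?normrN ?normr1//= ?cosN ?sinN ?mul1r ?mulN1r.
Qed.

End trigonometric_jets.

Section characteristic_function_deviation.
Context {R : realType} d (Omega : measurableType d) (P : probability Omega R).
Variables (n : nat) (Z : 'I_n -> Omega -> R) (X : Omega -> R).
Hypothesis n0 : (0 < n)%N.
Hypothesis mX : measurable_fun setT X.
Hypothesis mZ : forall i, measurable_fun setT (Z i).
Hypothesis indepZ : forall B : 'I_n -> set R, (forall i, measurable (B i)) ->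
  P [set w | forall i, B i (Z i w)] = (\prod_i P (Z i @^-1` B i))%E.
Hypothesis lawZ : forall i B, measurable B -> P (Z i @^-1` B) = P (X @^-1` B).
Variables gamma delta : R.
Hypotheses (gamma0 : 0 < gamma) (delta0 : 0 < delta).
Hypothesis moment : P.-integrable setT (EFin \o (fun w => `|X w| `^ (4 + gamma))).
Variables (phi : R -> R[i]) (emp : Omega -> R -> R[i]).
Hypothesis phiE : forall u,
  phi u = (\int[P]_o cos (u * X o)) +i* (\int[P]_o sin (u * X o)).
Hypothesis empE : forall o u,
  emp o u = (n%:R^-1)%:C * \sum_i cis (u * Z i o).

Local Notation w := (log_weight delta).
Let M := \int[P]_o (`|X o| `^ (4 + gamma)).

Lemma cderive_cf k u : (k < 3)%N -> cderive k phi u =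
  (\int[P]_o trig_moment (cos_jet k) k u (X o)) +i*
  (\int[P]_o trig_moment (sin_jet k) k u (X o)).
Proof.
move=> k3.
apply: (@cderiveE _ _ (fun k v => \int[P]_o trig_moment (cos_jet k) k v (X o))
  (fun k v => \int[P]_o trig_moment (sin_jet k) k v (X o)) u k _ _ _ k3).
- move=> v; rewrite phiE; congr (_ +i* _); apply: eq_Rintegral => o _;
    by rewrite /trig_moment expr0 mul1r.
- move=> j v j2; apply: (is_derive_Rintegral_trig_moment _ mX gamma0 moment) => //.
  + by move=> y; apply: is_derive_cos_jet; exact: ltnW.
  + exact: cos_jet_le1.
  + exact: cos_jet_le1.
- move=> j v j2; apply: (is_derive_Rintegral_trig_moment _ mX gamma0 moment) => //.
  + by move=> y; apply: is_derive_sin_jet; exact: ltnW.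
  + exact: sin_jet_le1.
  + exact: sin_jet_le1.
Qed.

Lemma cderive_empirical_cf o k u : (k < 3)%N -> cderive k (emp o) u =
  (n%:R^-1 * \sum_i trig_moment (cos_jet k) k u (Z i o)) +i*
  (n%:R^-1 * \sum_i trig_moment (sin_jet k) k u (Z i o)).
Proof.
move=> k3.
apply: (@cderiveE _ _ (fun k v => n%:R^-1 * \sum_i trig_moment (cos_jet k) k v (Z i o))
  (fun k v => n%:R^-1 * \sum_i trig_moment (sin_jet k) k v (Z i o)) u k _ _ _ k3).
- move=> v; rewrite empE.
  have -> : \sum_i cis (v * Z i o) =
      (\sum_i cos (v * Z i o)) +i* (\sum_i sin (v * Z i o)) :> R[i].
    elim/big_rec3: _ => [//|i x y z _ ->]; rewrite /cis; simpc.
    by [].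
  simpc; congr (_ * _ +i* (_ * _)); apply: eq_bigr => i _;
    by rewrite /trig_moment expr0 mul1r.
- move=> j v j2; apply: is_derive_mean_trig_moment => y.
  by apply: is_derive_cos_jet; exact: ltnW.
- move=> j v j2; apply: is_derive_mean_trig_moment => y.
  by apply: is_derive_sin_jet; exact: ltnW.
Qed.

Let one_deviation c k : (forall y, `|c y| <= 1) ->
    (forall y z, `|c y - c z| <= `|y - z|) -> continuous c ->
    (exists e : R, `|e| = 1 /\ forall y, c (- y) = e * c y) -> (k < 3)%N ->
  exists Y : Omega -> \bar R,
  [/\ measurable_fun setT Y, forall o, (0 <= Y o)%E,
    (\int[P]_o Y o <= (chaining_constant gamma delta * (9 + 8 * M) *
      root_rate n)%:E)%E &
    forall u o, ((w u * `|\int[P]_o trig_moment c k u (X o) -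
       n%:R^-1 * \sum_i trig_moment c k u (Z i o)|)%:E <= Y o)%E].
Proof.
move=> c1 cl cc [e ce] k3.
have [Y [mY Y0 iY YP]] := empirical_process_sup n0 mX mZ indepZ lawZ c1 cl cc ce
  gamma0 delta0 (k3 : (k <= 2)%N) moment.
have nR : 0 < n%:R :> R by rewrite ltr0n.
exists (fun o => (n%:R^-1)%:E * Y o)%E; split.
- exact: measurable_funeM.
- by move=> o; rewrite mule_ge0// lee_fin invr_ge0 ler0n.
- rewrite ge0_integralZl//.
  apply: (le_trans (lee_wpmul2l _ iY)); first by rewrite lee_fin invr_ge0 ler0n.
  rewrite lee_fin -/M /root_rate.
  have q0 : 0 < Num.sqrt n%:R :> R by rewrite sqrtr_gt0.
  rewrite -{1}[n%:R]sqr_sqrtr ?ler0n// le_eqVlt; apply/orP; left; apply/eqP.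
  by field; rewrite gt_eqF.
- move=> u o; apply: le_trans (lee_wpmul2l _ (YP u o)); last first.
    by rewrite lee_fin invr_ge0 ler0n.
  rewrite lee_fin mulrCA ler_wpM2l ?(ltW (log_weight_gt0 _ _))//.
  rewrite sumrB sumr_const card_ord distrC.
  have n1 : 0 <= n%:R^-1 :> R by rewrite invr_ge0 ler0n.
  rewrite -[X in _ <= X * _](ger0_norm n1) -normrM mulrBr mulrnAr -mulrnAl.
  by rewrite -[n%:R^-1 *+ n]mulr_natl mulfV ?gt_eqF// mul1r.
Qed.

(** The real and imaginary parts of the derivatives of order at most two are six
empirical processes of trigonometric moments. *)
Lemma cf_deviation : exists Y : Omega -> \bar R,
  [/\ measurable_fun setT Y, forall o, (0 <= Y o)%E,
    (\int[P]_o Y o <= (6 * (chaining_constant gamma delta * (9 + 8 * M)) *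
      root_rate n)%:E)%E &
    forall u o k, (k < 3)%N ->
      ((w u * normc (cderive k phi u - cderive k (emp o) u))%:E <= Y o)%E].
Proof.
have ck k : (k < 3)%N -> continuous (cos_jet k : R -> R).
  by move=> k3; apply: is_derive_continuous => y; exact: is_derive_cos_jet.
have sk k : (k < 3)%N -> continuous (sin_jet k : R -> R).
  by move=> k3; apply: is_derive_continuous => y; exact: is_derive_sin_jet.
have dev k (k3 : (k < 3)%N) : exists Y : Omega -> \bar R,
  [/\ measurable_fun setT Y, forall o, (0 <= Y o)%E,
    (\int[P]_o Y o <= (2 * (chaining_constant gamma delta * (9 + 8 * M)) *
      root_rate n)%:E)%E &
    forall u o,
      ((w u * normc (cderive k phi u - cderive k (emp o) u))%:E <= Y o)%E].
  have [Y [mY Y0 iY YP]] := one_deviation (@cos_jet_le1 _ k) (@cos_jet_lipschitz _ k)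
    (ck _ k3) (cos_jet_parity k) k3.
  have [S [mS S0 iS SP]] := one_deviation (@sin_jet_le1 _ k) (@sin_jet_lipschitz _ k)
    (sk _ k3) (sin_jet_parity k) k3.
  exists (fun o => Y o + S o)%E; split.
  - exact: emeasurable_funD.
  - by move=> o; rewrite adde_ge0.
  - rewrite ge0_integralD// (le_trans (leeD iY iS))// -EFinD lee_fin.
    by rewrite le_eqVlt; apply/orP; left; apply/eqP; ring.
  - move=> u o; apply: le_trans (leeD (YP u o) (SP u o)).
    rewrite -EFinD lee_fin -mulrDr ler_wpM2l ?(ltW (log_weight_gt0 _ _))//.
    by rewrite cderive_cf// cderive_empirical_cf//; exact: normc_le.
have [Y0 [mY0 Y00 iY0 Y0P]] := dev 0%N isT.
have [Y1 [mY1 Y10 iY1 Y1P]] := dev 1%N isT.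
have [Y2 [mY2 Y20 iY2 Y2P]] := dev 2%N isT.
exists (fun o => Y0 o + Y1 o + Y2 o)%E; split.
- by apply: emeasurable_funD => //; exact: emeasurable_funD.
- by move=> o; rewrite !adde_ge0.
- rewrite ge0_integralD//; last 2 first.
  + by move=> o _; rewrite adde_ge0.
  + exact: emeasurable_funD.
  rewrite ge0_integralD// (le_trans (leeD (leeD iY0 iY1) iY2))// -!EFinD lee_fin.
  by rewrite le_eqVlt; apply/orP; left; apply/eqP; ring.
- move=> u o [|[|[|k]]] k3; last discriminate k3.
  + by rewrite -addeA (le_trans (Y0P u o))// leeDl// adde_ge0.
  + by rewrite [(Y0 o + _)%E]addeC -addeA (le_trans (Y1P u o))// leeDl// adde_ge0.
  + by rewrite (le_trans (Y2P u o))// leeDr// adde_ge0.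
Qed.

End characteristic_function_deviation.

(** * From the characteristic function to the Levy measure *)

Section logarithmic_derivatives.
Context {R : realType}.

(** If [phi' = p1 phi] and [phi'' = (p2 + p1 ^ 2) phi], the errors on [p1] and on
[p2 + p1 ^ 2] are obtained by dividing by the perturbed [phi], which is at least half
of [phi]. They are [4 L e / |phi|] and [6 L ^ 2 e / |phi|]; the error on [p1 ^ 2] adds
[16 L ^ 2 e / |phi|]. *)
Lemma second_log_derivative_stable (z t p1 p2 q1 q2 : R[i]) (e L : R) :
  1 <= L -> 0 < normc z -> 2 * e <= normc z ->
  normc p1 <= L -> normc p2 <= L ^+ 2 ->
  normc (t - z) <= e -> normc (q1 * t - p1 * z) <= e ->
  normc ((q2 + q1 ^+ 2) * t - (p2 + p1 ^+ 2) * z) <= e ->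
  normc (q2 - p2) * normc z <= 22 * L ^+ 2 * e.
Proof.
move=> L1 z0 ez p1L p2L tz q1p1 q2p2.
have e0 : 0 <= e := le_trans (normc_ge0 _) tz.
have L0 : 0 <= L by apply: le_trans L1.
have tz2 : normc z <= 2 * normc t.
  have : normc z <= normc t + e.
    rewrite -[z](subKr t) (le_trans (ler_normcB _ _))// lerD2l.
    exact: tz.
  by move: ez; lra.
have d1 : normc (q1 - p1) * normc t <= 2 * L * e.
  rewrite -normcM (_ : _ * t = (q1 * t - p1 * z) - p1 * (t - z)); last by ring.
  rewrite (le_trans (ler_normcB _ _))// normcM.
  have := ler_pM (normc_ge0 p1) (normc_ge0 (t - z)) p1L tz.
  by have : e <= L * e; [by rewrite ler_peMl|move: q1p1; lra].
have d2 : normc ((q2 + q1 ^+ 2) - (p2 + p1 ^+ 2)) * normc t <= 3 * L ^+ 2 * e.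
  rewrite -normcM (_ : _ * t = ((q2 + q1 ^+ 2) * t - (p2 + p1 ^+ 2) * z) -
    (p2 + p1 ^+ 2) * (t - z)); last by ring.
  rewrite (le_trans (ler_normcB _ _))// normcM.
  have H : normc (p2 + p1 ^+ 2) <= 2 * L ^+ 2.
    rewrite (le_trans (ler_normcD _ _))// normcX mulr_natl mulr2n lerD//.
    by rewrite lerXn2r ?nnegrE ?normc_ge0.
  have := ler_pM (normc_ge0 _) (normc_ge0 _) H tz.
  have : e <= L ^+ 2 * e by rewrite ler_peMl// exprn_ege1.
  by move: q2p2; lra.
have x1 : normc (q1 - p1) * normc z <= 4 * L * e.
  by have := ler_wpM2l (normc_ge0 (q1 - p1)) tz2; move: d1; lra.
have x2 : normc (q1 - p1) <= 2 * L.
  rewrite -(ler_pM2r z0) (le_trans x1)//.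
  by have := ler_wpM2l L0 ez; lra.
have y1 : normc ((q2 + q1 ^+ 2) - (p2 + p1 ^+ 2)) * normc z <= 6 * L ^+ 2 * e.
  have := ler_wpM2l (normc_ge0 ((q2 + q1 ^+ 2) - (p2 + p1 ^+ 2))) tz2.
  by move: d2; lra.
have s1 : normc (q1 - p1 + 2 * p1) <= 4 * L.
  rewrite mulr_natl mulr2n; have := ler_normcD (q1 - p1) (p1 + p1).
  by have := ler_normcD p1 p1; move: x2 p1L; lra.
have sq : normc ((q1 - p1) * (q1 - p1 + 2 * p1)) * normc z <= 16 * L ^+ 2 * e.
  rewrite normcM mulrAC (_ : 16 * _ * _ = 4 * L * e * (4 * L)); last by ring.
  by rewrite ler_pM ?normc_ge0// mulr_ge0// normc_ge0.
rewrite (_ : q2 - p2 = ((q2 + q1 ^+ 2) - (p2 + p1 ^+ 2)) -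
  (q1 - p1) * (q1 - p1 + 2 * p1)); last by ring.
have := ler_wpM2r (ltW z0) (ler_normcB ((q2 + q1 ^+ 2) - (p2 + p1 ^+ 2))
  ((q1 - p1) * (q1 - p1 + 2 * p1))).
by move: y1 sq; lra.
Qed.

End logarithmic_derivatives.

Section minimum_distance_jets.
Context {R : realType} (w : R -> R).
Hypothesis w0 : forall u, 0 < w u.

Lemma dist2_le (f g : R -> R[i]) (y : R) :
  (forall u k, (k < 3)%N ->
     normc (cderive k f u - cderive k g u) * w u <= y) ->
  (dist2 w f g <= (3 * y)%:E)%E.
Proof.
move=> H; rewrite /dist2 (_ : 3 * y = \sum_(k < 3) y); last first.
  by rewrite sumr_const card_ord mulr_natl.
rewrite -sumEFin; apply: lee_sum => k _.
by apply: ub_ereal_sup => _ [u _ <-]; rewrite lee_fin; exact: H.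
Qed.

Lemma le_dist2 (f g : R -> R[i]) (u : R) k : (k < 3)%N ->
  ((normc (cderive k f u - cderive k g u) * w u)%:E <= dist2 w f g)%E.
Proof.
move=> k3.
have H j : (0 <= weighted_sup_norm w (fun u : R => cderive j f u - cderive j g u)%R)%E.
  apply: (@le_trans _ _ (normc (cderive j f 0 - cderive j g 0) * w 0)%:E).
    by rewrite lee_fin mulr_ge0 ?normc_ge0// ltW.
  by apply: ereal_sup_ubound; exists 0.
rewrite /dist2 (bigD1 (Ordinal k3))//=; apply: lee_paddr.
  by apply: sume_ge0 => j _; exact: H.
by apply: ereal_sup_ubound; exists u.
Qed.

(** The true parameters are a competitor whose distance to [g] is at most [3 y], and the
triangle inequality through [g] adds [y]. *)
Lemma near_minimizer_jets (g : R -> R[i]) (eps b bh : R)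
    (nu nuh : finite_borel_measure R) (y : R) :
  near_minimizer w g eps bh nuh ->
  (forall u k, (k < 3)%N ->
     normc (cderive k (levy_cf b nu) u - cderive k g u) * w u <= y) ->
  forall u k, (k < 3)%N ->
    normc (cderive k (levy_cf bh nuh) u - cderive k (levy_cf b nu) u) * w u
      <= 4 * y + eps.
Proof.
move=> nm H u k k3.
have : ((normc (cderive k (levy_cf bh nuh) u - cderive k g u) * w u)%:E <=
    (3 * y + eps)%:E)%E.
  apply: (le_trans (le_dist2 _ _ _ k3)); apply: (le_trans nm).
  rewrite EFinD leeD2r//; apply: le_trans (dist2_le H).
  by apply: ereal_inf_lbound; exists (b, nu).
rewrite lee_fin => G.
have := ler_normcB (cderive k (levy_cf bh nuh) u - cderive k g u)
  (cderive k (levy_cf b nu) u - cderive k g u).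
rewrite opprB addrA subrK => T.
have := ler_wpM2r (ltW (w0 u)) T.
by rewrite mulrDl; have := H u k k3; move: G; lra.
Qed.

End minimum_distance_jets.

Section fourier_transform_bound.
Context {R : realType} (w : R -> R) (b bh : R) (nu nuh : finite_borel_measure R).
Variable D : R.
Hypothesis w0 : forall u, 0 < w u.
Hypothesis w_at0 : w 0 = 1.
Hypothesis jets : forall u k, (k < 3)%N ->
  normc (cderive k (levy_cf bh nuh) u - cderive k (levy_cf b nu) u) * w u <= D.

Local Notation m := (fine (nu setT)).
Local Notation mh := (fine (nuh setT)).

Let D0 : 0 <= D.
Proof.
apply: le_trans (@jets 0 0%N isT).
by rewrite mulr_ge0// ?normc_ge0// ltW.
Qed.

Lemma drift_error : `|bh - b| <= D.
Proof.
have := @jets 0 1%N isT; rewrite w_at0 mulr1 !cderive1_levy_cf !levy_cf0 !psi1_at0.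
rewrite !mulr1; apply: le_trans.
by rewrite [leRHS]/= subrr expr0n/= add0r sqrtr_sqr.
Qed.

(** The second derivative of [phi] at [0] is [- (nu(R) + b ^ 2)]. *)
Lemma total_mass_le : mh <= m + b ^+ 2 + D.
Proof.
have := @jets 0 2%N isT; rewrite w_at0 mulr1 !cderive2_levy_cf !levy_cf0 !psi1_at0.
rewrite !psi2_at0 !mulr1 => /(le_trans (Re_le_normc _)).
rewrite !expr2 /= ler_norml => /andP[+ _].
have := sqr_ge0 bh; rewrite -[fine (nuh setT)]/mh -[fine (nu setT)]/m.
rewrite !expr2; lra.
Qed.

Lemma psi2_diff_le u : normc (psi2 nuh u - psi2 nu u) <= 4 * m + 2 * b ^+ 2 + 2 * D.
Proof.
rewrite (le_trans (ler_normcB _ _))//.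
by have := normc_psi2_le nuh u; have := normc_psi2_le nu u; have := total_mass_le; lra.
Qed.

(** Where [w |phi|] is less than [2 D], division by [phi] is impossible, but there the
bound by the total masses is stronger than the claim. *)
Lemma psi2_diff_weighted (u L : R) :
  1 <= L -> normc (psi1 nu b u) <= L -> 2 * m <= L ^+ 2 ->
  normc (psi2 nuh u - psi2 nu u) * (w u * normc (levy_cf b nu u)) <=
  (22 * L ^+ 2 + 8 * m + 4 * b ^+ 2 + 4 * D) * D.
Proof.
move=> L1 p1L mL.
have g0 := levy_cf_gt0 b nu u; set g := normc (levy_cf b nu u) in g0 *.
have m0 : 0 <= m by exact: fine_ge0.
have H0 := normc_ge0 (psi2 nuh u - psi2 nu u).
have Hm := psi2_diff_le u.
set H := normc _ in H0 Hm *.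
have e0 : 0 <= D / w u by rewrite divr_ge0// ltW.
have Dw : w u * (D / w u) = D by rewrite mulrC divfK// gt_eqF.
have jet k : (k < 3)%N ->
    normc (cderive k (levy_cf bh nuh) u - cderive k (levy_cf b nu) u) <= D / w u.
  by move=> k3; rewrite ler_pdivlMr//; exact: jets.
have [ge|ge] := leP (2 * (D / w u)) g.
- have := jet 0%N isT; have := jet 1%N isT; have := jet 2%N isT.
  rewrite !cderiveE0 !cderive1_levy_cf !cderive2_levy_cf => j2 j1 j0.
  have p2L := le_trans (normc_psi2_le nu u) mL.
  have := second_log_derivative_stable L1 g0 ge p1L p2L j0 j1 j2.
  rewrite -/H -/g => /(ler_wpM2l (ltW (w0 u))).
  rewrite (mulrCA (w u) H) (mulrCA (w u) (22 * _)) Dw => /le_trans; apply.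
  rewrite ler_wpM2r//; have := sqr_ge0 b; move: m0 D0; lra.
- have Hwg : H * (w u * g) <= (4 * m + 2 * b ^+ 2 + 2 * D) * (2 * D).
    apply: ler_pM => //; first by rewrite mulr_ge0// ltW.
    by rewrite -Dw mulrCA ler_wpM2l ?(ltW (w0 u))// ltW.
  apply: (le_trans Hwg); rewrite [X in X <= _](_ : _ =
    (8 * m + 4 * b ^+ 2 + 4 * D) * D); last by ring.
  by rewrite ler_wpM2r//; have := sqr_ge0 L; lra.
Qed.

(** The loss only sees the Fourier transform of the difference, which is the
difference of the second logarithmic derivatives. *)
Lemma loss_le_psi2 (s B : R) : 0 <= s ->
  (forall u, normc (psi2 nuh u - psi2 nu u) <= B * (1 + `|u|) `^ s) ->
  (loss s nuh nu <= B%:E)%E.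
Proof.
move=> s0 HB; apply: loss_le => // u; apply: le_trans (HB u).
  apply: le_trans (Re_le_normc _).
  by rewrite !psi2E/= -normrN opprB opprK addrC.
apply: le_trans (Im_le_normc _).
by rewrite !psi2E/= -normrN opprB opprK addrC.
Qed.

End fourier_transform_bound.

(** * The cutoff and the general rate *)

Lemma root_rate_gt0 {R : realType} n : (0 < n)%N -> 0 < root_rate n :> R.
Proof. by move=> n0; rewrite invr_gt0 sqrtr_gt0 ltr0n. Qed.

Lemma root_rate_le1 {R : realType} n : (0 < n)%N -> root_rate n <= 1 :> R.
Proof.
move=> n0; rewrite /root_rate invf_le1 ?sqrtr_gt0 ?ltr0n//.
by rewrite -[leLHS]sqrtr1 ler_wsqrtr// ler1n.
Qed.

Section cutoff_theory.
Context {R : realType} (s : R) (w g : R -> R) (n : nat).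
Hypotheses (s0 : 0 < s) (n0 : (0 < n)%N).
Hypotheses (cw : continuous w) (cg : continuous g).
Hypotheses (w0 : forall u, 0 < w u) (w1 : forall u, w u <= 1).
Hypotheses (g0 : forall u, 0 < g u) (g1 : forall u, g u <= 1).

Local Notation U := (cutoff w g n).
Local Notation r := (@root_rate R n).

Let A := [set u : R | 0 < u /\ 1 <= (1 + u) ^+ 2 * r / (w u * g u)].

Let wg0 u : 0 < w u * g u. Proof. exact: mulr_gt0. Qed.

Let wg1 u : w u * g u <= 1.
Proof. by rewrite -[leRHS]mul1r ler_pM// ltW. Qed.

Let r0 : 0 < r := root_rate_gt0 n0.

Let A_nonempty : A !=set0.
Proof.
exists r^-1; split; first by rewrite invr_gt0.
rewrite ler_pdivlMr// mul1r (le_trans (wg1 _))//.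
rewrite (_ : (1 + r^-1) ^+ 2 * r = 1 + (1 + r + r^-1)); last first.
  by field; rewrite gt_eqF.
by rewrite lerDl !addr_ge0 ?invr_ge0// ltW.
Qed.

Let A_inf : has_inf A.
Proof. by split=> //; exists 0 => u [/ltW]. Qed.

Lemma cutoff_ge0 : 0 <= U.
Proof. by apply: lb_le_inf => // u [/ltW]. Qed.

Let continuous_wg : continuous (fun u : R => w u * g u).
Proof. exact: continuous_mul. Qed.

(** The infimum is attained, by continuity. *)
Lemma cutoff_reached : w U * g U <= (1 + U) ^+ 2 * r.
Proof.
rewrite leNgt; apply/negP => ltU.
pose f u := (1 + u) ^+ 2 * r - w u * g u.
have cf : continuous (f : R -> R).
  apply: continuous_add; last exact: continuous_opp.
  apply: continuous_mul; last exact: continuous_cst.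
  have c1 : continuous (fun u : R => 1 + u).
    by apply: continuous_add; [exact: continuous_cst|exact: continuous_id].
  by rewrite /= (_ : (fun u => _) = fun u => (1 + u) * (1 + u)); 
    [exact: continuous_mul|apply/funext => u; rewrite expr2].
have fU : f U < 0 by rewrite subr_lt0.
have : \forall u \near U, f u < 0.
  exact: (cvgr_lt _ (cf U) 0 fU).
move=> /nbhs_ballP[e/= e0 He].
have [u [u0 uA] uU] := inf_adherent e0 A_inf.
have Uu : U <= u by apply: ge_inf => //; exact: A_inf.2.
have := He u; rewrite /ball/= ltr_distlC => /(_ _)/wrap[].
  by rewrite uU andbT (lt_le_trans _ Uu)// ltrBlDr ltrDl.
by rewrite subr_lt0 ltNge; move: uA; rewrite ler_pdivlMr// mul1r => ->.
Qed.

Lemma general_rate_ge u : 0 <= u -> u <= U ->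
  r * ((1 + u) `^ (2 - s) / (w u * g u)) <= general_rate s w g n.
Proof.
move=> u0 uU; rewrite /general_rate ler_wpM2l ?(ltW r0)//.
pose f u := expR ((2 - s) * ln (1 + `|u|)) / (w u * g u).
have fE v : 0 <= v -> (1 + v) `^ (2 - s) / (w v * g v) = f v.
  by move=> v0; rewrite /f ger0_norm// /powR gt_eqF// ltr_wpDr.
have cf : continuous (f : R -> R).
  move=> v; apply: cvgM; last by apply: cvgV; [rewrite gt_eqF|exact: continuous_wg].
  apply: continuous_comp; last exact: continuous_expR.
  apply: continuousM; first exact: cst_continuous.
  apply: continuous_comp; last exact/continuous_ln/ltr_pwDl/normr_ge0/ltr01.
  by apply: continuousD; [exact: cst_continuous|exact: norm_continuous].
have [c cU fc] := @EVT_max _ f _ _ cutoff_ge0 (continuous_subspaceT cf).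
apply: sup_ubound; last by exists u => //; rewrite /= in_itv/= u0.
exists (f c) => _ [v vU <-]; rewrite fE; first exact: fc.
by move: vU; rewrite /= in_itv/= => /andP[].
Qed.

(** At the cutoff the supremum which defines the rate is already at least
[(1 + U_n) ^ (- s)]. *)
Lemma powR_le_general_rate u : U <= u -> (1 + u) `^ (- s) <= general_rate s w g n.
Proof.
move=> Uu; have U0 := cutoff_ge0.
apply: le_trans (general_rate_ge U0 (lexx _)).
have U1 : 0 < 1 + U by rewrite ltr_wpDr.
apply: (@le_trans _ _ ((1 + U) `^ (- s))).
  rewrite !powRN lef_pV2 ?posrE ?powR_gt0 ?ltr_wpDr// ?(le_trans U0)//.
  by rewrite ge0_ler_powR ?nnegrE ?addr_ge0 ?lerD2l ?(ltW s0)// (le_trans U0).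
rewrite mulrA ler_pdivlMr//; apply: (le_trans (ler_wpM2l _ cutoff_reached)).
  exact: powR_ge0.
rewrite -powR_mulrn ?(ltW U1)// mulrA -powRD; last by rewrite (gt_eqF U1) implybT.
by rewrite [- s + 2]addrC mulrC.
Qed.

End cutoff_theory.

Lemma normc_levy_cfN {R : realType} (b : R) (nu : finite_borel_measure R) u :
  normc (levy_cf b nu (- u)) = normc (levy_cf b nu u).
Proof.
rewrite !normc_levy_cf; congr expR; apply: eq_Rintegral => x _.
by rewrite /levy_kernel_re sqrrN mulNr cosN.
Qed.

Lemma log_weight_norm {R : realType} (delta u : R) :
  log_weight delta `|u| = log_weight delta u.
Proof. by rewrite /log_weight normr_id. Qed.

Section loss_rates.
Context {R : realType} (delta : R) (b : R) (nu : finite_borel_measure R).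
Variables (s M : R).
Hypotheses (delta0 : 0 < delta) (s0 : 0 < s) (M0 : 0 <= M).

Local Notation m := (fine (nu setT)).
Local Notation w := (log_weight delta).
Local Notation g := (fun u => normc (levy_cf b nu u)).

Definition jet_error (D bh : R) (nuh : finite_borel_measure R) :=
  forall u k, (k < 3)%N ->
  normc (cderive k (levy_cf bh nuh) u - cderive k (levy_cf b nu) u) * w u <= D.

Definition loss_constant :=
  22 * (1 + `|b| + 2 * m) ^+ 2 + 8 * m + 4 * `|b| ^+ 2 + 4 * M.

Let m0 : 0 <= m. Proof. exact: fine_ge0. Qed.

Let g_norm u : g `|u| = g u.
Proof.
have [u0|u0] := leP 0 u; first by rewrite ger0_norm.
rewrite (ltr0_norm u0); exact: normc_levy_cfN.
Qed.

Let wg0 u : 0 < w u * g u.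
Proof. by rewrite mulr_gt0 ?log_weight_gt0 ?levy_cf_gt0. Qed.

Lemma loss_constant_ge0 : 0 <= loss_constant.
Proof.
rewrite /loss_constant.
by have := sqr_ge0 (1 + `|b| + 2 * m); have := sqr_ge0 `|b|; move: m0 M0; lra.
Qed.

Section one_sample_size.
Variables (n : nat) (D bh : R) (nuh : finite_borel_measure R).
Hypotheses (n0 : (0 < n)%N) (jets : jet_error D bh nuh) (DM : D <= M * root_rate n).

Local Notation H u := (normc (psi2 nuh u - psi2 nu u)).

Let D0 : 0 <= D.
Proof.
apply: le_trans (@jets 0 0%N isT).
by rewrite mulr_ge0 ?normc_ge0// ltW ?log_weight_gt0.
Qed.

Let DleM : D <= M.
Proof. by rewrite (le_trans DM)// ler_piMr// root_rate_le1. Qed.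

Lemma psi2_error_le u : H u <= loss_constant.
Proof.
have := psi2_diff_le (log_weight0 delta) jets u.
move=> /le_trans; apply; rewrite /loss_constant real_normK ?num_real//.
have := sqr_ge0 (1 + `|b| + 2 * m); have := sqr_ge0 b.
by move: DleM m0 D0; lra.
Qed.

Lemma psi2_error_weighted u (L : R) :
  1 <= L -> normc (psi1 nu b u) <= L -> 2 * m <= L ^+ 2 ->
  H u * (w u * g u) <= (22 * L ^+ 2 + 8 * m + 4 * `|b| ^+ 2 + 4 * M) * (M * root_rate n).
Proof.
move=> L1 p1 p2.
have := psi2_diff_weighted (@log_weight_gt0 R delta) (log_weight0 delta) jets L1 p1 p2.
move=> /le_trans; apply; rewrite real_normK ?num_real//; apply: ler_pM => //.
  by have := sqr_ge0 L; have := sqr_ge0 b; move: m0 D0; lra.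
by rewrite lerD2l ler_wpM2l.
Qed.

Lemma psi2_error_weighted_growth u :
  H u * (w u * g u) <= loss_constant * (1 + `|u|) ^+ 2 * (M * root_rate n).
Proof.
have u1 : 1 <= 1 + `|u| by rewrite lerDl.
have L1 : 1 <= 1 + `|b| + 2 * m by rewrite -addrA lerDl addr_ge0 ?mulr_ge0.
have := @psi2_error_weighted u ((1 + `|b| + 2 * m) * (1 + `|u|)).
move=> /(_ _ _ _)/le_trans; apply.
- by rewrite mulr_ege1.
- apply: (le_trans (normc_psi1_le _ _ _)).
  by have := mulr_ge0 (normr_ge0 b) (normr_ge0 u); move: (normr_ge0 u) m0; lra.
- rewrite (@le_trans _ _ (1 + `|b| + 2 * m))//.
    by have := normr_ge0 b; lra.
  rewrite exprMn -[leLHS]mulr1 ler_pM ?(le_trans ler01 L1)//.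
    by rewrite expr2 ler_peMr// (le_trans ler01).
  by rewrite exprn_ege1.
- rewrite ler_wpM2r//; first by rewrite mulr_ge0// ltW// root_rate_gt0.
  rewrite /loss_constant exprMn.
  have : 1 <= (1 + `|u|) ^+ 2 by rewrite exprn_ege1.
  have : 0 <= 8 * m + 4 * `|b| ^+ 2 + 4 * M.
    by have := sqr_ge0 `|b|; move: m0 M0; lra.
  move=> y0 t1; have t0 : 0 <= (1 + `|u|) ^+ 2 - 1 by rewrite subr_ge0.
  by have := mulr_ge0 y0 t0; lra.
Qed.

(** The weighted bound is used up to the cutoff, and the bound by a constant beyond. *)
Lemma loss_le_general :
  (loss s nuh nu <= (loss_constant * (1 + M) * general_rate s w g n)%:E)%E.
Proof.
have K0 := loss_constant_ge0.
have cw := @continuous_log_weight R delta.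
have cg := @continuous_normc_levy_cf R b nu.
have w0 := @log_weight_gt0 R delta; have w1 := @log_weight_le1 R delta delta0.
have g0 := @levy_cf_gt0 R b nu; have g1 := @levy_cf_le1 R b nu.
apply: loss_le_psi2; first exact: ltW.
move=> u; have a0 : 0 <= `|u| by [].
have a1 : 0 < 1 + `|u| by rewrite ltr_pwDl.
have [uU|Uu] := leP `|u| (cutoff w g n).
- have := general_rate_ge s n0 cw cg w0 w1 g0 g1 a0 uU.
  rewrite g_norm log_weight_norm; set G := general_rate _ _ _ _ => HG.
  have G0 : 0 <= G.
    apply: le_trans HG; rewrite mulr_ge0 ?(ltW (root_rate_gt0 n0))//.
    by rewrite divr_ge0 ?powR_ge0// ltW.
  have := psi2_error_weighted_growth u; rewrite -ler_pdivlMr// => /le_trans; apply.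
  have -> : (1 + `|u|) ^+ 2 = (1 + `|u|) `^ (2 - s) * (1 + `|u|) `^ s.
    by rewrite -powRD ?subrK ?powR_mulrn ?(ltW a1)// (gt_eqF a1) implybT.
  rewrite [X in X <= _](_ : _ = loss_constant * M *
    (root_rate n * ((1 + `|u|) `^ (2 - s) / (w u * g u))) * (1 + `|u|) `^ s).
    rewrite ler_wpM2r ?powR_ge0// ler_pM//; first exact: mulr_ge0.
      rewrite mulr_ge0 ?(ltW (root_rate_gt0 n0))//.
      by rewrite divr_ge0 ?powR_ge0// ltW.
    by rewrite ler_wpM2l// lerDr.
  by field; rewrite !gt_eqF.
- have := powR_le_general_rate s0 n0 cw cg w0 w1 g0 g1 (ltW Uu).
  set G := general_rate _ _ _ _ => HG.
  apply: (le_trans (psi2_error_le u)).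
  rewrite -(mulrA (loss_constant * _)) -(mulrA loss_constant) ler_peMr//.
  have e1 : 1 <= G * (1 + `|u|) `^ s.
    apply: le_trans (ler_wpM2r (powR_ge0 _ _) HG).
    by rewrite -powRD ?addNr ?powRr0// (gt_eqF a1) implybT.
  by rewrite mulr_ege1// lerDl.
Qed.

End one_sample_size.

End loss_rates.
(** * Exponential decay *)

Section elementary_growth.
Context {R : realType}.
Implicit Types a kappa u y : R.

(** From [z <= expR z] at [z = (kappa / a) (2 + y)]. *)
Lemma powR_le_expR a kappa : 0 < a -> 0 < kappa ->
  exists2 C : R, 0 < C & forall y, 0 <= y -> (2 + y) `^ a <= C * expR (kappa * y).
Proof.
move=> a0 k0; exists ((a / kappa) `^ a * expR (2 * kappa)) => [|y y0].
  by rewrite mulr_gt0 ?expR_gt0// powR_gt0// divr_gt0.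
have ak0 : 0 <= a / kappa by rewrite ltW// divr_gt0.
have e0 : 0 <= kappa / a * (2 + y) by rewrite mulr_ge0 ?addr_ge0// ltW// divr_gt0.
have -> : 2 + y = a / kappa * (kappa / a * (2 + y)).
  by field; rewrite !gt_eqF.
rewrite [leLHS](powRM _ ak0 e0) -[leRHS]mulrA ler_wpM2l ?powR_ge0// -expRD.
have -> : 2 * kappa + kappa * y = kappa / a * (2 + y) * a by field; rewrite gt_eqF.
rewrite expRM ge0_ler_powR ?nnegrE ?expR_ge0 ?(ltW a0)//.
by rewrite (le_trans _ (expR_ge1Dx _))// lerDr.
Qed.

Lemma ln_expR1D_le_ln u : ln (expR 1 + `|u|) <= 1 + ln (1 + `|u|).
Proof.
have u1 : 0 < 1 + `|u| by rewrite ltr_pwDl.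
rewrite (@le_trans _ _ (ln (expR 1 * (1 + `|u|))))//; last first.
  by rewrite lnM ?posrE ?expR_gt0// expRK.
rewrite ler_ln ?posrE ?mulr_gt0 ?expR_gt0 ?ltr_wpDr ?expR_gt0//.
rewrite mulrDr mulr1 lerD2l ler_peMl//.
by rewrite (le_trans _ (expR_ge1Dx _))// lerDl.
Qed.

Lemma ln_expR1D_le u : ln (expR 1 + `|u|) <= 1 + `|u|.
Proof.
rewrite (le_trans (ln_expR1D_le_ln u))// lerD2l.
by rewrite -[leRHS]expRK ler_ln ?posrE ?expR_gt0 ?ltr_pwDl// expR_ge1Dx.
Qed.

Lemma log_weightV delta u :
  (log_weight delta u)^-1 = ln (expR 1 + `|u|) `^ (1 / 2 + delta).
Proof. by rewrite /log_weight -opprD powRN invrK. Qed.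

Lemma root_rate_expR n : (0 < n)%N -> root_rate n = expR (- (ln n%:R / 2)) :> R.
Proof.
move=> n0; have nR : 0 < n%:R :> R by rewrite ltr0n.
rewrite /root_rate expRN; congr (_^-1).
by rewrite -powR12_sqrt ?ler0n// /powR gt_eqF// mulrC.
Qed.

End elementary_growth.

Section exponential_decay.
Context {R : realType} (delta : R) (b : R) (nu : finite_borel_measure R).
Variables (s M kappa c p : R).
Hypotheses (delta0 : 0 < delta) (s0 : 0 < s) (M0 : 0 <= M).
Hypotheses (kappa0 : 0 < kappa) (c0 : 0 < c) (p1 : 1 <= p).
Hypothesis decay : forall u : R,
  c * expR (- (kappa * `|u| `^ p)) <= normc (levy_cf b nu u).

(** The frequencies are cut at [V] with [kappa V ^ p = (ln n) / 4]: up to [V] the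
function [|phi|] is at least of order [n ^ (-1/4)], and the remaining factor
[n ^ (-1/4)] absorbs all the powers of [1 + V]. *)
Lemma exponential_rate : exists K : R, 0 <= K /\
  forall n (D bh : R) nuh, (1 < n)%N -> jet_error delta b nu D bh nuh ->
    D <= M * root_rate n ->
    (loss s nuh nu <= (K * ln n%:R `^ (- (s / p)))%:E)%E.
Proof.
(* the powers of 1 + V: from the weight, from (1 + |u|) ^ 2, and from the rate *)
pose a : R := 1 / 2 + delta + 2 + s.
have a0 : 0 < a by rewrite /a; move: delta0 s0; lra.
have p0 : 0 < p by apply: lt_le_trans p1.
have [Ca Ca0 Ha] := powR_le_expR a0 kappa0.
pose L := loss_constant b nu M.
have L0 : 0 <= L by exact: loss_constant_ge0.
exists (L * (1 + M * Ca / c) * (4 * kappa) `^ (s / p)); split.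
  rewrite !mulr_ge0 ?powR_ge0// addr_ge0// divr_ge0 ?(ltW c0)//.
  by rewrite mulr_ge0// ltW.
move=> n D bh nuh n1 jets DM; have n0 := ltnW n1.
pose y : R := ln n%:R / (4 * kappa).
have ln0 : 0 < ln n%:R :> R by rewrite ln_gt0// ltr1n.
have k4 : 0 < 4 * kappa by rewrite mulr_gt0.
have y0 : 0 < y by rewrite divr_gt0.
pose V := y `^ p^-1.
have V0 : 0 < V by exact: powR_gt0.
have Vy : V `^ p = y by rewrite -powRrM mulVf ?gt_eqF// powRr1// ltW.
have V1 : 1 + V <= 2 + y.
  have [V1|V1] := leP V 1; first by move: V1 y0; lra.
  have : V <= y.
    by rewrite -Vy -[leLHS](powRr1 (ltW V0)) ler_powR// ltW.
  by lra.
have rE : root_rate n = expR (- (2 * kappa * y)) :> R.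
  by rewrite root_rate_expR// /y; congr (expR (- _)); field; rewrite gt_eqF.
have rate : V `^ (- s) = ln n%:R `^ (- (s / p)) * (4 * kappa) `^ (s / p).
  rewrite /V -powRrM /y powRM ?invr_ge0 ?(ltW ln0) ?(ltW k4)//.
  rewrite (_ : p^-1 * - s = - (s / p)); last by rewrite mulrN mulrC.
  congr (_ * _); rewrite -[_^-1](powR_inv1 (ltW k4)) -powRrM.
  by congr (_ `^ _); ring.
rewrite [X in X%:E](_ : _ = L * (1 + M * Ca / c) * V `^ (- s)); last first.
  by rewrite rate; ring.
apply: loss_le_psi2; first exact: ltW.
move=> u; have u1 : 0 < 1 + `|u| by rewrite ltr_pwDl.
have Vs : (1 + V) `^ (- s) <= V `^ (- s).
  rewrite !powRN lef_pV2 ?posrE ?powR_gt0// ?ltr_pwDl// ?(ltW V0)//.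
  by rewrite ge0_ler_powR ?nnegrE ?(ltW s0) ?(ltW V0) ?lerDr// addr_ge0// ltW.
have MC0 : 0 <= M * Ca / c by rewrite divr_ge0 ?(ltW c0)// mulr_ge0// ltW.
have [uV|Vu] := leP `|u| V.
- have g0 := levy_cf_gt0 b nu u; have w0 := log_weight_gt0 delta u.
  have := psi2_error_weighted_growth M0 n0 jets DM u; rewrite -/L.
  rewrite -ler_pdivlMr ?mulr_gt0// => /le_trans; apply.
  rewrite invfM [_^-1 * _^-1]mulrC mulrA log_weightV.
  have gV : (normc (levy_cf b nu u))^-1 <= c^-1 * expR (kappa * y).
    rewrite -[expR _]invrK -expRN -invfM lef_pV2 ?posrE ?mulr_gt0 ?expR_gt0//.
    rewrite (le_trans _ (decay u))// ler_pM2l// ler_expR lerN2 ler_pM2l//.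
    by rewrite -Vy ge0_ler_powR ?nnegrE ?(ltW p0) ?(ltW V0).
  have wV : ln (expR 1 + `|u|) `^ (1 / 2 + delta) <= (1 + V) `^ (1 / 2 + delta).
    rewrite ge0_ler_powR ?nnegrE ?(ltW (ln_expR1D_gt0 _)) ?addr_ge0 ?(ltW V0) ?(ltW delta0)//.
    by rewrite (le_trans (ln_expR1D_le u))// lerD2l.
  have V10 : 0 < 1 + V by rewrite ltr_pwDl// ltW.
  have Mr0 : 0 <= M * root_rate n by rewrite mulr_ge0// ltW// root_rate_gt0.
  have aV : (1 + V) ^+ 2 * (1 + V) `^ (1 / 2 + delta) = (1 + V) `^ a * (1 + V) `^ (- s).
    rewrite -(powR_mulrn 2 (ltW V10)) -!powRD ?(gt_eqF V10) ?implybT//.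
    by congr (_ `^ _); rewrite /a; ring.
  have CaV : (1 + V) `^ a * expR (- (kappa * y)) <= Ca.
    rewrite expRN ler_pdivrMr ?expR_gt0// (le_trans _ (Ha _ (ltW y0)))//.
    by rewrite ge0_ler_powR ?nnegrE ?(ltW a0) ?(ltW V10) ?addr_ge0 ?(ltW y0).
  apply: (@le_trans _ _ (L * (1 + V) ^+ 2 * (M * root_rate n) *
      (c^-1 * expR (kappa * y)) * (1 + V) `^ (1 / 2 + delta))).
    have q0 : 0 <= (1 + `|u|) ^+ 2 by rewrite sqr_ge0.
    have qV : (1 + `|u|) ^+ 2 <= (1 + V) ^+ 2.
      by rewrite lerXn2r ?nnegrE ?(ltW u1) ?(ltW V10)// lerD2l.
    have i0 : 0 <= (normc (levy_cf b nu u))^-1 by rewrite invr_ge0 ltW.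
    have lL : L * (1 + `|u|) ^+ 2 * (M * root_rate n) <= L * (1 + V) ^+ 2 * (M * root_rate n).
      by rewrite ler_wpM2r// ler_wpM2l.
    have l0 : 0 <= L * (1 + `|u|) ^+ 2 * (M * root_rate n).
      by apply: mulr_ge0 => //; exact: mulr_ge0.
    apply: ler_pM => //; [exact: mulr_ge0|exact: powR_ge0|exact: ler_pM].
  rewrite [leLHS](_ : _ = L * (M * ((1 + V) `^ a * expR (- (kappa * y))) / c) *
      (1 + V) `^ (- s)); last first.
    have -> : root_rate n = expR (- (kappa * y)) * expR (- (kappa * y)) :> R.
      by rewrite rE -expRD; congr expR; ring.
    have -> : expR (kappa * y) = (expR (- (kappa * y)))^-1 by rewrite expRN invrK.
    transitivity (L * (M * expR (- (kappa * y)) / c) *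
      ((1 + V) ^+ 2 * (1 + V) `^ (1 / 2 + delta))).
      by field; rewrite !gt_eqF ?expR_gt0.
    by rewrite aV; ring.
  have us : 1 <= (1 + `|u|) `^ s.
    by rewrite -[leLHS](powRr0 (1 + `|u|)) ler_powR ?lerDl// ltW.
  apply: (@le_trans _ _ (L * (1 + M * Ca / c) * V `^ (- s))); last first.
    by rewrite ler_peMr// !mulr_ge0 ?powR_ge0// addr_ge0.
  apply: ler_pM => //; last 1 first.
  + rewrite ler_wpM2l// (@le_trans _ _ (M * Ca / c))//.
      by rewrite ler_pM2r ?invr_gt0// ler_wpM2l.
    by rewrite lerDr.
  + rewrite mulr_ge0// divr_ge0 ?(ltW c0)// mulr_ge0// mulr_ge0 ?powR_ge0//.
  + exact: powR_ge0.
- apply: (le_trans (psi2_error_le M0 n0 jets DM u)); rewrite -/L.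
  rewrite -(mulrA (L * _)) -(mulrA L) ler_peMr//.
  have e1 : 1 <= V `^ (- s) * (1 + `|u|) `^ s.
    rewrite powRN mulrC ler_pdivlMr ?powR_gt0// mul1r.
    rewrite ge0_ler_powR ?nnegrE ?(ltW s0) ?(ltW V0) ?(ltW u1)//.
    by rewrite (le_trans (ltW Vu))// lerDr.
  by rewrite mulr_ege1// lerDl.
Qed.

End exponential_decay.

(** * Polynomial decay *)

Section kernel_against_dyadic_exponents.
Context {R : realType}.
Implicit Types u v x y : R.

Lemma one_sub_cos y : 1 - cos y = 2 * sin (y / 2) ^+ 2.
Proof.
rewrite {1}(_ : y = y / 2 + y / 2); last by field.
by rewrite cosD -!expr2; have := cos2Dsin2 (y / 2); lra.
Qed.

Lemma sin_norm_le y : `|sin y| <= `|y|.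
Proof. by have := sin_lipschitz y 0; rewrite sin0 !subr0. Qed.

Lemma cos_ge_half y : `|y| <= 1 -> 1 / 2 <= cos y.
Proof.
move=> y1; have := one_sub_cos y.
have : sin (y / 2) ^+ 2 <= 1 / 4.
  rewrite -real_normK ?num_real// (_ : 1 / 4 = (1 / 2) ^+ 2); last by field.
  rewrite lerXn2r ?nnegrE// (le_trans (sin_norm_le _))// normrM normfV.
  by rewrite normr_nat; lra.
by lra.
Qed.

Lemma sin_norm_ge y : `|y| <= 1 -> `|y| / 2 <= `|sin y|.
Proof.
move=> y1.
have H (z : R) : 0 <= z -> z <= 1 -> z / 2 <= sin z.
  move=> z0 z1.
  have [|t tz E] := @MVT_segment R sin cos 0 z z0 (fun x _ => is_derive_sin x).
    exact: continuous_subspaceT (@continuous_sin R).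
  have : 1 / 2 <= cos t.
    apply: cos_ge_half; move: tz; rewrite in_itv/= => /andP[t0 tz].
    by rewrite ger0_norm// (le_trans tz).
  by move: E; rewrite sin0 !subr0 => ->; nra.
have [y0|y0] := leP 0 y.
  rewrite ger0_norm// (le_trans (H _ y0 _) (ler_norm _))//.
  by move: y1; rewrite ger0_norm.
rewrite ltr0_norm// (le_trans (H _ _ _) _) ?oppr_ge0 ?(ltW y0)//.
  by move: y1; rewrite ltr0_norm.
by rewrite sinN (le_trans (ler_norm _))// normrN.
Qed.

(** For [|y| <= 1], [sin y] is at least [|y| / 2] in absolute value, and
[1 - cos (v x) = 2 sin (v x / 2) ^ 2]. *)
Lemma levy_kernel_re_ge v x : `|v| * `|x| <= 2 ->
  v ^+ 2 / 8 <= - levy_kernel_re v x.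
Proof.
move=> vx; rewrite /levy_kernel_re; case: eqVneq => [_|x0].
  by have := sqr_ge0 v; lra.
have x20 : 0 < x ^+ 2 by rewrite exprn_even_gt0.
rewrite -mulNr opprB ler_pdivlMr// one_sub_cos.
have H : `|v * x / 2| <= 1.
  by rewrite !normrM normfV normr_nat; lra.
have : (`|v * x / 2| / 2) ^+ 2 <= sin (v * x / 2) ^+ 2.
  by rewrite -[leRHS]real_normK ?num_real// lerXn2r ?nnegrE ?divr_ge0// sin_norm_ge.
rewrite exprMn real_normK ?num_real// => /(ler_wpM2l (ler0n R 2)); apply: le_trans.
by rewrite le_eqVlt; apply/orP; left; apply/eqP; field.
Qed.

(** The kernels of [- Re psi] at the frequencies [2 ^ k], with weights that make the term
[k] of order [2 ^ k] as long as [2 ^ k |x| <= 2]. *)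
Definition dyadic_exponents N x :=
  2 + 16 * \sum_(k < N) (2 ^+ k)^-1 * - levy_kernel_re (2 ^+ k) x.

(** The last index [k] with [2 ^ k |x| <= 2] contributes at least [2 ^ (k + 1)], which is
more than [2 / |x|] unless [k] is the last index of the sum; then it is at least
[|u|]. The constant term covers the sums without such an index. *)
Lemma le_dyadic_exponents N u x y : `|u| <= 2 ^+ N -> y <= `|u| ->
  y * `|x| <= 2 -> y <= dyadic_exponents N x.
Proof.
elim: N u => [|N IH] u uN yu yx.
  by rewrite /dyadic_exponents big_ord0 mulr0 addr0; move: uN; rewrite expr0; lra.
have N0 : 0 < 2 ^+ N :> R by rewrite exprn_gt0.
have S0 : 0 <= \sum_(k < N) (2 ^+ k)^-1 * - levy_kernel_re (2 ^+ k) x.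
  apply: sumr_ge0 => k _; rewrite mulr_ge0 ?invr_ge0 ?exprn_ge0//.
  by rewrite oppr_ge0 levy_kernel_re_le0.
have T0 : 0 <= (2 ^+ N)^-1 * - levy_kernel_re (2 ^+ N) x.
  by rewrite mulr_ge0 ?invr_ge0 ?(ltW N0)// oppr_ge0 levy_kernel_re_le0.
have E : dyadic_exponents N.+1 x = dyadic_exponents N x +
    16 * ((2 ^+ N)^-1 * - levy_kernel_re (2 ^+ N) x).
  by rewrite /dyadic_exponents big_ord_recr/=; ring.
have [xN|Nx] := leP (2 ^+ N * `|x|) 2.
  have : 2 ^+ N / 8 <= (2 ^+ N)^-1 * - levy_kernel_re (2 ^+ N) x.
    rewrite ler_pdivlMl// mulrA -expr2; apply: levy_kernel_re_ge.
    by rewrite (ger0_norm (ltW N0)).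
  move: uN; rewrite exprS /dyadic_exponents big_ord_recr/= => uN.
  by move: T0 S0; lra.
have yN : y <= 2 ^+ N.
  have x0 : 0 < `|x|.
    by rewrite normr_gt0; apply/eqP => x0; move: Nx; rewrite x0 normr0 mulr0; lra.
  by rewrite -(ler_pM2r x0) (le_trans yx)// ltW.
rewrite E (@le_trans _ _ (dyadic_exponents N x))//; last by rewrite lerDl mulr_ge0.
have [yu'|] := leP y 0.
  by rewrite (le_trans yu')// /dyadic_exponents addr_ge0// mulr_ge0.
move=> y0; apply: (IH y) => //; first by rewrite ger0_norm// ltW.
by rewrite ler_norm.
Qed.

Lemma levy_kernel1_re_dyadic N u x : `|u| <= 2 ^+ N ->
  `|levy_kernel1_re u x| <= dyadic_exponents N x.
Proof.
move=> uN; apply: (le_dyadic_exponents uN); first exact: levy_kernel1_re_le.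
rewrite -normrM /levy_kernel1_re; case: eqVneq => [->|x0].
  by rewrite mulr0 normr0.
by rewrite divfK// normrN (le_trans (sin_max _))// ler1n.
Qed.

Lemma levy_kernel1_im_dyadic N u x : `|u| <= 2 ^+ N ->
  `|levy_kernel1_im u x| <= dyadic_exponents N x.
Proof.
move=> uN; apply: (le_dyadic_exponents uN); first exact: levy_kernel1_im_le.
rewrite -normrM /levy_kernel1_im; case: eqVneq => [->|x0].
  by rewrite mulr0 normr0.
rewrite divfK//; have := ler_normB (cos (u * x)) 1; have := cos_max (u * x).
by rewrite normr1; lra.
Qed.

End kernel_against_dyadic_exponents.

Lemma sum_arithmetic_geometric {R : realType} N :
  \sum_(k < N) k.+1%:R / 2 ^+ k <= 4 :> R.
Proof.
suff -> : \sum_(k < N) k.+1%:R / 2 ^+ k = 4 - 2 * (N%:R + 2) / 2 ^+ N :> R.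
  by rewrite gerBl divr_ge0 ?exprn_ge0// mulr_ge0// addr_ge0.
elim: N => [|N IH]; first by rewrite big_ord0; field.
rewrite big_ord_recr/= IH exprS -natr1; field.
by rewrite expf_neq0.
Qed.

Section polynomial_decay.
Context {R : realType} (delta : R) (b : R) (nu : finite_borel_measure R).
Variables (s M beta C : R).
Hypotheses (delta0 : 0 < delta) (s0 : 0 < s) (M0 : 0 <= M).
Hypotheses (beta0 : 0 <= beta) (C0 : 0 < C).
Hypothesis decay : forall u : R,
  C * (1 + `|u|) `^ (- beta) <= normc (levy_cf b nu u).

Local Notation m := (fine (nu setT)).

Let m0 : 0 <= m. Proof. exact: fine_ge0. Qed.

Let c : R := `|ln C| + beta.

Let c0 : 0 <= c. Proof. exact: addr_ge0. Qed.

(** A polynomial lower bound on [|phi|] is a logarithmic upper bound on [- Re psi]. *)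
Lemma levy_re_dyadic_le k : - levy_re nu (2 ^+ k) <= c * k.+1%:R.
Proof.
have := decay (2 ^+ k); rewrite normc_levy_cf ger0_norm ?exprn_ge0// => H.
have k0 : 0 < 1 + 2 ^+ k :> R by rewrite ltr_pwDl// exprn_ge0.
have : ln (C * (1 + 2 ^+ k) `^ (- beta)) <= levy_re nu (2 ^+ k).
  by rewrite -[leRHS]expRK ler_ln ?posrE ?expR_gt0 ?mulr_gt0 ?powR_gt0.
rewrite lnM ?posrE ?powR_gt0// ln_powR.
have l1 : ln (1 + 2 ^+ k) <= k.+1%:R :> R.
  rewrite -[leRHS]expRK ler_ln ?posrE ?expR_gt0//.
  rewrite (@le_trans _ _ (2 ^+ k.+1))//.
    have : 1 <= 2 ^+ k :> R by rewrite exprn_ege1// ler1n.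
    by rewrite exprS; lra.
  rewrite -[k.+1%:R]mulr1 expRM_natl lerXn2r ?nnegrE ?expR_ge0//.
  by rewrite (le_trans _ (expR_ge1Dx _)).
have l2 : - ln C <= `|ln C| * k.+1%:R.
  by rewrite (le_trans (ler_norm _))// normrN ler_peMr// ler1n.
have := ler_wpM2l beta0 l1; rewrite /c; lra.
Qed.

Lemma Rintegral_dyadic_exponents N :
  nu.-integrable setT (EFin \o dyadic_exponents N) /\
  \int[nu]_x dyadic_exponents N x <= 2 * m + 64 * c.
Proof.
have ik v : nu.-integrable setT (EFin \o levy_kernel_re v).
  apply: (@bounded_integrable _ _ _ nu _ (v ^+ 2)); first exact: measurable_levy_kernel_re.
  exact: levy_kernel_re_le.
have it (k : 'I_N) : nu.-integrable setT
    (EFin \o (fun x => (2 ^+ k)^-1 * - levy_kernel_re (2 ^+ k) x)).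
  rewrite (_ : (fun x => _) = fun x => - (2 ^+ k)^-1 * levy_kernel_re (2 ^+ k) x).
    exact: integrable_scale.
  by apply/funext => x; rewrite mulNr mulrN.
have is_ := integrable_sumr it.
split; first exact: (integrable_affine (mu := nu)).
rewrite /dyadic_exponents (Rintegral_affine (mu := nu))// lerD2l.
rewrite (_ : 64 * c = 16 * (4 * c)); last by ring.
rewrite ler_pM2l// (Rintegral_sum it).
apply: (@le_trans _ _ (\sum_(k < N) c * (k.+1%:R / 2 ^+ k))).
  apply: ler_sum => k _.
  have -> : \int[nu]_x ((2 ^+ k)^-1 * - levy_kernel_re (2 ^+ k) x) =
      - (2 ^+ k)^-1 * levy_re nu (2 ^+ k).
    rewrite -(RintegralZl _ measurableT (ik _)); apply: eq_Rintegral => x _.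
    by rewrite mulNr mulrN.
  rewrite mulNr -mulrN mulrA mulrC ler_wpM2r ?invr_ge0 ?exprn_ge0//.
  exact: levy_re_dyadic_le.
by rewrite -mulr_sumr mulrC ler_wpM2r// sum_arithmetic_geometric.
Qed.
(** The kernel of [psi'] is dominated by the dyadic combination of any length [N] with
[|u| <= 2 ^ N], whose integral is bounded uniformly in [N]. *)
Lemma psi1_bounded u : normc (psi1 nu b u) <= `|b| + 2 * (2 * m + 64 * c).
Proof.
have [N uN] : exists N, `|u| <= 2 ^+ N.
  exists (Num.Def.archi_bound `|u|).
  by apply/ltW; exact: upper_nthrootP.
have [iE EB] := Rintegral_dyadic_exponents N.
have Hr : `|levy1_re nu u| <= 2 * m + 64 * c.
  apply: le_trans EB; apply: norm_Rintegral_le => //.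
    exact: measurable_levy_kernel1_re.
  by move=> x; exact: levy_kernel1_re_dyadic.
have Hi : `|\int[nu]_x levy_kernel1_im u x| <= 2 * m + 64 * c.
  apply: le_trans EB; apply: norm_Rintegral_le => //.
    exact: measurable_levy_kernel1_im.
  by move=> x; exact: levy_kernel1_im_dyadic.
apply: (le_trans (normc_le _ _)).
have := ler_normD b (\int[nu]_x levy_kernel1_im u x).
by rewrite -/(levy1_im nu b u); move: Hr Hi; lra.
Qed.

Let L := 1 + `|b| + 2 * (2 * m + 64 * c) + 2 * m.
Let K1 := (22 * L ^+ 2 + 8 * m + 4 * `|b| ^+ 2 + 4 * M) * M / C.
Let ell (u : R) := ln (expR 1 + `|u|) `^ (1 / 2 + delta).

Let K1_ge0 : 0 <= K1.
Proof.
rewrite divr_ge0 ?(ltW C0)// mulr_ge0//.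
by have := sqr_ge0 L; have := sqr_ge0 `|b|; move: m0 M0; lra.
Qed.

Lemma psi2_error_polynomial n (D bh : R) nuh u : (0 < n)%N ->
  jet_error delta b nu D bh nuh -> D <= M * root_rate n ->
  normc (psi2 nuh u - psi2 nu u) <=
  K1 * (root_rate n * (1 + `|u|) `^ beta * ell u).
Proof.
move=> n0 jets DM.
have u1 : 0 < 1 + `|u| by rewrite ltr_pwDl.
have x0 : 0 <= 2 * m + 64 * c by rewrite addr_ge0// mulr_ge0.
have L1 : 1 <= L by have := normr_ge0 b; rewrite /L; move: m0 x0; lra.
have p1L : normc (psi1 nu b u) <= L.
  by have := psi1_bounded u; rewrite /L; move: m0; lra.
have mL : 2 * m <= L ^+ 2.
  rewrite expr2 (@le_trans _ _ L)//; last by rewrite ler_peMr// (le_trans ler01).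
  by have := normr_ge0 b; rewrite /L; move: m0 x0; lra.
have := psi2_error_weighted M0 n0 jets DM L1 p1L mL.
have g0 := levy_cf_gt0 b nu u; have w0 := log_weight_gt0 delta u.
rewrite -ler_pdivlMr ?mulr_gt0// => /le_trans; apply.
rewrite invfM log_weightV -/(ell u).
have gV : (normc (levy_cf b nu u))^-1 <= C^-1 * (1 + `|u|) `^ beta.
  by rewrite -[(1 + `|u|) `^ beta]invrK -powRN -invfM lef_pV2 ?posrE ?mulr_gt0 ?powR_gt0.
rewrite /K1; set A := _ + 4 * M.
have A0 : 0 <= A.
  by have := sqr_ge0 L; have := sqr_ge0 `|b|; rewrite /A; move: m0 M0; lra.
rewrite [leRHS](_ : _ = A * (M * root_rate n) * (ell u * (C^-1 * (1 + `|u|) `^ beta)));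
  last by ring.
by rewrite ler_wpM2l ?ler_wpM2l ?powR_ge0// !mulr_ge0// ltW// root_rate_gt0.
Qed.

(** For [s > beta] the factor [(1 + |u|) ^ s] absorbs both the division by [phi] and the
logarithm of the weight. *)
Lemma polynomial_rate_smooth : beta < s -> exists K : R, 0 <= K /\
  forall n (D bh : R) nuh, (0 < n)%N -> jet_error delta b nu D bh nuh ->
    D <= M * root_rate n -> (loss s nuh nu <= (K * root_rate n)%:E)%E.
Proof.
move=> bs; have sb : 0 < s - beta by rewrite subr_gt0.
have d0 : 0 < 1 / 2 + delta by move: delta0; lra.
have [Cq Cq0 Hq] := powR_le_expR d0 sb.
exists (K1 * Cq); split; first by rewrite mulr_ge0// ltW.
move=> n D bh nuh n0 jets DM; apply: loss_le_psi2; first exact: ltW.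
move=> u; have u1 : 0 < 1 + `|u| by rewrite ltr_pwDl.
apply: (le_trans (psi2_error_polynomial u n0 jets DM)).
rewrite [leRHS](_ : _ = K1 * (root_rate n * (Cq * (1 + `|u|) `^ s))); last by ring.
rewrite ler_wpM2l// -mulrA ler_wpM2l ?(ltW (root_rate_gt0 n0))//.
have z0 : 0 <= ln (1 + `|u|) by rewrite ln_ge0// lerDl.
have lu : ell u <= Cq * (1 + `|u|) `^ (s - beta).
  rewrite /ell {2}/powR (gt_eqF u1); apply: le_trans (Hq _ z0).
  rewrite ge0_ler_powR ?nnegrE ?(ltW d0) ?(ltW (ln_expR1D_gt0 _)) ?addr_ge0//.
  by rewrite (le_trans (ln_expR1D_le_ln u))// lerD2r ler1n.
apply: (le_trans (ler_wpM2l (powR_ge0 _ _) lu)).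
have -> : (1 + `|u|) `^ s = (1 + `|u|) `^ beta * (1 + `|u|) `^ (s - beta).
  rewrite -powRD; last by rewrite (gt_eqF u1) implybT.
  by congr (_ `^ _); ring.
by rewrite mulrCA lexx.
Qed.

(** The error is at most [K] and at most [K X], where [X] is the product of the rate
[n ^ (-1/2)], of a power of [ln n] and of [(1 + |u|) ^ beta]; therefore it is at most
[K X ^ (s / beta)], which is the rate times [(1 + |u|) ^ s]. *)
Lemma polynomial_rate_rough : s <= beta -> exists K : R, 0 <= K /\
  forall n (D bh : R) nuh, expR 1 <= n%:R :> R -> jet_error delta b nu D bh nuh ->
    D <= M * root_rate n ->
    (loss s nuh nu <= (K * (ln n%:R `^ (1 / 2 + 2 * delta) * root_rate n)
       `^ (s / beta))%:E)%E.
Proof.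
move=> sb; have b0 : 0 < beta by apply: lt_le_trans sb.
have t0 : 0 < s / beta by rewrite divr_gt0.
have t1 : s / beta <= 1 by rewrite ler_pdivrMr// mul1r.
have d0 : 0 < 1 / 2 + delta by move: delta0; lra.
pose c2 := (1 + (2 * beta)^-1) `^ (1 / 2 + delta).
have K0 := loss_constant_ge0 b nu M0.
exists (loss_constant b nu M + K1 * c2); split.
  by rewrite addr_ge0// mulr_ge0// powR_ge0.
move=> n D bh nuh n2 jets DM; have n0 : (0 < n)%N.
  by rewrite -(ltr0n R) (lt_le_trans _ n2)// expR_gt0.
have nR : 0 < n%:R :> R by rewrite ltr0n.
have ln1 : 1 <= ln n%:R :> R.
  by rewrite -[leLHS]expRK ler_ln ?posrE ?expR_gt0.
set Lam := ln n%:R `^ _.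
have Lam1 : 1 <= Lam.
  rewrite -[leLHS](powRr0 (ln n%:R)) ler_powR//.
  by move: delta0; lra.
apply: loss_le_psi2; first exact: ltW.
move=> u; have u1 : 0 < 1 + `|u| by rewrite ltr_pwDl.
pose X := Lam * root_rate n * (1 + `|u|) `^ beta.
have r0 := @root_rate_gt0 R n n0.
have X0 : 0 < X by rewrite !mulr_gt0 ?powR_gt0// (lt_le_trans ltr01).
have Xt : X `^ (s / beta) =
    (Lam * root_rate n) `^ (s / beta) * (1 + `|u|) `^ s.
  rewrite /X powRM ?powR_ge0 ?mulr_ge0 ?(ltW r0) ?(le_trans ler01 Lam1)//.
  by rewrite -powRrM mulrC [beta * _]mulrC divfK ?gt_eqF// mulrC.
rewrite -mulrA -Xt.
have [X1|X1] := leP 1 X.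
  have Xt1 : 1 <= X `^ (s / beta).
    by rewrite -[leLHS](powRr0 X) ler_powR// ltW.
  apply: (le_trans (psi2_error_le M0 n0 jets DM u)).
  rewrite (@le_trans _ _ (loss_constant b nu M + K1 * c2))//.
    by rewrite lerDl mulr_ge0// powR_ge0.
  by rewrite ler_peMr// addr_ge0// mulr_ge0// powR_ge0.
have XX : X <= X `^ (s / beta).
  by rewrite -[leLHS](powRr1 (ltW X0)) ger_powR// X0 ltW.
apply: (@le_trans _ _ (K1 * c2 * X)); last first.
  apply: ler_pM => //; [by rewrite mulr_ge0// powR_ge0|exact: ltW|].
  by rewrite lerDr.
apply: (le_trans (psi2_error_polynomial u n0 jets DM)).
rewrite -[leRHS]mulrA ler_wpM2l// [leRHS](_ : _ =
  root_rate n * (1 + `|u|) `^ beta * (c2 * Lam)); last by rewrite /X; ring.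
rewrite ler_wpM2l ?mulr_ge0 ?powR_ge0 ?(ltW r0)//.
(* in this range 1 + |u| is at most n ^ (1 / (2 beta)) *)
have zn : ln (1 + `|u|) <= (2 * beta)^-1 * ln n%:R.
  have : root_rate n * (1 + `|u|) `^ beta <= 1.
    apply: le_trans (ltW X1); rewrite /X -mulrA ler_peMl// mulr_ge0 ?powR_ge0//.
    exact: ltW.
  rewrite root_rate_expR// {1}/powR (gt_eqF u1) -expRD -[X in _ <= X -> _]expR0 ler_expR.
  rewrite ler_pdivlMl ?mulr_gt0//; lra.
apply: (@le_trans _ _ (c2 * ln n%:R `^ (1 / 2 + delta))); last first.
  rewrite ler_wpM2l ?powR_ge0// ler_powR//.
  by move: delta0; lra.
rewrite /c2 -powRM ?addr_ge0 ?invr_ge0 ?mulr_ge0 ?(le_trans ler01 ln1)//.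
rewrite ge0_ler_powR ?nnegrE ?(ltW d0) ?(ltW (ln_expR1D_gt0 _))//.
  rewrite mulr_ge0 ?(le_trans ler01 ln1)// addr_ge0// invr_ge0 mulr_ge0//.
rewrite (le_trans (ln_expR1D_le_ln u))// mulrDl mul1r.
by move: ln1 zn; lra.
Qed.

End polynomial_decay.

(** * The minimum distance estimator *)

Lemma measure_le_ae {R : realType} d (T : measurableType d)
    (mu : {measure set T -> \bar R}) (A B : set T) :
  measurable A -> measurable B -> {ae mu, forall x, A x -> B x} ->
  (mu A <= mu B)%E.
Proof.
move=> mA mB [N [mN N0 HN]].
apply: (@le_trans _ _ (mu (B `|` N))).
  apply: le_measure; rewrite ?inE//; first exact: measurableU.
  move=> x Ax; have [Bx|nBx] := pselect (B x); [by left|right].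
  by apply: HN => /(_ Ax).
apply: (le_trans (measureU2 mu mB mN)).
by rewrite [X in (_ + X)%E](_ : _ = 0%E) ?adde0//; exact: N0.
Qed.

Section levy_increments.
Context {R : realType} d (Omega : measurableType d) (P : probability Omega R).
Variables (X : R -> {RV P >-> R}) (b : R) (nu : finite_borel_measure R).
Hypothesis levyX : levy_process_with X b nu.

Let measurable_incr (s t : R) : measurable_fun setT (incr X s t).
Proof. by apply: measurable_funB; exact: measurable_funPT. Qed.

Lemma levy_increment_law (i : nat) (B : set R) : measurable B ->
  P (incr X i%:R i.+1%:R @^-1` B) = P (X 1 @^-1` B).
Proof.
move=> mB; have lX := levy_is_process levyX.
have := levy_stationary lX (ler0n _ i) ler01 mB.
rewrite natr1 => ->.
have mE (f : Omega -> R) : measurable_fun setT f -> measurable (f @^-1` B).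
  by move=> mf; rewrite -[f @^-1` B]setTI; exact: mf.
have X0 := levy_start lX.
have mI := mE _ (measurable_incr 0 1); have m1 := mE _ (measurable_funPT (X 1)).
apply/eqP; rewrite eq_le; apply/andP; split.
  apply: (measure_le_ae mI m1); apply: filterS X0 => o Xo.
  by rewrite /preimage /= /incr Xo subr0.
apply: (measure_le_ae m1 mI); apply: filterS X0 => o Xo.
by rewrite /preimage /= /incr Xo subr0.
Qed.

Lemma levy_increments_independent n (B : 'I_n -> set R) :
  (forall i, measurable (B i)) ->
  P [set w | forall i : 'I_n, B i (incr X i%:R i.+1%:R w)] =
  (\prod_(i < n) P ((incr X i%:R i.+1%:R)%R @^-1` B i))%E.
Proof.
move=> mB; have lX := levy_is_process levyX.
pose B' i := if insub i is Some j then B j else setT.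
have B'E (j : 'I_n) : B' j = B j by rewrite /B' valK.
have mB' i : measurable (B' i).
  by rewrite /B'; case: insub => // ; exact: mB.
have := @levy_indep _ _ _ _ _ lX n (fun i => i%:R) B' (lexx _) _ mB'.
have -> : (\prod_(i < n) P ((incr X i%:R i.+1%:R)%R @^-1` B' i))%E =
    (\prod_(i < n) P ((incr X i%:R i.+1%:R)%R @^-1` B i))%E.
  by apply: eq_bigr => i _; rewrite B'E.
move=> <-; last by move=> i j ij; rewrite ler_nat.
congr (P _); apply/seteqP; split => w.
  by move=> H i /= il; have := H (Ordinal il); rewrite -B'E.
by move=> H i; have := H i (ltn_ord i); rewrite /= B'E.
Qed.

Lemma levy_cf_trig u : levy_cf b nu u =
  (\int[P]_o cos (u * X 1 o)) +i* (\int[P]_o sin (u * X 1 o)).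
Proof.
have := levy_cfE levyX u ler01; rewrite mul1r /levy_cf => <-.
by [].
Qed.

Lemma empirical_cfE n o u : empirical_cf X n o u =
  (n%:R^-1)%:C * \sum_(i < n) cis (u * incr X i%:R i.+1%:R o).
Proof. by rewrite /empirical_cf big_add1 big_mkord. Qed.

End levy_increments.

Section estimation_error.
Context {R : realType} (gamma delta : R).
Hypotheses (gamma0 : 0 < gamma) (delta0 : 0 < delta).
Context d (Omega : measurableType d) (P : probability Omega R).
Variables (X : R -> {RV P >-> R}) (b : R) (nu : finite_borel_measure R).
Variables (dn : nat -> R) (bhat : nat -> {RV P >-> R}).
Variable nuhat : nat -> Omega -> finite_borel_measure R.
Hypothesis setting : min_distance_setting gamma delta X b nu dn bhat nuhat.

Definition deviation_constant (moment : R) : R :=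
  6 * (chaining_constant gamma delta * (9 + 8 * moment)).

Local Notation moment := (fine (abs_moment (4 + gamma) (X 1))).
Let K := deviation_constant moment.

Lemma moment_ge0 : 0 <= moment.
Proof.
apply: fine_ge0; rewrite /abs_moment unlock.
by apply: integral_ge0 => o _; rewrite lee_fin powR_ge0.
Qed.

Lemma deviation_constant_ge0 : 0 <= K.
Proof.
rewrite mulr_ge0// mulr_ge0 ?chaining_constant_ge0//.
by rewrite addr_ge0// mulr_ge0// moment_ge0.
Qed.

Let integrable_moment : P.-integrable setT (EFin \o (fun o => `|X 1 o| `^ (4 + gamma))).
Proof.
apply/integrableP; split.
  apply/measurable_EFinP; apply: (measurableT_comp (measurable_powR_norm _)).
  exact: measurable_funPT.
apply: le_lt_trans (setting_moment setting); rewrite /abs_moment unlock.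
rewrite le_eqVlt; apply/orP; left; apply/eqP; apply: eq_integral => o _ /=.
by rewrite ger0_norm// powR_ge0.
Qed.

Lemma setting_deviation n : (0 < n)%N -> exists Y : Omega -> \bar R,
  [/\ measurable_fun setT Y, forall o, (0 <= Y o)%E,
    (\int[P]_o Y o <= (K * root_rate n)%:E)%E &
    forall o y, Y o = y%:E ->
      jet_error delta b nu (4 * y + dn n) (bhat n o) (nuhat n o)].
Proof.
move=> n0; have lX := setting_levy setting.
have mX (t : R) : measurable_fun setT (X t) by exact: measurable_funPT.
have mZ (i : 'I_n) : measurable_fun setT (incr X i%:R i.+1%:R).
  exact: measurable_funB.
have [Y [mY Y0 iY YP]] := @cf_deviation R d Omega P n
  (fun i => incr X i%:R i.+1%:R) (X 1) n0 (mX 1) mZ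
  (@levy_increments_independent _ _ _ _ _ _ _ lX n)
  (fun i B mB => levy_increment_law lX i mB)
  gamma delta gamma0 delta0 integrable_moment (levy_cf b nu)
  (fun o u => empirical_cf X n o u) (levy_cf_trig lX)
  (fun o u => empirical_cfE X n o u).
exists Y; split => //.
  move: iY; rewrite /K /deviation_constant /abs_moment unlock.
  by [].
move=> o y Yy.
apply: (near_minimizer_jets (@log_weight_gt0 R delta)
  (setting_minimizer setting o n0)) => u k k3.
by have := YP u o k k3; rewrite Yy lee_fin mulrC.
Qed.

Lemma drift_estimation_error n D : (0 < n)%N -> dn n <= D * root_rate n ->
  ('E_P[fun o => `|bhat n o - b|%R] <= ((4 * K + D) * root_rate n)%:E)%E.
Proof.
move=> n0 dD; have [Y [mY Y0 iY YP]] := setting_deviation n0.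
have dn0 := ltW (setting_tolerance setting n).
have m4 : measurable_fun setT (fun o => 4%:E * Y o)%E by exact: measurable_funeM.
rewrite unlock; apply: (@le_trans _ _ (\int[P]_o (4%:E * Y o + (dn n)%:E))%E).
  apply: ge0_le_integral => //.
  - apply/measurable_EFinP; apply: measurableT_comp => //.
    by apply: measurable_funB => //; exact: measurable_funPT.
  - exact: emeasurable_funD.
  - move=> o _; have := YP o; have := Y0 o.
    case: (Y o) => [y| |] // _ H.
      rewrite -EFinM -EFinD lee_fin.
      exact: (drift_error (log_weight0 delta) (H _ erefl)).
    by rewrite gt0_muley// ?lte_fin// addye// leey.
rewrite ge0_integralD//; last by move=> o _; rewrite mule_ge0// Y0.
have -> : (\int[P]__ (dn n)%:E = (dn n)%:E)%E.
  rewrite integral_cst//; transitivity ((dn n)%:E * 1)%E; last exact: mule1.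
  by congr (_ * _)%E; exact: probability_setT.
rewrite ge0_integralZl//.
rewrite (@le_trans _ _ (4%:E * (K * root_rate n)%:E + (D * root_rate n)%:E)%E)//.
  by rewrite leeD ?lee_fin// lee_pmul2l.
by rewrite mulrDl -mulrA EFinD EFinM.
Qed.

Definition good_error_constant (eps D : R) := 4 * ((K + 1) / eps) + D.

(** Markov's inequality for the deviation of the empirical characteristic function. *)
Lemma good_event n eps D (B : set Omega) : (0 < n)%N -> 0 < eps ->
  dn n <= D * root_rate n ->
  (forall o D', jet_error delta b nu D' (bhat n o) (nuhat n o) ->
    D' <= good_error_constant eps D * root_rate n -> ~ B o) ->
  ((P^*)%mu B <= eps%:E)%E.
Proof.
move=> n0 eps0 dD HB; have [Y [mY Y0 iY YP]] := setting_deviation n0.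
have r0 := @root_rate_gt0 R n n0; have K0 := deviation_constant_ge0.
pose t := (K + 1) / eps * root_rate n.
have t0 : 0 < t by rewrite mulr_gt0// divr_gt0// ltr_wpDl.
pose A := [set o | (t%:E <= `|Y o|)%E].
have mA : measurable A.
  rewrite -[A]setTI; apply: emeasurable_fun_c_infty => //.
  exact: measurableT_comp.
have BA : B `<=` A.
  move=> o Bo; rewrite /A/= leNgt gee0_abs//; apply/negP => Yt.
  have := YP o; have := Y0 o; move: Yt; case: (Y o) => [y| |] //.
  rewrite lte_fin => yt _ /(_ _ erefl) /HB; apply => //.
  rewrite /good_error_constant (mulrDl (4 * _)) lerD// -mulrA ler_pM2l//.
  exact: ltW.
apply: (le_trans (le_mu_ext P BA)); rewrite measurable_mu_extE//.
have := le_integral_abse P measurableT mY t0; rewrite setTI -/A => H.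
have : (t%:E * P A <= (K * root_rate n)%:E)%E.
  apply: (le_trans H); apply: le_trans iY; rewrite le_eqVlt; apply/orP; left.
  by apply/eqP; apply: eq_integral => o _; rewrite gee0_abs.
have PA : P A \is a fin_num by rewrite fin_num_measure.
rewrite -(fineK PA) -EFinM !lee_fin mulrC -(ler_pdivlMr _ _ t0).
move=> PAt; apply: (@le_trans _ _ (fine (P A))%:E); first by rewrite fineK.
rewrite lee_fin (le_trans PAt)//; have -> : K * root_rate n / t = eps * (K / (K + 1)).
  by rewrite /t; field; rewrite !gt_eqF//= ltr_wpDl.
by rewrite ler_piMr ?(ltW eps0)// ler_pdivrMr ?ltr_wpDl// mul1r lerDl.
Qed.

End estimation_error.

Lemma loss_ge0 {R : realType} s (mu1 mu2 : finite_borel_measure R) :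
  (0 <= loss s mu1 mu2)%E.
Proof.
apply: (@le_trans _ _ (`|\int[mu1]_x (fun=> 0) x - \int[mu2]_x (fun=> 0) x|%:E)).
  by rewrite lee_fin.
apply: ereal_sup_ubound; exists (fun=> 0) => //; split.
- by move=> x; exact: cvg_cst.
- exact: integrable0.
- rewrite (_ : (fun u => _) = fun=> 0%E); first by rewrite integral0 lee_fin.
  apply/funext => u; rewrite (_ : fourier _ u = 0) ?normc0 ?mulr0//.
  rewrite /fourier (_ : (fun x => _) = fun=> 0); last first.
    by apply/funext => x; rewrite mul0r.
  by rewrite /cintegral /Rintegral /= !integral0.
Qed.

Section assembly.
Context {R : realType} (gamma delta : R).
Hypotheses (gamma0 : 0 < gamma) (delta0 : 0 < delta).

Lemma good_error_constant_ge0 d (Omega : measurableType d) (P : probability Omega R)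
    (X : R -> {RV P >-> R}) (eps D : R) : 0 < eps -> 0 <= D ->
  0 <= good_error_constant gamma delta X eps D.
Proof.
move=> e0 D0; rewrite addr_ge0// mulr_ge0// divr_ge0 ?(ltW e0)// addr_ge0//.
exact: deviation_constant_ge0.
Qed.

Section general.
Context d (Omega : measurableType d) (P : probability Omega R).
Variables (X : R -> {RV P >-> R}) (b : R) (nu : finite_borel_measure R).
Variables (dn : nat -> R) (bhat : nat -> {RV P >-> R}).
Variable nuhat : nat -> Omega -> finite_borel_measure R.
Hypothesis setting : min_distance_setting gamma delta X b nu dn bhat nuhat.

Local Notation g := (fun u => normc (levy_cf b nu u)).
Local Notation w := (log_weight delta).
Local Notation M eps D := (good_error_constant gamma delta X eps D).

Lemma tolerance_constant_ge0 n D : (0 < n)%N -> dn n <= D * root_rate n -> 0 <= D.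
Proof.
move=> n0 dD; have r0 := @root_rate_gt0 R n n0.
rewrite -(ler_pM2r r0) mul0r; apply: le_trans dD.
exact/ltW/(setting_tolerance setting).
Qed.

Lemma general_loss_bound s eps n D : 0 < s -> 0 < eps -> (0 < n)%N ->
  dn n <= D * root_rate n ->
  ((P^*)%mu [set o | ((loss_constant b nu (M eps D) * (1 + M eps D) *
     general_rate s w g n)%:E < loss s (nuhat n o) nu)%E] <= eps%:E)%E.
Proof.
move=> s0 e0 n0 dD; have D0 := tolerance_constant_ge0 n0 dD.
have M0 := good_error_constant_ge0 X e0 D0.
apply: (good_event gamma0 delta0 setting n0 e0 dD) => o D' jets D'M.
by apply/negP; rewrite -leNgt; apply: (loss_le_general delta0 s0 M0 n0 jets D'M).
Qed.

(** On the complement of an event of small probability, the rates are deterministic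
consequences of the bound on the jets. *)
Lemma bounded_in_prob_of_jets s (r : nat -> R) : dn =O_\oo root_rate ->
  (forall M, 0 <= M -> exists (K : R) (N : nat), forall n D bh nuh,
     (N <= n)%N -> (0 < n)%N -> jet_error delta b nu D bh nuh -> D <= M * root_rate n ->
     (loss s nuh nu <= (K * r n)%:E)%E) ->
  bounded_in_prob P (fun n o => loss s (nuhat n o) nu) r.
Proof.
move=> /eqO_exP[D D0 dnD] H eps e0.
have M0 := good_error_constant_ge0 X e0 (ltW D0).
have [K [N HK]] := H _ M0; exists K.
near=> n.
have n0 : (0 < n)%N by near: n; exists 1%N.
have dD : dn n <= D * root_rate n.
  have : `|dn n| <= D * `|root_rate n : R| by near: n.
  by rewrite (ger0_norm (ltW (root_rate_gt0 n0))); apply: le_trans (ler_norm _).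
have Nn : (N <= n)%N by near: n; exists N.
apply: (good_event gamma0 delta0 setting n0 e0 dD) => o D' jets D'M /=.
apply/negP; rewrite -leNgt gee0_abs ?loss_ge0//.
exact: (HK n D' (bhat n o) _ Nn n0 jets D'M).
Unshelve. all: by end_near. Qed.

Lemma drift_bound_asymptotic : dn =O_\oo root_rate ->
  exists C : R, \forall n \near \oo,
    ('E_P[fun o => `|bhat n o - b|%R] <= (C * root_rate n)%:E)%E.
Proof.
move=> /eqO_exP[D D0 dnD].
eexists; near=> n.
have n0 : (0 < n)%N by near: n; exists 1%N.
have dD : dn n <= D * root_rate n.
  have : `|dn n| <= D * `|root_rate n : R| by near: n.
  by rewrite (ger0_norm (ltW (root_rate_gt0 n0))); apply: le_trans (ler_norm _).
exact: (drift_estimation_error gamma0 delta0 setting n0 dD).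
Unshelve. all: by end_near. Qed.

Lemma general_in_prob s : 0 < s -> dn =O_\oo root_rate ->
  bounded_in_prob P (fun n o => loss s (nuhat n o) nu) (general_rate s w g).
Proof.
move=> s0 dO; apply: bounded_in_prob_of_jets => // M M0; do 2 eexists.
by move=> n D bh nuh _ n0 jets DM; exact: (loss_le_general delta0 s0 M0 n0 jets DM).
Unshelve. exact: 0%N.
Qed.

Lemma exponential_in_prob s kappa c p : 0 < s -> 0 < kappa -> 0 < c ->
  1 <= p -> (forall u : R, c * expR (- (kappa * `|u| `^ p)) <= g u) ->
  dn =O_\oo root_rate ->
  bounded_in_prob P (fun n o => loss s (nuhat n o) nu)
    (fun n => ln n%:R `^ (- (s / p))).
Proof.
move=> s0 k0 c0 p1 decay dO; apply: bounded_in_prob_of_jets => // M M0.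
have [K [_ HK]] := exponential_rate delta0 s0 M0 k0 c0 p1 decay.
by exists K, 2%N => n D bh nuh n2 _ jets DM; exact: (HK n D bh nuh n2 jets DM).
Qed.

Lemma gaussian_in_prob s : 0 < s -> dn =O_\oo root_rate ->
  bounded_in_prob P (fun n o => loss s (nuhat n o) nu)
    (fun n => ln n%:R `^ (- (s / 2))).
Proof.
move=> s0; apply: (@exponential_in_prob s (fine (nu setT) + 1) 1 2) => //.
- by rewrite ltr_wpDl// fine_ge0.
- by rewrite ler1n.
- move=> u; rewrite mul1r; apply: le_trans (levy_cf_ge b nu u).
  rewrite ler_expR lerN2 -[2]/(2%:R) powR_mulrn// real_normK ?num_real//.
  by rewrite ler_wpM2r ?sqr_ge0// lerDl.
Qed.

Lemma polynomial_in_prob s beta C : 0 < s -> 0 <= beta -> 0 < C ->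
  (forall u : R, C * (1 + `|u|) `^ (- beta) <= g u) -> dn =O_\oo root_rate ->
  bounded_in_prob P (fun n o => loss s (nuhat n o) nu)
    (fun n => if beta == 0 then root_rate n else
       Num.max ((ln n%:R `^ (1 / 2 + 2 * delta) * root_rate n) `^ (s / beta))
               (root_rate n)).
Proof.
move=> s0 b0 C0 decay dO; apply: bounded_in_prob_of_jets => // M M0.
have [bs|sb] := ltP beta s.
- have [K [K0 HK]] := polynomial_rate_smooth delta0 s0 M0 b0 C0 decay bs.
  exists K, 1%N => n D bh nuh _ n0 jets DM.
  apply: (le_trans (HK n D bh nuh n0 jets DM)); rewrite lee_fin ler_wpM2l//.
  by case: eqP => _ //; rewrite le_max lexx orbT.
- have [K [K0 HK]] := polynomial_rate_rough delta0 s0 M0 b0 C0 decay sb.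
  have [N HN] : exists N : nat, expR 1 <= N%:R :> R.
    by exists (Num.Def.archi_bound (expR 1 : R)); exact/ltW/archi_boundP/expR_ge0.
  exists K, N => n D bh nuh Nn n0 jets DM.
  have en : expR 1 <= n%:R :> R by rewrite (le_trans HN)// ler_nat.
  apply: (le_trans (HK n D bh nuh en jets DM)); rewrite lee_fin ler_wpM2l//.
  by rewrite gt_eqF ?(lt_le_trans s0)// le_max lexx.
Qed.

End general.

End assembly.
Section continuous_constants_of_the_setting.
Context {R : realType}.

Lemma continuous_moment_arg : continuous (fun t : R * R * R * R => t.1.2).
Proof.
move=> t; apply: (@cvg_comp _ _ _ fst snd); [exact: cvg_fst|exact: cvg_snd].
Qed.

Lemma continuous_deviation (gamma delta : R) :
  continuous (fun t : R * R * R * R => deviation_constant gamma delta t.1.2).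
Proof.
do 2 (apply: continuous_mul; first exact: continuous_cst).
apply: continuous_add; first exact: continuous_cst.
apply: continuous_mul; first exact: continuous_cst.
exact: continuous_moment_arg.
Qed.

Lemma continuous_loss_constant (gamma delta eps : R) :
  let M (t : R * R * R * R) :=
    4 * ((deviation_constant gamma delta t.1.2 + 1) / eps) + t.2 in
  continuous (fun t : R * R * R * R => (22 * (1 + t.1.1.1 + 2 * t.1.1.2) ^+ 2 + 8 * t.1.1.2 +
    4 * t.1.1.1 ^+ 2 + 4 * M t) * (1 + M t)).
Proof.
move=> M.
have cc (c : R) : continuous (fun _ : R * R * R * R => c) by exact: continuous_cst.
have c11 : continuous (fun t : R * R * R * R => t.1.1).
  by move=> t; apply: (@continuous_comp _ _ _ fst fst); exact: cvg_fst.
have cb : continuous (fun t : R * R * R * R => t.1.1.1).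
  by move=> t; apply: (continuous_comp (c11 t)); exact: cvg_fst.
have cn : continuous (fun t : R * R * R * R => t.1.1.2).
  by move=> t; apply: (continuous_comp (c11 t)); exact: cvg_snd.
have cM : continuous M.
  apply: continuous_add; last by move=> t; exact: cvg_snd.
  apply: continuous_mul => //; apply: continuous_mul => //.
  by apply: continuous_add => //; exact: continuous_deviation.
have sq (f : R * R * R * R -> R) : continuous f -> continuous (fun t => f t ^+ 2).
  move=> cf; rewrite (_ : (fun t => _) = fun t => f t * f t).
    exact: continuous_mul.
  by apply/funext => t; rewrite expr2.
apply: continuous_mul; last exact: continuous_add.
apply: continuous_add; last exact: continuous_mul.
apply: continuous_add; last by apply: continuous_mul => //; exact: sq.
apply: continuous_add; last exact: continuous_mul.
apply: continuous_mul => //; apply: sq; apply: continuous_add.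
  exact: continuous_add.
exact: continuous_mul.
Qed.

End continuous_constants_of_the_setting.

Theorem theorem4p2 (R : realType) (gamma delta : R) :
  0 < gamma -> 0 < delta ->
  let w := log_weight delta in
  (forall (d : measure_display) (Omega : measurableType d)
      (P : probability Omega R) (X : R -> {RV P >-> R})
      (b : R) (nu : finite_borel_measure R) (dn : nat -> R)
      (bhat : nat -> {RV P >-> R})
      (nuhat : nat -> Omega -> finite_borel_measure R),
    min_distance_setting gamma delta X b nu dn bhat nuhat ->
    dn =O_\oo root_rate ->
    let g u := normc (levy_cf b nu u) in
    let err s n o := loss s (nuhat n o) nu in
    [/\ exists C : R, \forall n \near \oo,
          ('E_P[fun o => `|bhat n o - b|%R] <= (C * root_rate n)%:E)%E,
        forall s : R, 0 < s -> bounded_in_prob P (err s) (general_rate s w g),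
        (0 < nu [set 0%R])%E -> forall s : R, 0 < s ->
          bounded_in_prob P (err s) (fun n => ln n%:R `^ (- (s / 2))),
        forall alpha C : R, 0 < alpha -> 0 < C ->
          (forall u, C * expR (- (alpha * `|u|)) <= g u) ->
          forall s : R, 0 < s ->
          bounded_in_prob P (err s) (fun n => ln n%:R `^ (- s)) &
        forall beta C : R, 0 <= beta -> 0 < C ->
          (forall u, C * (1 + `|u|) `^ (- beta) <= g u) ->
          forall s : R, 0 < s ->
          bounded_in_prob P (err s) (fun n =>
            if beta == 0 then root_rate n else
            Num.max ((ln n%:R `^ (1 / 2 + 2 * delta) * root_rate n)
                       `^ (s / beta))
                    (root_rate n))]) /\
  (* The constants of the two general bounds, continuous in |b| and nu(R)
     (jointly with the moment E|X_1|^(4 + gamma) and the constant D of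
     dn = O(n^(-1/2)), on which they depend as well) and otherwise
     independent of the process. *)
  (exists2 C : R * R * R * R -> R, continuous C &
    forall (d : measure_display) (Omega : measurableType d)
      (P : probability Omega R) (X : R -> {RV P >-> R})
      (b : R) (nu : finite_borel_measure R) (D : R) (dn : nat -> R)
      (bhat : nat -> {RV P >-> R})
      (nuhat : nat -> Omega -> finite_borel_measure R),
    min_distance_setting gamma delta X b nu dn bhat nuhat ->
    (forall n, (0 < n)%N -> dn n <= D * root_rate n) ->
    let m := abs_moment (4 + gamma) (X 1) in
    let K := C (`|b|, fine (nu setT), fine m, D) in
    forall n, (0 < n)%N ->
      ('E_P[fun o => `|bhat n o - b|%R] <= (K * root_rate n)%:E)%E) /\
  (forall s eps : R, 0 < s -> 0 < eps ->
    exists2 C : R * R * R * R -> R, continuous C &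
    forall (d : measure_display) (Omega : measurableType d)
      (P : probability Omega R) (X : R -> {RV P >-> R})
      (b : R) (nu : finite_borel_measure R) (D : R) (dn : nat -> R)
      (bhat : nat -> {RV P >-> R})
      (nuhat : nat -> Omega -> finite_borel_measure R),
    min_distance_setting gamma delta X b nu dn bhat nuhat ->
    (forall n, (0 < n)%N -> dn n <= D * root_rate n) ->
    let g u := normc (levy_cf b nu u) in
    let m := abs_moment (4 + gamma) (X 1) in
    let K := C (`|b|, fine (nu setT), fine m, D) in
    forall n, (0 < n)%N ->
      ((P^*)%mu [set o | ((K * general_rate s w g n)%:E <
                          loss s (nuhat n o) nu)%E] <= eps%:E)%E).
Proof.
move=> gamma0 delta0 w; split; [|split].
- move=> d Omega P X b nu dn bhat nuhat setting dO g err; split.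
  + exact: (drift_bound_asymptotic gamma0 delta0 setting dO).
  + by move=> s s0; exact: (general_in_prob gamma0 delta0 setting s0 dO).
  + by move=> _ s s0; exact: (gaussian_in_prob gamma0 delta0 setting s0 dO).
  + move=> alpha C a0 C0 decay s s0; rewrite -[s in - s]divr1.
    apply: (exponential_in_prob gamma0 delta0 setting s0 a0 C0 (lexx 1) _ dO) => u.
    by rewrite powRr1.
  + move=> beta C b0 C0 decay s s0.
    exact: (polynomial_in_prob gamma0 delta0 setting s0 b0 C0 decay dO).
- exists (fun t => 4 * deviation_constant gamma delta t.1.2 + t.2).
    apply: continuous_add; last by move=> t; exact: cvg_snd.
    apply: continuous_mul; first exact: continuous_cst.
    exact: continuous_deviation.
  move=> d Omega P X b nu D dn bhat nuhat setting dD m K n n0.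
  exact: (drift_estimation_error gamma0 delta0 setting n0 (dD n n0)).
- move=> s eps s0 eps0.
  pose M (t : R * R * R * R) :=
    4 * ((deviation_constant gamma delta t.1.2 + 1) / eps) + t.2.
  exists (fun t => (22 * (1 + t.1.1.1 + 2 * t.1.1.2) ^+ 2 + 8 * t.1.1.2 +
    4 * t.1.1.1 ^+ 2 + 4 * M t) * (1 + M t)).
    exact: continuous_loss_constant.
  move=> d Omega P X b nu D dn bhat nuhat setting dD g m K n n0.
  exact: (general_loss_bound gamma0 delta0 setting s0 eps0 n0 (dD n n0)).
Qed.
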